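(* For any given $K_0>1$ there exist $\varepsilon_0=\varepsilon_0(K_0)>0$ and $L=L(K_0)>1$ such that the following holds. Let $\zeta_0$ and $\zeta_1$ be two $C^3$ critical commuting pairs which are $K_0$-controlled, both having negative Schwarzian, with $\rho(\zeta_0)=\rho(\zeta_1)\in[0,1]\setminus\mathbb{Q}$ and $d_2(\zeta_0,\zeta_1)<\varepsilon_0$. Then $\zeta_0$ and $\zeta_1$ are $L$-synchronized.
   Context: Critical commuting pairs: a $C^r$ critical commuting pair $\zeta=(\eta,\xi)$ consists of two $C^r$ orientation preserving homeomorphisms $\eta:I_\eta\to\eta(I_\eta)$, $\xi:I_\xi\to\xi(I_\xi)$ with: (1) $I_\eta=[0,\xi(0)]$ and $I_\xi=[\eta(0),0]$ compact intervals in $\mathbb{R}$; (2) $(\eta\circ\xi)(0)=(\xi\circ\eta)(0)\ne0$; (3) $D\eta>0$ on $I_\eta\setminus\{0\}$ and $D\xi>0$ on $I_\xi\setminus\{0\}$; (4) there exist a positive integer $d$, an open interval $C\ni0$ and orientation preserving $C^r$ diffeomorphisms $\phi:C\to\phi(C)$, $\psi:C\to\psi(C)$ fixing $0$ with $\eta(x)=\phi(x)^{2d+1}+\eta(0)$ on $C\cap I_\eta$ and $\xi(x)=\psi(x)^{2d+1}+\xi(0)$ on $C\cap I_\xi$; (5) $D_-^j(\eta\circ\xi)(0)=D_+^j(\xi\circ\eta)(0)$ for $1\le j\le r$. It is normalized if $|I_\xi|=1$, i.e. $\eta(0)=-1$. It has negative Schwarzian if $S\eta<0$ on $I_\eta\setminus\{0\}$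 and $S\xi<0$ on $I_\xi\setminus\{0\}$, where $Sf=\frac{D^3f}{Df}-\frac32\big(\frac{D^2f}{Df}\big)^2$. Renormalization: if $(\xi\circ\eta)(0)\in I_\eta$, the period $\chi(\zeta)$ is the $a\in\mathbb{N}$ with $\eta^{a+1}(\xi(0))<0\le\eta^a(\xi(0))$ ($\infty$ if none); $\zeta$ is renormalizable if $a=\chi(\zeta)<\infty$, with pre-renormalization $p\mathcal{R}(\zeta)=(\eta|_{[0,\eta^a(\xi(0))]},\ \eta^a\circ\xi|_{I_\xi})$. If $(\xi\circ\eta)(0)\in I_\xi$ the definition is analogous: $\xi^a(\eta(0))\le0<\xi^{a+1}(\eta(0))$ and $p\mathcal{R}(\zeta)=(\xi^a\circ\eta|_{I_\eta},\ \xi|_{[\xi^a(\eta(0)),0]})$. $\mathcal{R}(\zeta)$ is $p\mathcal{R}(\zeta)$ linearly rescaled so as to be normalized. If $\chi(\mathcal{R}^j(\zeta))<\infty$ for all $j\ge0$ ($\zeta$ infinitely renormalizable), the rotation number is $\rho(\zeta)=[\chi(\zeta),\chi(\mathcal{R}(\zeta)),\dots]$, where $[a_0,a_1,\dots]=1/(a_0+1/(a_1+\cdots))$; the rotation number is irrational exactly in this sense. Control: for $K>1$, a normalized $C^3$ critical commuting pair $\zeta=(\eta,\xi)$ which is renormalizable with period $a$ is $K$-controlled if: $1/K\le\xi(0)\le K$; $\xi(0)-\eta(\xi(0))\ge1/K$; $\eta^{a-1}(\xi(0))-\eta^a(\xi(0))\ge1/K$; $\eta^a(\xi(0))\ge1/K$;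 $\eta^{a+1}(\xi(0))\le-1/K$; $\|\xi\|_{C^3([-1,0])}\le K$ and $\|\eta\|_{C^3([0,\xi(0)])}\le K$; $D\eta(x)\ge1/K$ for all $x\in[\eta^a(\xi(0)),\xi(0)]$. Metric: for critical commuting pairs $\zeta_i=(\eta_i,\xi_i)$ let $A_i$ be the M\''obius transformation with $A_i(\eta_i(0))=-1$, $A_i(0)=0$, $A_i(\xi_i(0))=1$, and view $\zeta_i$ as the piecewise map equal to $\xi_i$ on $I_{\xi_i}$ and $\eta_i$ on $I_{\eta_i}$. Then $d_r(\zeta_1,\zeta_2)=\max\big\{\big|\frac{\xi_1(0)}{\eta_1(0)}-\frac{\xi_2(0)}{\eta_2(0)}\big|,\ \|A_1\circ\zeta_1\circ A_1^{-1}-A_2\circ\zeta_2\circ A_2^{-1}\|_r\big\}$, where $\|\cdot\|_r$ is the $C^r$ norm for maps on $[-1,1]$ with one discontinuity at $0$ (maximum over the two branches). Synchronization: two controlled pairs $\zeta_0=(\eta_0,\xi_0)$ and $\zeta_1=(\eta_1,\xi_1)$, renormalizable with the same period $a$, are $L$-synchronized if $|\eta_1^a(\xi_1(0))-\eta_0^a(\xi_0(0))|\le L\,d_2(\zeta_0,\zeta_1)$. *)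

(* Defs.v *)
From HB Require Import structures.
From mathcomp Require Import all_boot all_order all_algebra.
From mathcomp Require Import all_classical all_reals all_analysis.
From mathcomp Require Import ring lra.
Set Implicit Arguments.
Unset Strict Implicit.
Unset Printing Implicit Defensive.
Import Order.TTheory GRing.Theory Num.Theory.
Import numFieldNormedType.Exports.
Local Open Scope classical_set_scope.
Local Open Scope ring_scope.

(** * C^r maps on subsets of the line

    Derivatives are taken relative to a set [A]: they are one-sided at the
    endpoints of an interval, and for [x] in [A] they depend only on the values
    of [f] on [A]. *)

Section Smoothness.
Variable R : realType.
Implicit Types (A : set R) (f : R -> R).

Definition diffq f (x y : R) : R := (f y - f x) / (y - x).

Definition derivable_within A f (x : R) : Prop :=
  cvg (diffq f x y @[y --> within A x^']).

Definition deriv_within A f (x : R) : R :=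
  lim (diffq f x y @[y --> within A x^']).

Definition derivn_within A (n : nat) f : R -> R := iter n (deriv_within A) f.

Definition Cr (r : nat) A f : Prop :=
  (forall k, (k < r)%N ->
     forall x, A x -> derivable_within A (derivn_within A k f) x) /\
  (forall k, (k <= r)%N -> {within A, continuous (derivn_within A k f)}).

(* The supremum is taken in the extended reals, so that an unbounded
   derivative gives the value +oo. *)
Definition Cr_norm (r : nat) A f : \bar R :=
  ereal_sup [set y | exists j x,
    [/\ (j <= r)%N, A x & y = (`|derivn_within A j f x|)%:E]].

Definition increasing_on A f : Prop :=
  forall x y, A x -> A y -> x < y -> f x < f y.

Definition op_homeo A f : Prop :=
  [/\ increasing_on A f, {within A, continuous f} &
      exists g, (forall x, A x -> g (f x) = x) /\
                {within f @` A, continuous g}].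

Definition op_Cr_diffeo (r : nat) A f : Prop :=
  [/\ increasing_on A f, Cr r A f &
      exists g, (forall x, A x -> g (f x) = x) /\ Cr r (f @` A) g].

Definition schwarzian A f (x : R) : R :=
  derivn_within A 3 f x / derivn_within A 1 f x
  - 3 / 2 * (derivn_within A 2 f x / derivn_within A 1 f x) ^+ 2.

End Smoothness.

(** * Critical commuting pairs *)

(* The two maps are total functions, but only their restrictions to
   [I_eta] and [I_xi] below are meaningful. *)
Record map_pair (R : realType) := MapPair { eta : R -> R; xi : R -> R }.

Section Pairs.
Variable R : realType.
Implicit Types z : map_pair R.

Definition I_eta z : set R := `[0, xi z 0].
Definition I_xi z : set R := `[eta z 0, 0].

Definition critical_commuting_pair (r : nat) z : Prop :=
  (* the domains are nondegenerate *)
  (eta z 0 < 0 < xi z 0) /\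
  (op_homeo (I_eta z) (eta z) /\ Cr r (I_eta z) (eta z)) /\
  (op_homeo (I_xi z) (xi z) /\ Cr r (I_xi z) (xi z)) /\
  (eta z (xi z 0) = xi z (eta z 0) /\ eta z (xi z 0) != 0) /\
  (forall x, I_eta z x -> x != 0 -> 0 < deriv_within (I_eta z) (eta z) x) /\
  (forall x, I_xi z x -> x != 0 -> 0 < deriv_within (I_xi z) (xi z) x) /\
  (exists (d : nat) (C : set R) (phi psi : R -> R),
     [/\ (0 < d)%N, open C, is_interval C & C 0] /\
     [/\ op_Cr_diffeo r C phi, op_Cr_diffeo r C psi, phi 0 = 0 & psi 0 = 0] /\
     (forall x, C x -> I_eta z x ->
        eta z x = phi x ^+ (2 * d + 1) + eta z 0) /\
     (forall x, C x -> I_xi z x ->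
        xi z x = psi x ^+ (2 * d + 1) + xi z 0)) /\
  (* The domain of [eta \o xi] is an interval with right endpoint 0 and that
     of [xi \o eta] one with left endpoint 0, so these are D_-^j and D_+^j. *)
  (forall j, (1 <= j <= r)%N ->
     derivn_within (I_xi z `&` xi z @^-1` I_eta z) j (eta z \o xi z) 0 =
     derivn_within (I_eta z `&` eta z @^-1` I_xi z) j (xi z \o eta z) 0).

Definition normalized z : Prop := eta z 0 = -1.

Definition negative_schwarzian z : Prop :=
  (forall x, I_eta z x -> x != 0 -> schwarzian (I_eta z) (eta z) x < 0) /\
  (forall x, I_xi z x -> x != 0 -> schwarzian (I_xi z) (xi z) x < 0).

(** * Renormalization and rotation number *)

(* Which of the two cases of the definition of renormalization applies. *)
Definition lands_in_eta z : Prop := I_eta z (xi z (eta z 0)).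
Definition lands_in_xi z : Prop := I_xi z (xi z (eta z 0)).

(* The iterates are required to stay in the domain of the map, since its
   values elsewhere are meaningless. *)
Definition is_period_eta z (a : nat) : Prop :=
  (forall k, (k <= a)%N -> I_eta z (iter k (eta z) (xi z 0))) /\
  iter a.+1 (eta z) (xi z 0) < 0.

Definition is_period_xi z (a : nat) : Prop :=
  (forall k, (k <= a)%N -> I_xi z (iter k (xi z) (eta z 0))) /\
  0 < iter a.+1 (xi z) (eta z 0).

Definition is_period z (a : nat) : Prop :=
  if `[< lands_in_eta z >] then is_period_eta z a
  else lands_in_xi z /\ is_period_xi z a.

(* [None] stands for an infinite period. *)
Definition period z : option nat :=
  xget None [set o | exists2 a, o = Some a & is_period z a].

Lemma is_period_uniq z a b : is_period z a -> is_period z b -> a = b.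
Proof.
rewrite /is_period; case: ifP => _.
- move=> [ha la] [hb lb]; case: (ltngtP a b) => // lt_ab.
  + by have := hb _ lt_ab; rewrite /I_eta /= in_itv /= leNgt la.
  + by have := ha _ lt_ab; rewrite /I_eta /= in_itv /= leNgt lb.
- move=> [_ [ha la]] [_ [hb lb]]; case: (ltngtP a b) => // lt_ab.
  + by have := hb _ lt_ab; rewrite /I_xi /= in_itv /= andbC leNgt la.
  + by have := ha _ lt_ab; rewrite /I_xi /= in_itv /= andbC leNgt lb.
Qed.

Lemma periodP z a : period z = Some a <-> is_period z a.
Proof.
split=> [|pa].
- rewrite /period; case: xgetP => [_ -> [b -> pb] [<-]|] //.
- rewrite /period; case: xgetP => [_ -> [b -> pb]|/(_ (Some a))].
  + by rewrite (is_period_uniq pa pb).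
  + by case; exists a.
Qed.

Definition pre_renorm z : map_pair R :=
  if period z is Some a then
    if `[< lands_in_eta z >] then MapPair (eta z) (iter a (eta z) \o xi z)
    else MapPair (iter a (xi z) \o eta z) (xi z)
  else z.

Definition rescale z : map_pair R :=
  let l := - eta z 0 in
  MapPair (fun x => eta z (l * x) / l) (fun x => xi z (l * x) / l).

Definition renorm z : map_pair R := rescale (pre_renorm z).

Definition infinitely_renormalizable z : Prop :=
  forall j, period (iter j renorm z) <> None.

(* n-th convergent of 1 / (a 0 + 1 / (a 1 + ...)) *)
Fixpoint convergent (a : nat -> nat) (n : nat) : R :=
  if n is n'.+1 then ((a 0)%:R + convergent (fun k => a k.+1) n')^-1 else 0.

(* Meaningful for infinitely renormalizable pairs only. *)
Definition rotation_number z : R :=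
  limn (convergent (fun j => odflt 0%N (period (iter j renorm z)))).

(** * Control, metric and synchronization *)

Definition controlled (K : R) z : Prop :=
  critical_commuting_pair 3 z /\ normalized z /\
  exists a : nat,
  (* The conditions below involve eta^a(xi(0)), so they only make sense when
     the renormalization is of the first kind. *)
  [/\ lands_in_eta z & period z = Some a] /\
  let c k := iter k (eta z) (xi z 0) in
      K^-1 <= xi z 0 <= K /\
      K^-1 <= xi z 0 - eta z (xi z 0) /\
      K^-1 <= c a.-1 - c a /\
      K^-1 <= c a /\
      c a.+1 <= - K^-1 /\
      (Cr_norm 3 (`[(-1)%R, 0%R]) (xi z) <= K%:E)%E /\
      (Cr_norm 3 (`[0%R, xi z 0]) (eta z) <= K%:E)%E /\
      (forall x, c a <= x <= xi z 0 -> K^-1 <= deriv_within (I_eta z) (eta z) x).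

(* The Moebius transformation sending [p] to -1, 0 to 0 and [q] to 1, and its
   inverse (see the lemmas below). *)
Definition mobius (p q x : R) : R :=
  (q - p) * x / ((p + q) * x - 2 * p * q).

Definition mobius_inv (p q y : R) : R :=
  2 * p * q * y / ((p + q) * y - (q - p)).

Lemma mobius_values p q : p < 0 < q ->
  [/\ mobius p q p = -1, mobius p q 0 = 0, mobius p q q = 1 &
      (q - p) * (- (2 * p * q)) - 0 * (p + q) != 0].
Proof.
move=> /andP[p0 q0].
have p0' : p != 0 by rewrite lt_eqF.
have q0' : q != 0 by rewrite gt_eqF.
have qp : q - p != 0 by rewrite gt_eqF// subr_gt0 (lt_trans p0).
rewrite /mobius; split.
- rewrite (_ : (p + q) * p - _ = - ((q - p) * p)); last by ring.
  by rewrite invrN mulrN divff// mulf_neq0.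
- by rewrite mulr0 mul0r.
- rewrite (_ : (p + q) * q - _ = (q - p) * q); last by ring.
  by rewrite divff// mulf_neq0.
- by rewrite mul0r subr0 mulf_neq0 ?oppr_eq0 ?mulf_neq0// pnatr_eq0.
Qed.

Lemma mobius_invK p q y : p < 0 < q -> -1 <= y <= 1 ->
  p <= mobius_inv p q y <= q /\ mobius p q (mobius_inv p q y) = y.
Proof.
move=> /andP[p0 q0] /andP[y1 y2].
have den : (p + q) * y - (q - p) < 0 by nra.
have den0 : (p + q) * y - (q - p) != 0 by rewrite lt_eqF.
split.
  rewrite /mobius_inv ler_ndivlMr// ler_ndivrMr//.
  rewrite -subr_ge0 -[X in _ && X]subr_ge0; apply/andP; split.
    rewrite (_ : _ - _ = (- p) * (q - p) * (y + 1)); last by ring.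
    by rewrite !mulr_ge0//; lra.
  rewrite (_ : _ - _ = q * (q - p) * (1 - y)); last by ring.
  by rewrite !mulr_ge0//; lra.
have p0' : p != 0 by rewrite lt_eqF.
have q0' : q != 0 by rewrite gt_eqF.
have qp : q - p != 0 by rewrite gt_eqF// subr_gt0 (lt_trans p0).
rewrite /mobius /mobius_inv.
rewrite [X in _ / X](_ : _ = 2 * p * q * (q - p) / ((p + q) * y - (q - p))).
  by field; rewrite den0 p0' q0' qp.
by field.
Qed.

Definition conj_eta z : R -> R :=
  mobius (eta z 0) (xi z 0) \o eta z \o mobius_inv (eta z 0) (xi z 0).

Definition conj_xi z : R -> R :=
  mobius (eta z 0) (xi z 0) \o xi z \o mobius_inv (eta z 0) (xi z 0).

Definition pair_dist (r : nat) z1 z2 : \bar R :=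
  maxe (`|xi z1 0 / eta z1 0 - xi z2 0 / eta z2 0|)%:E
    (maxe (Cr_norm r (`[(-1)%R, 0%R]) (fun x => conj_xi z1 x - conj_xi z2 x))
          (Cr_norm r (`[0%R, 1%R]) (fun x => conj_eta z1 x - conj_eta z2 x))).

Definition synchronized (L : R) z0 z1 : Prop :=
  exists a : nat, [/\ period z0 = Some a, period z1 = Some a &
    ((`|iter a (eta z1) (xi z1 0) - iter a (eta z0) (xi z0 0)|)%:E
      <= L%:E * pair_dist 2 z0 z1)%E].

End Pairs.

(* Main.v *)
Require Import Defs.
From mathcomp Require Import all_boot all_order all_algebra.
From mathcomp Require Import all_classical all_reals all_analysis.
From mathcomp Require Import ring lra.
Set Implicit Arguments.
Unset Strict Implicit.
Unset Printing Implicit Defensive.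
Import Order.TTheory GRing.Theory Num.Theory.
Import numFieldNormedType.Exports.
Local Open Scope classical_set_scope.
Local Open Scope ring_scope.

(** Both pairs are read in the coordinate of the first one: the Moebius changes
    of coordinate that define the metric carry the second pair to a pair on the
    interval [-1, q] of the first, q being [xi z0 0], and turn [eta z1] into a map
    F = f + e where f is [eta z0] and e, e', e'' are O(delta) for delta the
    distance ([small_hat]). It is enough to bound the last landing point F^a(q)
    from above by f^a(q) + O(delta), since the roles of the pairs can be exchanged.

    Suppose that F^a(q) exceeds f^a(q) by a large multiple of delta. The claim is
    that F^a is then above f^a by a multiple of delta on the whole fundamental
    domain [f(q), q] ([gap_core]). Otherwise, by the intermediate value theorem,
    at some point xs the two landing points differ by a moderate multiple of
    delta, and two facts, both with constants independent of the period a, show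
    that the difference would stay O(delta) up to q.

    (1) The two orbits of xs, which start together and land O(delta) apart, are
    O(delta)-close at all intermediate times ([orbits_close]). Negative
    Schwarzian says that (f')^(-1/2) is convex; hence the gap x - f(x) is either
    bounded below, and a is bounded, or has one minimum p, at which it is
    quadratic with uniform constants, and is bounded below away from p. Outside
    a fixed window around p the orbits make boundedly many steps. In the window,
    with each map centred at the minimum of its own gap, the two gap functions
    have second derivatives O(delta)-close; if the minimal gaps were not
    comparable up to a factor 1 + O(delta), one orbit would be delayed, and the
    contraction z |-> (1 - b) z with b = O(delta) is a barrier along which the
    orbits can be compared ([transit_close]).

    (2) For C on the right of xs in its fundamental domain, let r_k be the position of
    f^k(C) relative to the fundamental domain (f^(k+1)(xs), f^k(xs)). The
    increments of r_k are second-order Taylor quotients times the lengths of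
    these domains, which are summable, and a discrete Gronwall argument gives
    that F^a(C) - f^a(C) is O(delta) ([ratio_close], [distortion]).

    So all return maps F^a xi of the second pair exceed those of the first by
    some kappa > 0, and the pairs renormalized twice are ordered on the whole
    line, with a gap kappa. Two such pairs do not have the same sequence of
    periods ([ordered_contra]): along n renormalizations, for all points p and all q, r
    not below p, either the long composition of the lower pair maps q strictly
    below the image of r under the upper one, or the images of p and q met on the way are
    apart by a total of n kappa; but the total distance that is available is
    the same at all levels, so that for large n the first case would hold at
    points where it contradicts the combinatorics. On the other hand pairs with
    the same irrational rotation number have the same periods by uniqueness of
    continued fractions ([rotation_number_inj]). *)

(** * Compositions of two ordered families of maps *)

Section Towers.
Variables (R : realType) (kappa : R).
Hypothesis kappa_ge0 : 0 <= kappa.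
Implicit Types W U V S : R -> R.

(** [W0] and [W1] stand for long compositions of maps of two families, each map
    of the second being above the corresponding one by [kappa]; [S] is the sum
    of the [n] partial compositions of [W0]. At each stage either the image of
    [q] is already strictly below that of [r], and then it stays there, or the
    images of [p] and [q] are at least [kappa] apart; [S q - S p] adds up these
    distances. *)
Record tower (n : nat) S W0 W1 : Prop := Tower {
  tower_homo : {homo W0 : x y / x <= y};
  tower_gap : forall x, W0 x + kappa <= W1 x;
  tower_homoS : {homo S : x y / x <= y};
  tower_alt : forall p q r, p <= q -> p <= r ->
    W0 q < W1 r \/ n%:R * kappa <= S q - S p }.

Lemma tower1 W0 W1 : {homo W0 : x y / x <= y} ->
  (forall x, W0 x + kappa <= W1 x) -> tower 1 W0 W0 W1.
Proof.
move=> hW gap; split=> // p q r pq pr.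
have [h|h] := ltP (W0 q) (W1 r); [by left|right].
by have := gap r; have := hW _ _ pr; lra.
Qed.

(** If the inner alternative gives a strict inequality, the outer maps keep it;
    otherwise the displacements of the two parts add up. *)
Lemma tower_comp n m S S' U0 U1 V0 V1 : 0 < kappa ->
  tower n S U0 U1 -> tower m S' V0 V1 ->
  tower (n + m) (fun x => S x + S' (U0 x)) (V0 \o U0) (V1 \o U1).
Proof.
move=> k0 [hU gU hS aU] [hV gV hS' aV]; split.
- by move=> x y xy /=; apply/hV/hU.
- move=> x /=; have := gV (U1 x).
  have /hV : U0 x <= U1 x by have := gU x; lra.
  lra.
- by move=> x y xy; apply: lerD; [exact: hS | exact/hS'/hU].
- move=> p q r pq pr /=; case: (aU _ _ _ pq pr) => [|hn].
    move=> lt; left; have := gV (U1 r); have := hV _ _ (ltW lt); lra.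
  have pr' : U0 p <= U1 r by have := gU r; have := hU _ _ pr; lra.
  case: (aV _ _ _ (hU _ _ pq) pr') => [?|hm]; first by left.
  by right; rewrite natrD mulrDl; lra.
Qed.

Lemma tower_weaken n m S W0 W1 : (m <= n)%N -> tower n S W0 W1 ->
  tower m S W0 W1.
Proof.
move=> mn [hW gW hS aW]; split=> // p q r pq pr.
case: (aW _ _ _ pq pr) => [?|h]; first by left.
right; apply: le_trans h; apply: ler_wpM2r => //; by rewrite ler_nat.
Qed.

(** The displacement of [S] over the two intervals on which a commuting pair
    lives is bounded by [T]; the bound is the same at all levels because a
    renormalization cuts these intervals and moves the pieces around. *)
Definition tower_pair (n : nat) (T : R) (H0 X0 H1 X1 : R -> R) : Prop :=
  exists m SH SX, [/\ (0 < m)%N, tower m SH H0 H1, tower n SX X0 X1,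
    H0 (X0 0) = X0 (H0 0) &
    (SX 0 - SX (H0 0)) + (SH (X0 0) - SH 0) <= T].

Lemma tower_pair_eta n T H0 X0 H1 X1 a : 0 < kappa ->
  tower_pair n T H0 X0 H1 X1 ->
  tower_pair (n + a) T H0 (iter a H0 \o X0) H1 (iter a H1 \o X1).
Proof.
move=> k0 tp; elim: a => [|a]; first by rewrite addn0.
move=> [m [SH [SX [m0 tH tX com tot]]]].
exists m, SH, (fun x => SX x + SH ((iter a H0 \o X0) x)).
split=> //.
- have le : (n + a.+1 <= n + a + m)%N by rewrite addnS -addn1 leq_add2l.
  exact: tower_weaken le (tower_comp k0 tX tH).
- by move: com => /= ->.
- move: com tot => /= <-; lra.
Qed.

Lemma tower_pair_xi n T H0 X0 H1 X1 a : 0 < kappa ->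
  tower_pair n T H0 X0 H1 X1 ->
  tower_pair n T (iter a X0 \o H0) X0 (iter a X1 \o H1) X1.
Proof.
move=> k0 tp; elim: a => [|a] //.
move=> [m [SH [SX [m0 tH tX com tot]]]].
exists (m + n)%N, (fun x => SH x + SX ((iter a X0 \o H0) x)), SX.
split=> //.
- by rewrite addn_gt0 m0.
- exact: (tower_comp k0 tH tX).
- by move: com => /= ->.
- move: com tot => /= ->; lra.
Qed.

Lemma tower_pair_bound n T H0 X0 H1 X1 : tower_pair n T H0 X0 H1 X1 ->
  H0 0 <= 0 -> 0 <= X0 0 -> X1 (H1 0) <= X0 0 -> n%:R * kappa <= T.
Proof.
move=> [m [SH [SX [_ tH tX com tot]]]] h0 x0 le.
have hr : H0 0 <= H1 0 by have := tower_gap tH 0; move: kappa_ge0; lra.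
case: (tower_alt tX h0 hr) => [lt|]; first by rewrite ltNge le in lt.
have := tower_homoS tH x0; lra.
Qed.

End Towers.

(** * Renormalization through monotone models *)

Section Models.
Variable R : realType.
Implicit Types (z : map_pair R) (th H X : R -> R).

(** The part of a commuting pair that renormalization preserves without any
    smoothness. *)
Record top_pair z : Prop := TopPair {
  top_eta0 : eta z 0 < 0;
  top_xi0 : 0 < xi z 0;
  top_eta_homo : forall x y, 0 <= x -> x <= y -> y <= xi z 0 -> eta z x <= eta z y;
  top_xi_homo : forall x y, eta z 0 <= x -> x <= y -> y <= 0 -> xi z x <= xi z y;
  top_com : eta z (xi z 0) = xi z (eta z 0) }.

(** [H] and [X] are maps of the whole line that act on the image of the intervals
    of [z] as [eta z] and [xi z] do. Under renormalization only the coordinate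
    [th] is rescaled: the maps are composed and nothing else happens to them. *)
Record models z th H X : Prop := Models {
  models0 : th 0 = 0;
  models_incr : forall x y, eta z 0 <= x -> x < y -> y <= xi z 0 -> th x < th y;
  models_eta : forall x, 0 <= x <= xi z 0 -> H (th x) = th (eta z x);
  models_xi : forall x, eta z 0 <= x <= 0 -> X (th x) = th (xi z x) }.

Lemma lands_in_etaE z : lands_in_eta z <-> 0 <= xi z (eta z 0) <= xi z 0.
Proof. by rewrite /lands_in_eta /I_eta /= in_itv. Qed.

Lemma iter_eta_xi z a x k : top_pair z -> is_period_eta z a ->
  eta z 0 <= x <= 0 -> (k <= a)%N ->
  iter k.+1 (eta z) (xi z 0) <= iter k (eta z) (xi z x) <= iter k (eta z) (xi z 0).
Proof.
move=> tp [inI _] /andP[x1 x2]; elim: k => [_|k IH ka] /=.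
  by rewrite (top_com tp); apply/andP; split; apply: (top_xi_homo tp); lra.
have /andP[l u] := IH (ltnW ka).
have := inI _ (ltnW ka); rewrite /I_eta /= in_itv /= => /andP[k0 kq].
have := inI _ ka; rewrite /I_eta /= in_itv /= => /andP[k0' kq'].
move: l => /= l.
by apply/andP; split; apply: (top_eta_homo tp) => //; lra.
Qed.

Lemma iter_xi_eta z a x k : top_pair z -> is_period_xi z a ->
  0 <= x <= xi z 0 -> (k <= a)%N ->
  iter k (xi z) (eta z 0) <= iter k (xi z) (eta z x) <= iter k.+1 (xi z) (eta z 0).
Proof.
move=> tp [inI _] /andP[x1 x2]; elim: k => [_|k IH ka] /=.
  by rewrite -(top_com tp); apply/andP; split; apply: (top_eta_homo tp); lra.
have /andP[l u] := IH (ltnW ka).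
have := inI _ (ltnW ka); rewrite /I_xi /= in_itv /= => /andP[k0 kq].
have := inI _ ka; rewrite /I_xi /= in_itv /= => /andP[k0' kq'].
move: u => /= u.
by apply/andP; split; apply: (top_xi_homo tp) => //; lra.
Qed.

Lemma models_iter_eta z th H X a x k : top_pair z -> models z th H X ->
  is_period_eta z a -> eta z 0 <= x <= 0 -> (k <= a)%N ->
  iter k H (X (th x)) = th (iter k (eta z) (xi z x)).
Proof.
move=> tp md per xI; elim: k => [_|k IH ka] /=; first exact: (models_xi md).
rewrite IH ?(ltnW ka)//; apply: (models_eta md).
have /andP[l u] := iter_eta_xi tp per xI (ltnW ka).
have := per.1 _ (ltnW ka); have := per.1 _ ka.
rewrite /I_eta /= !in_itv /=; move: l => /=; lra.
Qed.

Lemma models_iter_xi z th H X a x k : top_pair z -> models z th H X ->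
  is_period_xi z a -> 0 <= x <= xi z 0 -> (k <= a)%N ->
  iter k X (H (th x)) = th (iter k (xi z) (eta z x)).
Proof.
move=> tp md per xI; elim: k => [_|k IH ka] /=; first exact: (models_eta md).
rewrite IH ?(ltnW ka)//; apply: (models_xi md).
have /andP[l u] := iter_xi_eta tp per xI (ltnW ka).
have := per.1 _ (ltnW ka); have := per.1 _ ka.
rewrite /I_xi /= !in_itv /=; move: u => /=; lra.
Qed.

(** Renormalization of a pair that lands on the right: the model of [xi] becomes
    a composition and the next renormalization is of the other kind. That there
    is a next one forces the new [xi] to be positive at 0. *)
Lemma renorm_eta z th H X a : top_pair z -> models z th H X ->
  lands_in_eta z -> period z = Some a -> period (renorm z) <> None ->
  [/\ (0 < a)%N, top_pair (renorm z), ~ lands_in_eta (renorm z) &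
      models (renorm z) (fun x => th (- eta z 0 * x)) H (iter a H \o X)].
Proof.
move=> tp md le pa nz.
have per : is_period_eta z a.
  by move/periodP: (pa); rewrite /is_period; case: asboolP.
have e0 := top_eta0 tp; have x0 := top_xi0 tp.
set l := - eta z 0.
have l0 : 0 < l by rewrite /l; lra.
have a0 : (0 < a)%N.
  case: a pa per => // pa [_] /=; rewrite (top_com tp).
  by move/lands_in_etaE: le; lra.
have rE : renorm z = MapPair (fun x => eta z (l * x) / l)
                             (fun x => iter a (eta z) (xi z (l * x)) / l).
  by rewrite /renorm /pre_renorm pa; case: asboolP.
move: nz rE; move: (renorm z) => z' nz rE.
have e1 : eta z' 0 = eta z 0 / l by rewrite rE /= mulr0.
have x1 : xi z' 0 = iter a (eta z) (xi z 0) / l by rewrite rE /= mulr0.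
have ca : 0 <= iter a (eta z) (xi z 0) <= xi z 0.
  by have := per.1 _ (leqnn a); rewrite /I_eta /= in_itv.
have lK x : l * (x / l) = x by rewrite mulrC divfK// gt_eqF.
have re1 : l * eta z' 0 = eta z 0 by rewrite e1 lK.
have rx1 : l * xi z' 0 = iter a (eta z) (xi z 0) by rewrite x1 lK.
have ltm x y : (l * x < l * y) = (x < y) by rewrite ltr_pM2l.
have lem x y : (l * x <= l * y) = (x <= y) by rewrite ler_pM2l.
have homoX x y : eta z 0 <= x -> x <= y -> y <= 0 ->
  iter a (eta z) (xi z x) <= iter a (eta z) (xi z y).
  move=> x1' xy y0; elim: {-2}a (leqnn a) => [_|k IH ka] /=.
    exact: (top_xi_homo tp).
  have xI : eta z 0 <= x <= 0 by lra.
  have yI : eta z 0 <= y <= 0 by lra.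
  have /andP[lx ux] := iter_eta_xi tp per xI (ltnW ka).
  have /andP[ly uy] := iter_eta_xi tp per yI (ltnW ka).
  have := per.1 _ (ltnW ka); have := per.1 _ ka.
  rewrite /I_eta /= !in_itv /= => /andP[? ?] /andP[? ?].
  apply: (top_eta_homo tp); [|exact: IH (ltnW ka)|]; move: lx => /=; lra.
have tp1' : eta z' (xi z' 0) = xi z' (eta z' 0).
  have -> : eta z' (xi z' 0) = eta z (l * xi z' 0) / l by rewrite {1}rE.
  have -> : xi z' (eta z' 0) = iter a (eta z) (xi z (l * eta z' 0)) / l by rewrite {1}rE.
  by rewrite rx1 re1 -(top_com tp) -iterS iterSr.
have neg : xi z' (eta z' 0) < 0.
  rewrite -tp1' -(pmulr_rlt0 _ l0).
  have -> : eta z' (xi z' 0) = eta z (l * xi z' 0) / l by rewrite {1}rE.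
  by rewrite lK rx1; exact: per.2.
have nl : ~ lands_in_eta z'.
  by move/lands_in_etaE; lra.
have xr0 : 0 < xi z' 0.
  case: (period z') (@periodP _ z') nz => // b /(_ b) [/(_ erefl) + _] _.
  rewrite /is_period; case: asboolP => // _ [_] [inI pos].
  rewrite ltNge; apply/negP => xle.
  suff : iter b.+1 (xi z') (eta z' 0) <= xi z' 0 by lra.
  rewrite iterS; have := inI _ (leqnn b); rewrite /I_xi /= in_itv /=.
  set w := iter b _ _ => /andP[w1 w2].
  have -> : xi z' w = iter a (eta z) (xi z (l * w)) / l by rewrite {1}rE.
  rewrite x1 ler_pM2r ?invr_gt0//; apply: homoX => //.
    by rewrite -re1 lem.
  by rewrite -(mulr0 l) lem.
split=> //.
- split=> //.
  + by rewrite e1 pmulr_llt0 ?invr_gt0.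
  + move=> x y x1' xy y1; rewrite rE /= ler_pM2r ?invr_gt0//.
    apply: (top_eta_homo tp); rewrite ?lem//; first by rewrite mulr_ge0// ltW.
    by move: y1; rewrite -lem rx1; lra.
  + move=> x y x1' xy y1; rewrite rE /= ler_pM2r ?invr_gt0//.
    apply: homoX; rewrite ?lem//; first by rewrite -re1 lem.
    by rewrite -(mulr0 l) lem.
- split.
  + by rewrite mulr0; exact: (models0 md).
  + move=> x y x1' xy y1; apply: (models_incr md); rewrite ?ltm//.
      by rewrite -re1 lem.
    by move: y1; rewrite -lem rx1; lra.
  + move=> x /andP[x1' x2'].
    have -> : eta z' x = eta z (l * x) / l by rewrite {1}rE.
    rewrite lK; apply: (models_eta md).
    rewrite mulr_ge0//= ?(ltW l0)//; move: x2'; rewrite -lem rx1; lra.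
  + move=> x /andP[x1' x2'].
    have -> : xi z' x = iter a (eta z) (xi z (l * x)) / l by rewrite {1}rE.
    rewrite lK /=; apply: (models_iter_eta tp md per) => //.
    by rewrite -re1 lem x1' -(mulr0 l) lem.
Qed.

Lemma renorm_xi z th H X a : top_pair z -> models z th H X ->
  ~ lands_in_eta z -> period z = Some a -> period (renorm z) <> None ->
  [/\ (0 < a)%N, top_pair (renorm z), lands_in_eta (renorm z) &
      models (renorm z) (fun x => th (- iter a (xi z) (eta z 0) * x))
        (iter a X \o H) X].
Proof.
move=> tp md le pa nz.
have [lx per] : lands_in_xi z /\ is_period_xi z a.
  by move/periodP: (pa); rewrite /is_period; case: asboolP.
have e0 := top_eta0 tp; have x0 := top_xi0 tp.
have a0 : (0 < a)%N.
  case: a pa per => // pa [_] /=.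
  by move: lx; rewrite /lands_in_xi /I_xi /= in_itv /=; lra.
set l := - iter a (xi z) (eta z 0).
have rE : renorm z = MapPair (fun x => iter a (xi z) (eta z (l * x)) / l)
                             (fun x => xi z (l * x) / l).
  by rewrite /renorm /pre_renorm pa; case: asboolP.
move: nz rE; move: (renorm z) => z' nz rE.
have ca : eta z 0 <= iter a (xi z) (eta z 0) <= 0.
  by have := per.1 _ (leqnn a); rewrite /I_xi /= in_itv.
have l0 : 0 < l.
  have : 0 <= l by rewrite /l; lra.
  rewrite le_eqVlt => /orP[/eqP l0|//].
  (* a vanishing scale makes the renormalization zero, and it has no period *)
  exfalso; case E : (period z') nz => [b|] // _.
  move/periodP: E; rewrite /is_period /lands_in_eta /I_eta /is_period_eta rE /= -l0 invr0.
  by rewrite !mulr0 /= in_itv /= !lexx; case: asboolP => // _ [_]; rewrite ?mulr0 ltxx.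
have e1 : eta z' 0 = iter a (xi z) (eta z 0) / l by rewrite rE /= mulr0.
have x1 : xi z' 0 = xi z 0 / l by rewrite rE /= mulr0.
have lK x : l * (x / l) = x by rewrite mulrC divfK// gt_eqF.
have re1 : l * eta z' 0 = iter a (xi z) (eta z 0) by rewrite e1 lK.
have rx1 : l * xi z' 0 = xi z 0 by rewrite x1 lK.
have ltm x y : (l * x < l * y) = (x < y) by rewrite ltr_pM2l.
have lem x y : (l * x <= l * y) = (x <= y) by rewrite ler_pM2l.
have homoH x y : 0 <= x -> x <= y -> y <= xi z 0 ->
  iter a (xi z) (eta z x) <= iter a (xi z) (eta z y).
  move=> x1' xy y0; elim: {-2}a (leqnn a) => [_|k IH ka] /=.
    exact: (top_eta_homo tp).
  have xI : 0 <= x <= xi z 0 by lra.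
  have yI : 0 <= y <= xi z 0 by lra.
  have /andP[lx' ux] := iter_xi_eta tp per xI (ltnW ka).
  have /andP[ly uy] := iter_xi_eta tp per yI (ltnW ka).
  have := per.1 _ (ltnW ka); have := per.1 _ ka.
  rewrite /I_xi /= !in_itv /= => /andP[? ?] /andP[? ?].
  apply: (top_xi_homo tp); [|exact: IH (ltnW ka)|]; move: uy => /=; lra.
have tp1' : eta z' (xi z' 0) = xi z' (eta z' 0).
  have -> : eta z' (xi z' 0) = iter a (xi z) (eta z (l * xi z' 0)) / l by rewrite {1}rE.
  have -> : xi z' (eta z' 0) = xi z (l * eta z' 0) / l by rewrite {1}rE.
  by rewrite rx1 re1 (top_com tp) -iterS iterSr.
have pos : 0 < l * xi z' (eta z' 0).
  have -> : xi z' (eta z' 0) = xi z (l * eta z' 0) / l by rewrite {1}rE.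
  by rewrite lK re1; exact: per.2.
have nl : lands_in_eta z'.
  apply/lands_in_etaE; rewrite -lem mulr0 -[X in _ && X]lem (ltW pos) /= rx1.
  have -> : xi z' (eta z' 0) = xi z (l * eta z' 0) / l by rewrite {1}rE.
  by rewrite lK re1; apply: (top_xi_homo tp); lra.
split=> //.
- split=> //.
  + by rewrite -(pmulr_rlt0 _ l0) re1; rewrite /l in l0; lra.
  + by rewrite -(pmulr_rgt0 _ l0) rx1.
  + move=> x y x1' xy y1; rewrite rE /= ler_pM2r ?invr_gt0//.
    apply: homoH; rewrite ?lem//; first by rewrite mulr_ge0// ltW.
    by rewrite -rx1 lem.
  + move=> x y x1' xy y1; rewrite rE /= ler_pM2r ?invr_gt0//.
    apply: (top_xi_homo tp); rewrite ?lem//; last by rewrite -(mulr0 l) lem.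
    by move: x1'; rewrite -lem re1; lra.
- split.
  + by rewrite mulr0; exact: (models0 md).
  + move=> x y x1' xy y1; apply: (models_incr md); rewrite ?ltm//.
      by move: x1'; rewrite -lem re1; lra.
    by rewrite -rx1 lem.
  + move=> x /andP[x1' x2'].
    have -> : eta z' x = iter a (xi z) (eta z (l * x)) / l by rewrite {1}rE.
    rewrite lK /=; apply: (models_iter_xi tp md per) => //.
    by rewrite -rx1 lem x2' mulr_ge0// ltW.
  + move=> x /andP[x1' x2'].
    have -> : xi z' x = xi z (l * x) / l by rewrite {1}rE.
    rewrite lK; apply: (models_xi md).
    have lx0 : l * x <= 0 by rewrite -(mulr0 l) lem.
    have := lem (eta z' 0) x; rewrite re1 x1'; lra.
Qed.

End Models.

(** * Ordered pairs have different periods *)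

Section Ordered.
Variable R : realType.
Implicit Types (z : map_pair R) (th H X : R -> R).

Lemma inf_renormS z : infinitely_renormalizable z ->
  infinitely_renormalizable (renorm z).
Proof. by move=> h j; rewrite -iterSr; exact: h. Qed.

Lemma inf_period z : infinitely_renormalizable z -> exists a, period z = Some a.
Proof. by move=> /(_ 0%N) /=; case: period => // a _; exists a. Qed.

Lemma not_lands_in_eta z : ~ lands_in_eta z -> period z <> None ->
  eta z 0 <= xi z (eta z 0) <= 0.
Proof.
move=> nl; case E: (period z) => [a|] // _; move/periodP: E.
rewrite /is_period; case: asboolP => // _ [+ _].
by rewrite /lands_in_xi /I_xi /= in_itv.
Qed.

Lemma models_eta0 z th H X : top_pair z -> models z th H X -> H 0 = th (eta z 0).
Proof.
move=> tp md; have x0 := top_xi0 tp.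
by rewrite -(models_eta md) ?(models0 md)// lexx ltW.
Qed.

Lemma models_xi0 z th H X : top_pair z -> models z th H X -> X 0 = th (xi z 0).
Proof.
move=> tp md; have x0 := top_eta0 tp.
by rewrite -(models_xi md) ?(models0 md)// lexx ltW.
Qed.

Lemma models_lt0 z th H X x : top_pair z -> models z th H X ->
  eta z 0 <= x -> x < 0 -> th x < 0.
Proof.
move=> tp md ex x0; have := models_incr md ex x0 (ltW (top_xi0 tp)).
by rewrite (models0 md).
Qed.

Lemma models_gt0 z th H X x : top_pair z -> models z th H X ->
  x <= xi z 0 -> 0 < x -> 0 < th x.
Proof.
move=> tp md ex x0; have := models_incr md (ltW (top_eta0 tp)) x0 ex.
by rewrite (models0 md).
Qed.

(** Each period is positive, so every second renormalization makes the tower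
    of [xi] higher by at least one stage, while [T] stays the same. *)
Lemma ordered_tower_bound (kappa T : R) n z0 z1 th0 th1 H0 X0 H1 X1 m :
  0 < kappa ->
  top_pair z0 -> top_pair z1 -> lands_in_eta z0 -> lands_in_eta z1 ->
  infinitely_renormalizable z0 -> infinitely_renormalizable z1 ->
  (forall j, period (iter j (@renorm R) z0) = period (iter j (@renorm R) z1)) ->
  models z0 th0 H0 X0 -> models z1 th1 H1 X1 ->
  tower_pair kappa m T H0 X0 H1 X1 -> (m + n.+1)%:R * kappa <= T.
Proof.
move=> k0; elim: n z0 z1 th0 th1 H0 X0 H1 X1 m => [|n IH] z0 z1 th0 th1 H0 X0 H1 X1 m
  tp0 tp1 le0 le1 ir0 ir1 same md0 md1 tow.
all: have [a pa0] := inf_period ir0.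
all: have pa1 : period z1 = Some a by rewrite -pa0; exact: esym (same 0%N).
all: have [a0 tp0' nl0 md0'] := renorm_eta tp0 md0 le0 pa0 (ir0 1%N).
all: have [_ tp1' nl1 md1'] := renorm_eta tp1 md1 le1 pa1 (ir1 1%N).
all: have tow' := tower_pair_eta (ltW k0) a k0 tow.
- have ir1' := not_lands_in_eta nl1 (ir1 1%N).
  set z0' := renorm z0 in tp0' md0' *; set z1' := renorm z1 in tp1' md1' ir1' *.
  have e0 := top_eta0 tp0'; have x0 := top_xi0 tp0'.
  have e1 := top_eta0 tp1'; have x1 := top_xi0 tp1'.
  set th0' := (fun x : R => th0 _) in md0'.
  set th1' := (fun x : R => th1 _) in md1'.
  have h0 : H0 0 < 0.
    by rewrite (models_eta0 tp0' md0') (models_lt0 tp0' md0').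
  have h0' : 0 < (iter a H0 \o X0) 0.
    by rewrite (models_xi0 tp0' md0') (models_gt0 tp0' md0').
  have h1 : (iter a H1 \o X1) (H1 0) <= 0.
    rewrite (models_eta0 tp1' md1') (models_xi md1') ?lexx ?(ltW e1)//.
    case/andP: ir1' => l1; rewrite le_eqVlt => /orP[/eqP ->|l2].
      by rewrite (models0 md1').
    exact/ltW/(models_lt0 tp1' md1').
  have le : (m + 1 <= m + a)%N by rewrite leq_add2l.
  apply: (@le_trans _ _ ((m + a)%:R * kappa)).
    by rewrite ler_pM2r// ler_nat.
  apply: (tower_pair_bound (ltW k0) tow'); lra.
have [b pb0] := inf_period (inf_renormS ir0).
have pb1 : period (renorm z1) = Some b by rewrite -pb0; exact: esym (same 1%N).
have [b0 tp0'' le0' md0''] := renorm_xi tp0' md0' nl0 pb0 (ir0 2%N).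
have [_ tp1'' le1' md1''] := renorm_xi tp1' md1' nl1 pb1 (ir1 2%N).
have tow'' := tower_pair_xi b k0 tow'.
have same'' j : period (iter j (@renorm R) (renorm (renorm z0))) =
                period (iter j (@renorm R) (renorm (renorm z1))).
  by have := same j.+2; rewrite !iterSr.
have := IH _ _ _ _ _ _ _ _ _ tp0'' tp1'' le0' le1' (inf_renormS (inf_renormS ir0))
  (inf_renormS (inf_renormS ir1)) same'' md0'' md1'' tow''.
apply: le_trans.
by rewrite ler_pM2r// ler_nat -addnA leq_add2l -[n.+2]add1n leq_add2r.
Qed.

(** Towers of arbitrary height would fit into a bounded displacement. *)
Lemma ordered_contra (kappa : R) z0 z1 th0 th1 H0 X0 H1 X1 :
  0 < kappa ->
  top_pair z0 -> top_pair z1 -> lands_in_eta z0 -> lands_in_eta z1 ->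
  infinitely_renormalizable z0 -> infinitely_renormalizable z1 ->
  (forall j, period (iter j (@renorm R) z0) = period (iter j (@renorm R) z1)) ->
  models z0 th0 H0 X0 -> models z1 th1 H1 X1 ->
  {homo H0 : x y / x <= y} -> {homo X0 : x y / x <= y} ->
  (forall x, H0 x + kappa <= H1 x) -> (forall x, X0 x + kappa <= X1 x) -> False.
Proof.
move=> k0 tp0 tp1 le0 le1 ir0 ir1 same md0 md1 hH hX gH gX.
have com : H0 (X0 0) = X0 (H0 0).
  have e0 := top_eta0 tp0; have x0 := top_xi0 tp0.
  rewrite (models_eta0 tp0 md0) (models_xi0 tp0 md0) (models_xi md0) ?(models_eta md0) ?lexx ?ltW//.
  by rewrite (top_com tp0).
pose T := X0 0 - X0 (H0 0) + (H0 (X0 0) - H0 0).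
have tow : tower_pair kappa 1 T H0 X0 H1 X1.
  by exists 1%N, H0, X0; split=> //; exact: tower1.
pose n := Num.bound `|T / kappa|.
have := ordered_tower_bound n k0 tp0 tp1 le0 le1 ir0 ir1 same md0 md1 tow.
apply/negP; rewrite -ltNge -ltr_pdivrMr//.
apply: le_lt_trans (ler_norm _) _.
apply: lt_le_trans (archi_boundP (normr_ge0 _)) _.
by rewrite ler_nat -/n add1n ltnW.
Qed.

Lemma models_id z : models z id (eta z) (xi z). Proof. by split. Qed.

Lemma renorm_top z : top_pair z -> infinitely_renormalizable z ->
  (0 < odflt 0 (period z))%N /\ top_pair (renorm z).
Proof.
move=> tp ir; have [a pa] := inf_period ir; rewrite pa /=.
have [le|nl] := pselect (lands_in_eta z).
  by have [] := renorm_eta tp (models_id z) le pa (ir 1%N).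
by have [] := renorm_xi tp (models_id z) nl pa (ir 1%N).
Qed.

Lemma digits_gt0 z : top_pair z -> infinitely_renormalizable z ->
  forall j, (0 < odflt 0 (period (iter j (@renorm R) z)))%N.
Proof.
move=> tp ir j; elim: j z tp ir => [|j IH] z tp ir.
  by have [] := renorm_top tp ir.
by rewrite iterSr; apply: IH; [have [] := renorm_top tp ir | exact: inf_renormS].
Qed.

End Ordered.

(** * Rotation numbers and periods *)

Section ContinuedFractions.
Variable R : realType.
Implicit Types a b : nat -> nat.

Lemma convergent_bound a n : (forall k, (0 < a k)%N) -> 0 <= convergent R a n <= 1.
Proof.
elim: n a => [|n IH] a a0 /=; first by rewrite lexx ler01.
have /andP[h1 h2] := IH (fun k => a k.+1) (fun k => a0 k.+1).
have h3 : 1 <= (a 0%N)%:R :> R by rewrite (ler_nat _ 1).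
by rewrite invr_ge0 addr_ge0//= ?ler0n// invf_le1; lra.
Qed.

(** An irrational limit determines the first digit and the limit of the tail. *)
Lemma convergent_tail a x : (forall k, (0 < a k)%N) -> irrational x ->
  convergent R a @ \oo --> x ->
  convergent R (fun k => a k.+1) @ \oo --> x^-1 - (a 0%N)%:R /\
  irrational (x^-1 - (a 0%N)%:R) /\ 0 < x^-1 - (a 0%N)%:R < 1.
Proof.
move=> a0 ir cx.
have x0 : x != 0.
  by apply/eqP => x0; apply: ir; rewrite x0; exists 0 => //; rewrite rmorph0.
have cv : convergent R (fun k => a k.+1) @ \oo --> x^-1 - (a 0%N)%:R.
  rewrite (_ : convergent R (fun k => a k.+1) =
    fun n => (convergent R a n.+1)^-1 - (a 0%N)%:R).
    apply: cvgB; last exact: cvg_cst.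
    apply: cvgV => //.
    by rewrite (cvg_shiftS (convergent R a)).
  by apply/funext => n /=; rewrite invrK addrC addKr.
have ir' : irrational (x^-1 - (a 0%N)%:R).
  move=> [q _ qE]; apply: ir; exists ((q + (a 0%N)%:R)^-1) => //.
  by rewrite fmorphV rmorphD /= qE ratr_nat subrK invrK.
split=> //; split=> //.
have b n := convergent_bound n (fun k => a0 k.+1).
have h0 : 0 <= x^-1 - (a 0%N)%:R.
  rewrite -(cvg_lim (@Rhausdorff R) cv); apply: limr_ge; first by apply/cvg_ex; eexists; exact: cv.
  by near=> n; have /andP[] := b n.
have h1 : x^-1 - (a 0%N)%:R <= 1.
  rewrite -(cvg_lim (@Rhausdorff R) cv); apply: limr_le; first by apply/cvg_ex; eexists; exact: cv.
  by near=> n; have /andP[] := b n.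
rewrite !lt_neqAle h0 h1 !andbT; apply/andP; split; apply/eqP => E; apply: ir'.
  by rewrite -E; exists 0 => //; rewrite rmorph0.
by rewrite E; exists 1 => //; rewrite rmorph1.
Unshelve. all: by end_near. Qed.

Lemma convergent_inj a b x : (forall k, (0 < a k)%N) -> (forall k, (0 < b k)%N) ->
  irrational x -> convergent R a @ \oo --> x -> convergent R b @ \oo --> x ->
  forall n, a n = b n.
Proof.
move=> a0 b0 ir ca cb n; elim: n a b x a0 b0 ir ca cb => [|n IH] a b x a0 b0 ir ca cb.
all: have [ca' [ira /andP[a1 a2]]] := convergent_tail a0 ir ca.
all: have [cb' [irb /andP[b1 b2]]] := convergent_tail b0 ir cb.
all: have E : a 0%N = b 0%N.
1,3: case: (ltngtP (a 0%N) (b 0%N)) => // lt; exfalso;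
     move: lt; rewrite -(ler_nat R) -natr1; lra.
- by [].
- rewrite -E in cb'.
  exact: (IH (fun k => a k.+1) (fun k => b k.+1) _ (fun k => a0 k.+1)
    (fun k => b0 k.+1) ira ca' cb').
Qed.

(** A divergent sequence of convergents would give the default limit, which is
    rational. *)
Lemma rotation_number_inj (z0 z1 : map_pair R) : top_pair z0 -> top_pair z1 ->
  infinitely_renormalizable z0 -> infinitely_renormalizable z1 ->
  rotation_number z0 = rotation_number z1 -> irrational (rotation_number z0) ->
  forall j, period (iter j (@renorm R) z0) = period (iter j (@renorm R) z1).
Proof.
move=> tp0 tp1 ir0 ir1 E irr j.
have cv z : irrational (rotation_number z) ->
    convergent R (fun j => odflt 0%N (period (iter j (@renorm R) z))) @ \oo --> rotation_number z.
  move=> iz; apply: contrapT => nc; apply: iz.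
  have nc' : ~ cvg (convergent R (fun j => odflt 0%N (period (iter j (@renorm R) z))) @ \oo).
    by move=> c; apply: nc.
  by rewrite /rotation_number (dvgP nc'); exists 0 => //; rewrite rmorph0.
have := convergent_inj (digits_gt0 tp0 ir0) (digits_gt0 tp1 ir1) irr (cv _ irr).
rewrite E => /(_ (cv _ _) j); rewrite -E => /(_ irr).
by have := ir0 j; have := ir1 j; do 2 case: period => // ?; move=> _ _ /= ->.
Qed.

End ContinuedFractions.

(** * Linear arithmetic and derivatives *)

(** Quantified hypotheses slow down linear arithmetic; these tactics remove them,
    or all hypotheses but those that matter. *)
Ltac prune := repeat match goal with
  | H : ?T |- _ => match type of T with
    | Prop => match T with is_true _ => fail 2 | _ = _ => fail 2 | _ => clear H end
    end
  end.
Ltac plra := prune; lra.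
Tactic Notation "lra" "using" ne_hyp_list(hs) := clear - hs; lra.

Ltac nonneg := repeat first [assumption | exact: ltW | exact: normr_ge0
  | exact: ler0n | exact: ler01 | exact: sqr_ge0 | apply: addr_ge0 | apply: mulr_ge0
  | apply: exprn_ge0 | rewrite invr_ge0].

Section Arithmetic.
Variable R : realType.
Implicit Types u D W : R.

Lemma inv_sq_bound u D W : 0 <= u -> u <= 1 / 16 -> W ^+ 2 * D = 1 -> 0 < D ->
  1 - u <= W -> 0 < W -> D <= 1 + 4 * u.
Proof.
move=> u0 u1 sq D0 uW W0.
have h1 : (1 - u) ^+ 2 * D <= 1.
  by rewrite -sq ler_wpM2r ?(ltW D0)// ler_sqr ?nnegrE//; lra.
rewrite leNgt; apply/negP => lt'.
have h2 : (1 - u) ^+ 2 * (1 + 4 * u) < (1 - u) ^+ 2 * D.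
  by rewrite ltr_pM2l// exprn_gt0//; lra.
have h3 : 0 <= u * (2 - 7 * u + 4 * u ^+ 2) by rewrite mulr_ge0//; nra.
have h4 : (1 - u) ^+ 2 * (1 + 4 * u) = 1 + u * (2 - 7 * u + 4 * u ^+ 2) by ring.
lra.
Qed.

Lemma inv_ge1 D W : W * D = 1 -> 0 < D -> W <= 1 -> 1 <= D.
Proof. by move=> ? ? ?; nra. Qed.

Lemma inv_le1 D W : W * D = 1 -> 0 < D -> 1 <= W -> D <= 1.
Proof. by move=> ? ? ?; nra. Qed.

End Arithmetic.

Section Derivatives.
Variable R : realType.
Implicit Types (f g df : R -> R) (x y a b c l K lo hi : R).

Lemma dv_eq f x a b : is_derive x 1 f a -> a = b -> is_derive x 1 f b.
Proof. by move=> h <-. Qed.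

Lemma dvC c x : is_derive x 1 (fun=> c : R) 0.
Proof. exact: is_derive_cst. Qed.

Lemma dvI x : is_derive x 1 (fun y : R => y) 1.
Proof. exact: is_derive_id. Qed.

Lemma dvD f g x a b : is_derive x 1 f a -> is_derive x 1 g b ->
  is_derive x 1 (fun y => f y + g y) (a + b).
Proof. by move=> h1 h2; exact: (is_deriveD h1 h2). Qed.

Lemma dvB f g x a b : is_derive x 1 f a -> is_derive x 1 g b ->
  is_derive x 1 (fun y => f y - g y) (a - b).
Proof. by move=> h1 h2; exact: (is_deriveB h1 h2). Qed.

Lemma dvM f g x a b : is_derive x 1 f a -> is_derive x 1 g b ->
  is_derive x 1 (fun y => f y * g y) (f x * b + g x * a).
Proof. by move=> h1 h2; exact: (is_deriveM h1 h2). Qed.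

Lemma dvZ c f x a : is_derive x 1 f a -> is_derive x 1 (fun y => c * f y) (c * a).
Proof. by move=> h; apply: dv_eq (dvM (dvC c x) h) _; rewrite mulr0 addr0. Qed.

Lemma dvV f x a : f x != 0 -> is_derive x 1 f a ->
  is_derive x 1 (fun y => (f y)^-1) (- a / f x ^+ 2).
Proof.
move=> f0 h; apply: dv_eq (is_deriveV f0 h) _.
by rewrite /GRing.scale /= mulrC mulrN mulNr.
Qed.

Lemma dv_comp f g x a b : is_derive (g x) 1 f a -> is_derive x 1 g b ->
  is_derive x 1 (fun y => f (g y)) (a * b).
Proof. by move=> h1 h2; exact: (is_derive1_comp h1 h2). Qed.

Lemma dv_cont f x a : is_derive x 1 f a -> {for x, continuous f}.
Proof.
move=> h; apply: differentiable_continuous; apply/derivable1_diffP.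
exact: (@ex_derive _ _ _ _ _ _ _ h).
Qed.

Lemma mvt f df a b : a < b -> {within `[a, b], continuous f} ->
  (forall x, a < x < b -> is_derive x 1 f (df x)) ->
  exists2 c, a < c < b & f b - f a = df c * (b - a).
Proof.
move=> ab cf h; have h' x : x \in `]a, b[ -> is_derive x 1 f (df x).
  by rewrite in_itv /= => xab; exact: h.
have [c cab ->] := MVT ab h' cf.
by exists c => //; rewrite in_itv in cab.
Qed.

Lemma mvt_open f df lo hi a b : lo < a -> a < b -> b < hi ->
  (forall x, lo < x < hi -> is_derive x 1 f (df x)) ->
  exists2 c, a < c < b & f b - f a = df c * (b - a).
Proof.
move=> la ab bh h; apply: mvt => //.
  apply: continuous_in_subspaceT => x; rewrite inE /= in_itv /= => xab.
  by apply: (@dv_cont _ _ (df x)); apply: h; lra.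
by move=> x xab; apply: h; lra.
Qed.

Lemma lip_within f df K a b x y : 0 <= K -> {within `[a, b], continuous f} ->
  (forall x, a < x < b -> is_derive x 1 f (df x)) ->
  (forall x, a < x < b -> `|df x| <= K) ->
  a <= x <= b -> a <= y <= b -> `|f x - f y| <= K * `|x - y|.
Proof.
move=> K0 cf h bd.
wlog xy : x y / x < y => [H|] xab yab.
  have [lt|lt|->] := ltgtP x y; first exact: H.
    by rewrite distrC [X in _ * X]distrC; exact: H.
  by rewrite !subrr normr0 mulr0.
rewrite distrC [X in _ * X]distrC.
have cf' : {within `[x, y], continuous f}.
  by apply: continuous_subspaceW cf => z /=; rewrite !in_itv /=; lra.
have h' z : x < z < y -> is_derive z 1 f (df z) by move=> zxy; apply: h; lra.
have [c cab ->] := mvt xy cf' h'.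
by rewrite normrM ler_wpM2r//; apply: bd; lra.
Qed.

Lemma lip_open f df K a b x y : 0 <= K ->
  (forall x, a < x < b -> is_derive x 1 f (df x)) ->
  (forall x, a < x < b -> `|df x| <= K) ->
  a < x < b -> a < y < b -> `|f x - f y| <= K * `|x - y|.
Proof.
move=> K0 h bd.
wlog xy : x y / x < y => [H|] xab yab.
  have [lt|lt|->] := ltgtP x y; first exact: H.
    by rewrite distrC [X in _ * X]distrC; exact: H.
  by rewrite !subrr normr0 mulr0.
rewrite distrC [X in _ * X]distrC.
have [||c cab ->] := @mvt_open f df a b x y _ xy _ h; [lra|lra|].
by rewrite normrM ler_wpM2r//; apply: bd; lra.
Qed.

Lemma homo_open f df a b x y :
  (forall x, a < x < b -> is_derive x 1 f (df x)) ->
  (forall x, a < x < b -> 0 <= df x) ->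
  a < x -> x <= y -> y < b -> f x <= f y.
Proof.
move=> h bd ax; rewrite le_eqVlt => /orP[/eqP->//|xy] yb.
have [c cab E] := mvt_open ax xy yb h.
by rewrite -subr_ge0 E mulr_ge0 ?bd//; lra.
Qed.

Lemma tangent_below f df lo hi x y :
  (forall x, lo < x < hi -> is_derive x 1 f (df x)) ->
  (forall x y, lo < x -> x <= y -> y < hi -> df x <= df y) ->
  lo < x < hi -> lo < y < hi -> f x + df x * (y - x) <= f y.
Proof.
move=> h mono xI yI; have [lt|lt|->] := ltgtP y x; last by rewrite subrr mulr0 addr0.
- have [|||c cI E] := @mvt_open f df lo hi y x _ _ _ h; [lra..|].
  have [c0 cx xh] : [/\ lo < c, c <= x & x < hi] by split; lra.
  have := mulr_ge0 (_ : 0 <= df x - df c) (_ : 0 <= x - y).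
  by rewrite !subr_ge0 (ltW lt) (mono _ _ c0 cx xh) => /(_ isT isT); lra.
- have [|||c cI E] := @mvt_open f df lo hi x y _ _ _ h; [lra..|].
  have [x0 xc ch] : [/\ lo < x, x <= c & c < hi] by split; lra.
  have := mulr_ge0 (_ : 0 <= df c - df x) (_ : 0 <= y - x).
  by rewrite !subr_ge0 (ltW lt) (mono _ _ x0 xc ch) => /(_ isT isT); lra.
Qed.

Lemma within_cont f (A : set R) : continuous f -> {within A, continuous f}.
Proof. exact: continuous_subspaceT. Qed.

End Derivatives.

(** * The gap of a map of negative Schwarzian derivative *)

Section Geometry.
Variable R : realType.

(** A diffeomorphism of negative Schwarzian without fixed points, controlled
    on the interval [m, q]. *)
Record base_map (K q m : R) (f d dd ddd : R -> R) : Prop := BaseMap {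
  bm_K : 1 <= K;
  bm_m : K^-1 <= m;
  bm_mq : m < q;
  bm_q : q <= K;
  bm_cont : continuous f;
  bm_d : forall x, 0 < x < q -> is_derive x 1 f (d x);
  bm_dd : forall x, 0 < x < q -> is_derive x 1 d (dd x);
  bm_ddd : forall x, 0 < x < q -> is_derive x 1 dd (ddd x);
  bm_dK : forall x, 0 < x < q -> `|d x| <= K;
  bm_ddK : forall x, 0 < x < q -> `|dd x| <= K;
  bm_dddK : forall x, 0 < x < q -> `|ddd x| <= K;
  bm_low : forall x, m <= x < q -> K^-1 <= d x;
  bm_pos : forall x, 0 < x < q -> 0 < d x;
  bm_schw : forall x, 0 < x < q -> ddd x / d x - 3 / 2 * (dd x / d x) ^+ 2 < 0;
  bm_endq : K^-1 <= q - f q;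
  bm_endm : K^-1 <= m - f m;
  bm_below : forall x, m <= x <= q -> f x < x }.

Section Fixed.
Variables (K q m : R) (f d dd ddd : R -> R).
Hypothesis bm : base_map K q m f d dd ddd.

Let K1 : 1 <= K. Proof. exact: bm_K bm. Qed.
Let K0 : 0 < K. Proof. by have := K1; lra. Qed.
Let m0 : 0 < m.
Proof. by apply: lt_le_trans (bm_m bm); rewrite invr_gt0. Qed.

(* The function (f')^(-1/2), convex by the sign of the Schwarzian derivative. *)
Let w x := expR (- (ln (d x) / 2)).
(* The derivative of [w]. *)
Let w1 x := - (dd x / d x / 2) * w x.

Let w_gt0 x : 0 < w x. Proof. exact: expR_gt0. Qed.

Let w_sq x : 0 < x < q -> w x ^+ 2 * d x = 1.
Proof.
move=> xq; have dx := bm_pos bm xq.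
have E : d x = expR (ln (d x)) by rewrite lnK.
by rewrite [X in _ * X]E /w expr2 -!expRD; apply: etrans (@expR0 R); congr expR; field.
Qed.

Let dv_w x : 0 < x < q -> is_derive x 1 w (w1 x).
Proof.
move=> xq; have dx := bm_pos bm xq.
have h := dvZ (- 2^-1) (dv_comp (is_derive1_ln dx) (bm_dd bm xq)).
have h2 := dv_comp (is_derive_expR _) h.
have -> : w = fun y => expR (- 2^-1 * ln (d y)).
  by apply/funext => y; rewrite /w; congr expR; ring.
apply: dv_eq h2 _; rewrite /w1 /w.
have -> : - (ln (d x) / 2) = - 2^-1 * ln (d x) by ring.
by ring.
Qed.

Let dv_w1 x : 0 < x < q ->
  is_derive x 1 w1 (- (ddd x / d x - 3 / 2 * (dd x / d x) ^+ 2) / 2 * w x).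
Proof.
move=> xq; have dx := bm_pos bm xq; have dx0 : d x != 0 by rewrite gt_eqF.
have h := dvM (bm_ddd bm xq) (dvV dx0 (bm_dd bm xq)).
have h2 := dvM (dvZ (- 2^-1) h) (dv_w xq).
have -> : w1 = fun y => - 2^-1 * (dd y * (d y)^-1) * w y.
  by apply/funext => y; rewrite /w1; ring.
apply: dv_eq h2 _; rewrite /w1.
by field.
Qed.

Let w1_homo x y : 0 < x -> x <= y -> y < q -> w1 x <= w1 y.
Proof.
apply: homo_open dv_w1 _ => z zq.
by have := bm_schw bm zq; have := w_gt0 z; nra.
Qed.

Let w_tangent p x : 0 < p < q -> 0 < x < q -> w p + w1 p * (x - p) <= w x.
Proof.
by move=> pq xq; exact: tangent_below dv_w w1_homo pq xq.
Qed.

(* The gap. *)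
Let g x := x - f x.

Let dv_g x : 0 < x < q -> is_derive x 1 g (1 - d x).
Proof. by move=> xq; apply: dvB (dvI x) (bm_d bm xq). Qed.

Let cont_g : continuous g.
Proof. by move=> x; apply: cvgB; [exact: cvg_id|exact: (bm_cont bm)]. Qed.

Let mvt_g x y : 0 <= x -> x < y -> y <= q ->
  exists2 c, x < c < y & g y - g x = (1 - d c) * (y - x).
Proof.
move=> x0 xy yq; apply: mvt => //; first exact: within_cont.
by move=> c cxy; apply: dv_g; lra.
Qed.

Lemma gap_min : exists p, [/\ m <= p, p <= q &
  forall x, m <= x <= q -> p - f p <= x - f x].
Proof.
have [p] := EVT_min (ltW (bm_mq bm)) (@within_cont _ g `[m, q] cont_g).
rewrite in_itv /= => /andP[mp pq] h; by exists p; split.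
Qed.

Let gap_lip x y : m <= x -> x < y -> y <= q -> `|g y - g x| <= (1 + K) * (y - x).
Proof.
move=> mx xy yq; have m0' := m0; have x0 : 0 <= x by lra.
have [c cI ->] := mvt_g x0 xy yq; have yx : 0 < y - x by lra.
rewrite normrM (gtr0_norm yx) ler_wpM2r ?(ltW yx)//.
have cI' : 0 < c < q by lra.
by have := bm_dK bm cI'; rewrite !ler_norml; lra.
Qed.

(** The gap is small at [p], large at both ends, and Lipschitz. *)
Lemma min_interior p rho : m <= p -> p <= q -> 0 < rho ->
  (1 + K) * rho <= K^-1 / 8 -> p - f p < K^-1 / 2 -> m + rho < p < q - rho.
Proof.
move=> mp pq rho0 hr small; have K0' := K0.
have k0 : 0 < K^-1 by rewrite invr_gt0.
have em := bm_endm bm; have eq := bm_endq bm.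
have far u : 0 <= u -> u <= rho -> (1 + K) * u <= K^-1 / 8.
  by move=> u0 ur; apply: le_trans hr; rewrite ler_wpM2l//; lra.
have mp' : m < p by rewrite lt_neqAle mp andbT; apply/eqP => E; rewrite E in em; lra.
have pq' : p < q by rewrite lt_neqAle pq andbT; apply/eqP => E; rewrite -E in eq; lra.
have hm := gap_lip (lexx m) mp' pq; have hq := gap_lip mp pq' (lexx q).
rewrite /g !ler_norml in hm hq.
apply/andP; split; rewrite ltNge; apply/negP => le.
- have fm : (1 + K) * (p - m) <= K^-1 / 8 by apply: far; lra.
  clear far; lra.
- have fq : (1 + K) * (q - p) <= K^-1 / 8 by apply: far; lra.
  clear far; lra.
Qed.

Lemma min_deriv1 p : m < p < q ->
  (forall x, m <= x <= q -> p - f p <= x - f x) -> d p = 1.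
Proof.
move=> pI pmin; have m0' := m0.
have h0 : is_derive p 1 g 0.
  apply: (@derive1_at_min R g m q p (ltW (bm_mq bm))).
  - move=> t; rewrite in_itv /= => tI.
    have tI' : 0 < t < q by lra.
    exact: (@ex_derive _ _ _ _ _ _ _ (dv_g tI')).
  - by rewrite in_itv.
  - by move=> t; rewrite in_itv /= => tI; apply: pmin; lra.
have pI' : 0 < p < q by lra.
have := @derive_val _ _ _ _ _ _ _ h0.
by rewrite (@derive_val _ _ _ _ _ _ _ (dv_g pI')); lra.
Qed.

Let w_at1 p : 0 < p < q -> d p = 1 -> w p = 1.
Proof.
move=> pI dp; have := w_sq pI; rewrite dp mulr1 => /eqP.
rewrite sqrf_eq1 => /orP[/eqP//|/eqP E].
by have := w_gt0 p; rewrite E; lra.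
Qed.

(** If the second derivative at the minimum of the gap were small, convexity
    of [w] would keep [f] so close to a translation that the gap could not
    reach its size at [m]. *)
Lemma min_deriv2 p s : m < p < q -> d p = 1 -> 0 < s -> s * K <= 1 / 16 ->
  4 * (s * K) * K <= K^-1 / 4 -> p - f p < K^-1 / 2 -> dd p <= - 2 * s.
Proof.
move=> pI dp s0 sK1 sK2 small; have m0' := m0.
have pI' : 0 < p < q by lra.
have wp := w_at1 pI' dp.
rewrite leNgt; apply/negP => lt.
have [mp pq] : m < p /\ p <= q by lra.
have [c cmp E] := mvt_g (ltW m0) mp pq.
have cI : 0 < c < q by lra.
have t := w_tangent pI' cI; rewrite wp /w1 wp dp in t.
have pmK : p - m <= K by have := bm_q bm; lra.
set u := s * (p - c).
have u0 : 0 <= u by rewrite mulr_ge0 ?ltW//; lra.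
have uK : u <= s * K by rewrite ler_wpM2l ?ltW//; lra.
have wc : 1 - u <= w c.
  have t2 : 0 <= (2 * s + dd p) * (p - c) by rewrite mulr_ge0//; lra.
  by rewrite /u; rewrite invr1 !mulr1 in t; lra.
have dc : d c <= 1 + 4 * u.
  apply: (inv_sq_bound u0 _ (w_sq cI) (bm_pos bm cI) wc (w_gt0 c)); lra.
have em := bm_endm bm; rewrite /g in E.
have K0' := K0; have k0 : 0 < K^-1 by rewrite invr_gt0.
have h : (d c - 1) * (p - m) <= K^-1 / 4.
  apply: (@le_trans _ _ (4 * (s * K) * (p - m))).
    by rewrite ler_wpM2r; lra.
  by apply: le_trans sK2; rewrite ler_wpM2l// !mulr_ge0// ltW.
lra.
Qed.

Lemma window_deriv2 p rho s : 0 < p - rho -> p + rho < q -> dd p <= - 2 * s ->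
  K * rho <= s -> forall x, `|x - p| <= rho -> dd x <= - s.
Proof.
move=> p1 p2 ddp hr x xr.
have rho0 : 0 <= rho by exact: le_trans (normr_ge0 _) xr.
have pI : 0 < p < q by lra.
have xI : 0 < x < q by move: xr; rewrite ler_norml; lra.
have h := lip_open (ltW K0) (bm_ddd bm) (bm_dddK bm) xI pI.
have h' : K * `|x - p| <= K * rho by rewrite ler_wpM2l// ltW// K0.
by move: h; rewrite ler_norml; lra.
Qed.

Lemma window_slope p rho s : 0 < p - rho -> p + rho < q -> d p = 1 ->
  (forall x, `|x - p| <= rho -> dd x <= - s) ->
  forall y, 0 < `|y - p| <= rho -> s * (y - p) ^+ 2 <= (1 - d y) * (y - p).
Proof.
move=> p1 p2 dp ddw y /andP[y0 yr].
have [lt|lt|E] := ltgtP y p; last by move: y0; rewrite E subrr normr0 ltxx.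
- have [||c cy E] := @mvt_open _ d dd 0 q y p _ lt _ (bm_dd bm).
  + by move: yr; rewrite ler_norml; lra.
  + by move: yr; rewrite ler_norml; lra.
  have ddc : dd c <= - s by apply: ddw; move: yr; rewrite !ler_norml; lra.
  rewrite dp in E; have -> : 1 - d y = dd c * (p - y) by lra.
  rewrite -subr_ge0 (_ : _ - _ = (- s - dd c) * (y - p) ^+ 2); last by ring.
  by rewrite mulr_ge0 ?sqr_ge0//; lra.
- have [||c cy E] := @mvt_open _ d dd 0 q p y _ lt _ (bm_dd bm).
  + by move: yr; rewrite ler_norml; lra.
  + by move: yr; rewrite ler_norml; lra.
  have ddc : dd c <= - s by apply: ddw; move: yr; rewrite !ler_norml; lra.
  rewrite dp in E; have -> : 1 - d y = - dd c * (y - p) by lra.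
  rewrite -subr_ge0 (_ : _ - _ = (- s - dd c) * (y - p) ^+ 2); last by ring.
  by rewrite mulr_ge0 ?sqr_ge0//; lra.
Qed.

(* Quasi-convexity of [w]. *)
Let w_le1 a b c : 0 < a -> a < b -> b < c -> c < q -> w a <= 1 -> w c <= 1 -> w b <= 1.
Proof.
move=> a0 ab bc cq wa wc; rewrite leNgt; apply/negP => wb.
have bq : b < q := lt_trans bc cq.
have b0 : 0 < b := lt_trans a0 ab.
have [e1 /andP[ae1 e1b] E1] := mvt_open a0 ab bq dv_w.
have [e2 /andP[be2 e2c] E2] := mvt_open b0 bc cq dv_w.
have h := w1_homo (lt_trans a0 ae1) (ltW (lt_trans e1b be2)) (lt_trans e2c cq).
have h1 : 0 < w1 e1 by rewrite -(@pmulr_lgt0 _ (b - a)) -?E1 subr_gt0//; exact: le_lt_trans wb.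
have h2 : w1 e2 < 0 by rewrite -(@pmulr_llt0 _ (c - b)) -?E2 ?subr_gt0// subr_lt0; exact: le_lt_trans wb.
by have := lt_le_trans h1 h; rewrite ltNge (ltW h2).
Qed.

Let d_ge1 y : 0 < y < q -> w y <= 1 -> 1 <= d y.
Proof.
move=> yI h; apply: inv_ge1 (w_sq yI) (bm_pos bm yI) _.
by rewrite expr_le1// ltW.
Qed.

Let d_le1 y : 0 < y < q -> 1 <= w y -> d y <= 1.
Proof.
move=> yI h; apply: inv_le1 (w_sq yI) (bm_pos bm yI) _.
by rewrite expr_ge1// ltW.
Qed.

Let gap_le x y : 0 <= x -> x <= y -> y <= q -> (forall c, x < c < y -> d c <= 1) -> g x <= g y.
Proof.
move=> x0; rewrite le_eqVlt => /orP[/eqP -> //|xy] yq h.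
have [c cI E] := mvt_g x0 xy yq.
by rewrite -subr_ge0 E mulr_ge0 ?subr_ge0 ?h// ltW.
Qed.

Let gap_ge x y : 0 <= x -> x <= y -> y <= q -> (forall c, x < c < y -> 1 <= d c) -> g y <= g x.
Proof.
move=> x0; rewrite le_eqVlt => /orP[/eqP -> //|xy] yq h.
have [c cI E] := mvt_g x0 xy yq.
by rewrite -subr_le0 E mulr_le0_ge0 ?subr_le0 ?subr_ge0 ?h// ltW.
Qed.

(* On the outer half of [p, p + r] the gap has slope at least [s r / 2]. *)
Let edge_right p rho r s : 0 < p - rho -> p + rho < q -> 0 <= g p -> d p = 1 -> 0 < s ->
  (forall x, m <= x <= q -> g p <= g x) -> m <= p ->
  (forall x, `|x - p| <= rho -> dd x <= - s) -> 0 < r <= rho ->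
  s * r ^+ 2 / 4 <= g (p + r).
Proof.
move=> p1 p2 gp dp s0 pmin mp ddw /andP[r0 rr].
have [c0 c1 c2] : [/\ 0 <= p + r / 2, p + r / 2 < p + r & p + r <= q] by split; lra.
have [c /andP[cr1 cr2] E] := mvt_g c0 c1 c2.
have gh : 0 <= g (p + r / 2) by apply: le_trans gp _; apply: pmin; lra.
have cp : 0 < c - p by lra.
have h2 : s * (c - p) ^+ 2 <= (1 - d c) * (c - p).
  by apply: (window_slope p1 p2 dp ddw); rewrite gtr0_norm// cp; lra.
rewrite expr2 mulrA ler_pM2r// in h2.
have h4 : s * (r / 2) <= 1 - d c by apply: le_trans h2; rewrite ler_pM2l//; lra.
have h5 : s * (r / 2) * (r / 2) <= (1 - d c) * (r / 2) by rewrite ler_wpM2r//; lra.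
rewrite expr2; have : g (p + r) - g (p + r / 2) = (1 - d c) * (r / 2) by rewrite E; congr (_ * _); field.
by have -> : s * (r * r) / 4 = s * (r / 2) * (r / 2); [field | lra].
Qed.

Let edge_left p rho r s : 0 < p - rho -> p + rho < q -> 0 <= g p -> d p = 1 -> 0 < s ->
  (forall x, m <= x <= q -> g p <= g x) -> m <= p - rho ->
  (forall x, `|x - p| <= rho -> dd x <= - s) -> 0 < r <= rho ->
  s * r ^+ 2 / 4 <= g (p - r).
Proof.
move=> p1 p2 gp dp s0 pmin mp ddw /andP[r0 rr].
have [c0 c1 c2] : [/\ 0 <= p - r, p - r < p - r / 2 & p - r / 2 <= q] by split; lra.
have [c /andP[cr1 cr2] E] := mvt_g c0 c1 c2.
have gh : 0 <= g (p - r / 2) by apply: le_trans gp _; apply: pmin; lra.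
have cp : c - p < 0 by lra.
have h2 : s * (c - p) ^+ 2 <= (1 - d c) * (c - p).
  by apply: (window_slope p1 p2 dp ddw); rewrite ltr0_norm// oppr_gt0 cp; lra.
rewrite expr2 mulrA ler_nM2r// in h2.
have h4 : s * (r / 2) <= d c - 1.
  have : s * (r / 2) <= s * (p - c) by rewrite ler_pM2l//; lra.
  lra.
have h5 : s * (r / 2) * (r / 2) <= (d c - 1) * (r / 2) by rewrite ler_wpM2r//; lra.
rewrite expr2; have : g (p - r / 2) - g (p - r) = (1 - d c) * (r / 2) by rewrite E; congr (_ * _); field.
by have -> : s * (r * r) / 4 = s * (r / 2) * (r / 2); [field | lra].
Qed.

(** Convexity of [w] confines the region [f' > 1] to one interval with
    right endpoint [p], so the gap cannot dip again away from the window. *)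
Lemma window_outside p rho s : m <= p - rho -> p + rho < q -> d p = 1 -> 0 < s ->
  (forall x, m <= x <= q -> p - f p <= x - f x) ->
  (forall x, `|x - p| <= rho -> dd x <= - s) -> s * rho ^+ 2 / 4 <= K^-1 ->
  forall r x, 0 < r <= rho -> m <= x <= q -> r <= `|x - p| ->
  s * r ^+ 2 / 4 <= x - f x.
Proof.
move=> p1 p2 dp s0 pmin ddw sk r x rr /andP[mx xq] rx; have m0' := m0.
have [r0 rrho] := andP rr.
have pI : 0 < p < q by lra.
have wp := w_at1 pI dp.
have [mp p0] : m <= p /\ 0 < p - rho by split; lra.
have gp : 0 <= g p by rewrite subr_ge0 ltW//; apply: (bm_below bm); lra.
have x0 : 0 < x := lt_le_trans m0 mx.
rewrite -/(g x); have [xp|xp] := leP p x.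
- have xr : p + r <= x by move: rx; rewrite ger0_norm ?subr_ge0// lerBrDl.
  apply: le_trans (edge_right p0 p2 gp dp s0 pmin mp ddw rr) _.
  have pr0 : 0 <= p + r by lra.
  apply: gap_le => // c /andP[pc cx].
  have cI : 0 < c < q by lra.
  apply: d_le1 => //; have := w_tangent pI cI; rewrite wp; apply: le_trans.
  have ddp : dd p <= - s by apply: ddw; rewrite subrr normr0; lra.
  rewrite lerDl mulr_ge0//; last by rewrite subr_ge0; lra.
  by rewrite /w1 wp dp invr1; lra.
have xr : x <= p - r.
  by move: rx; rewrite ltr0_norm ?subr_lt0// opprB lerBrDr lerBrDl addrC.
have [wx|wx] := leP (w x) 1.
- apply: le_trans (edge_left p0 p2 gp dp s0 pmin p1 ddw rr) _.
  have prq : p - r <= q by lra.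
  apply: (gap_ge (ltW x0) xr prq) => c /andP[xc cp].
  have [cp' pq] : c < p /\ p < q by split; lra.
  apply: d_ge1; first by rewrite (lt_trans x0 xc) (lt_trans cp' pq).
  by apply: (w_le1 x0 xc cp' pq wx); rewrite wp.
apply: (@le_trans _ _ (g m)).
  apply: le_trans (bm_endm bm); apply: le_trans sk.
  by rewrite ler_pM2r// ler_pM2l// ler_sqr ?nnegrE; lra.
apply: (gap_le (ltW m0) mx xq) => c /andP[mc cx].
have c0 : 0 < c := lt_trans m0 mc.
apply: d_le1; first by rewrite c0 (lt_le_trans cx xq).
rewrite leNgt; apply/negP => wc; have pq : p < q by case/andP: pI.
by have := w_le1 c0 cx xp pq (ltW wc); rewrite wp lexx leNgt wx => /(_ isT).
Qed.

End Fixed.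
End Geometry.

(** * Transits of two nearby bowls *)

Section Window.
Variable R : realType.
Implicit Types (G : R -> R) (x y : nat -> R).

(** The gap of a map near its minimum, seen from the minimum: quadratic between
    two constants, convex along rays with a quadratic margin, unimodal, and such
    that the map [z |-> z - G z] is nondecreasing. *)
Record bowl (s K rho eps : R) G : Prop := Bowl {
  bowl_eps : 0 <= eps;
  bowl_lo : forall z, `|z| <= rho -> eps + s / 2 * z ^+ 2 <= G z;
  bowl_up : forall z, `|z| <= rho -> G z <= eps + K * z ^+ 2;
  bowl_contr : forall b z, 0 <= b <= 1 -> `|z| <= rho ->
    G ((1 - b) * z) <= (1 - b) * G z + b * eps - s / 2 * b * (1 - b) * z ^+ 2;
  bowl_r : forall u v, 0 <= u -> u <= v -> v <= rho -> G u <= G v;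
  bowl_l : forall u v, - rho <= u -> u <= v -> v <= 0 -> G v <= G u;
  bowl_homo : forall u v, - rho <= u -> u <= v -> v <= rho -> u - G u <= v - G v }.

Definition bowl_close (rho mu e0 e1 : R) G0 G1 : Prop := forall z, `|z| <= rho ->
  `|(G1 z - e1) - (G0 z - e0)| <= mu * z ^+ 2.

Definition transit G x (n : nat) (r : R) : Prop :=
  (forall k, (k < n)%N -> x k.+1 = x k - G (x k)) /\
  (forall k, (k <= n)%N -> - r <= x k <= r).

Lemma transit_le s K rho e G x n r j k : 0 < s -> bowl s K rho e G -> r <= rho ->
  transit G x n r -> (j <= k)%N -> (k <= n)%N -> x k <= x j.
Proof.
move=> s0 bw rr [xS xI]; elim: k => [|k IH]; first by rewrite leqn0 => /eqP ->.
rewrite leq_eqVlt => /orP[/eqP -> //|]; rewrite ltnS => jk kn.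
apply: le_trans (IH jk (ltnW kn)); rewrite xS// gerBl.
have xk : `|x k| <= rho by have := xI _ (ltnW kn); rewrite ler_norml; lra.
apply: le_trans (bowl_lo bw xk); rewrite addr_ge0 ?(bowl_eps bw)//.
by rewrite mulr_ge0 ?sqr_ge0//; lra.
Qed.

(** The contraction [z |-> (1 - b) z] conjugates the first transit to a slower
    one than the second if the second gap is too small, and then the two
    transits cannot agree at both ends of the window. *)
Lemma transit_gap s K rho mu e0 e1 G0 G1 b r r0 n x y :
  0 < s -> bowl s K rho e0 G0 -> bowl s K rho e1 G1 ->
  bowl_close rho mu e0 e1 G0 G1 -> 0 <= b <= 1 / 2 -> 4 * mu <= s * b ->
  r <= rho -> transit G0 x n r -> transit G1 y n r ->
  r0 <= x 0%N -> x n <= - r0 -> x 0%N - b * r0 <= y 0%N -> y n < x n + b * r0 ->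
  e0 - e1 <= b * e0.
Proof.
move=> s0 bw0 bw1 cl b01 mub rr tx ty x0 xn xy0 xyn; rewrite leNgt; apply/negP => lt.
have inv k : (k <= n)%N -> (1 - b) * x k <= y k.
  elim: k => [_|k IH kn].
    have : 0 <= b * (x 0%N - r0) by rewrite mulr_ge0//; lra.
    lra.
  rewrite (tx.1 _ kn) (ty.1 _ kn).
  have := IH (ltnW kn); have := tx.2 _ (ltnW kn); have := ty.2 _ (ltnW kn).
  move: (x k) (y k) => z w wI zI zw.
  have zr : `|z| <= rho by rewrite ler_norml; lra.
  have hzI : `|(1 - b) * z| <= rho.
    rewrite normrM; apply: le_trans (zr); rewrite ler_piMl// ler_norml; lra.
  have hz : - rho <= (1 - b) * z by move: hzI; rewrite ler_norml => /andP[].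
  have h1 := bowl_homo bw1 hz zw (le_trans (andP wI).2 rr).
  apply: le_trans h1.
  have b1 : 0 <= b <= 1 by lra using b01.
  have h2 := bowl_contr bw0 b1 zr.
  have h3 := cl _ hzI; rewrite ler_norml exprMn in h3.
  have z2 : 0 <= z ^+ 2 by exact: sqr_ge0.
  have h4 : mu * ((1 - b) ^+ 2 * z ^+ 2) <= s / 2 * b * (1 - b) * z ^+ 2.
    rewrite mulrA ler_wpM2r//.
    have -> : mu * (1 - b) ^+ 2 = (mu * (1 - b)) * (1 - b) by ring.
    apply: ler_wpM2r; first lra using b01.
    have [m0|m0] := leP 0 mu; last first.
      have mb : mu * (1 - b) <= 0 by rewrite mulr_le0_ge0//; lra using m0 b01.
      have sb : 0 <= s * b by rewrite mulr_ge0; lra using s0 b01.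
      lra using mb sb.
    have mb : 0 <= mu * b by rewrite mulr_ge0//; lra using b01.
    lra using mub m0 mb.
  case/andP: h3 => _ h3.
  rewrite mulrBr; lra using lt h2 h4 h3.
have := inv _ (leqnn n).
have : 0 <= b * (- r0 - x n) by rewrite mulr_ge0//; lra using b01 xn.
lra.
Qed.

(** Before the first orbit has passed the bottom, the image of its points under
    [z |-> (1 - b) z + al] is a barrier for the second orbit. *)
Lemma transit_right s K rho mu e0 e1 G0 G1 b r al n x y :
  0 < s -> bowl s K rho e0 G0 -> bowl s K rho e1 G1 ->
  bowl_close rho mu e0 e1 G0 G1 -> 0 <= b <= 1 / 2 -> 4 * mu <= s * b ->
  b * r <= al -> r + al <= rho -> e0 - e1 <= b * e0 ->
  transit G0 x n r -> transit G1 y n r -> y 0%N <= x 0%N + (al - b * r) ->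
  forall k, (k <= n)%N -> (forall j, (j < k)%N -> 0 <= x j) ->
  y k <= (1 - b) * x k + al.
Proof.
move=> s0 bw0 bw1 cl b01 mub ral rr ee tx ty xy0.
have r0 : 0 <= r by have := tx.2 _ (leq0n n); lra.
have br0 : 0 <= b * r by rewrite mulr_ge0//; lra.
elim=> [_ _|k IH kn xp].
  have : 0 <= b * (r - x 0%N) by rewrite mulr_ge0//; have := tx.2 _ (leq0n n); lra.
  lra.
rewrite (tx.1 _ kn) (ty.1 _ kn).
have := IH (ltnW kn) (fun j jk => xp j (ltnW jk)); have := xp _ (ltnSn k).
have := tx.2 _ (ltnW kn); have := ty.2 _ (ltnW kn).
move: (x k) (y k) => z w wI zI z0 zw.
have zr : `|z| <= rho by rewrite ler_norml; lra.
have bz : b * z <= b * r by rewrite ler_wpM2l; lra using b01 zI.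
have bz0 : 0 <= b * z by rewrite mulr_ge0; lra using b01 z0.
have hz : (1 - b) * z + al <= rho by lra.
have wr : - rho <= w by lra using ral rr br0 wI.
have h1 := bowl_homo bw1 wr zw hz.
apply: le_trans h1 _.
have zhz : z <= (1 - b) * z + al by lra using ral bz.
have h2 := bowl_r bw1 z0 zhz hz.
have h3 := cl _ zr; rewrite ler_norml in h3; case/andP: h3 => h3 _.
have h4 := bowl_lo bw0 zr.
have h5 : b * (e0 + s / 2 * z ^+ 2) <= b * G0 z by rewrite ler_wpM2l//; lra using b01.
have h6 : mu * z ^+ 2 <= b * (s / 2) * z ^+ 2.
  rewrite ler_wpM2r ?sqr_ge0//.
  have sb : 0 <= s * b by rewrite mulr_ge0; lra using s0 b01.
  lra using mub sb.
rewrite mulrBr; lra using ee h2 h3 h5 h6.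
Qed.

(** After the bottom the barrier [z |-> (1 - b) z - al] acts backward: an orbit
    that has fallen below it remains below it until the end. *)
Lemma transit_left s K rho mu e0 e1 G0 G1 b r al n x y :
  0 < s -> bowl s K rho e0 G0 -> bowl s K rho e1 G1 ->
  bowl_close rho mu e0 e1 G0 G1 -> 0 <= b <= 1 / 2 -> 4 * mu <= s * b ->
  b * r <= al -> r + al <= rho -> e0 - e1 <= b * e0 ->
  transit G0 x n r -> transit G1 y n r -> x n - (al - b * r) < y n ->
  forall k, (k <= n)%N -> x k <= 0 -> (1 - b) * x k - al < y k.
Proof.
move=> s0 bw0 bw1 cl b01 mub ral rr ee tx ty xyn k kn xk; rewrite ltNge; apply/negP => le.
have r0 : 0 <= r by have := tx.2 _ (leq0n n); lra.
have br0 : 0 <= b * r by rewrite mulr_ge0//; lra.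
have rr' : r <= rho by lra.
suff : y n <= (1 - b) * x n - al.
  have : 0 <= b * (r + x n) by rewrite mulr_ge0//; have := tx.2 _ (leqnn n); lra using b01.
  lra.
rewrite -(subnKC kn); have : (k + (n - k) <= n)%N by rewrite subnKC.
elim: (n - k)%N => [|j IH]; first by rewrite addn0.
rewrite addnS => jn; have := IH (ltnW jn).
have xj : x (k + j)%N <= 0 by apply: le_trans xk; exact: (transit_le s0 bw0 rr' tx (leq_addr _ _) (ltnW jn)).
rewrite (tx.1 _ jn) (ty.1 _ jn).
have := xj; have := tx.2 _ (ltnW jn); have := ty.2 _ (ltnW jn).
move: (x (k + j)%N) (y (k + j)%N) => z w wI zI z0 zw.
have zr : `|z| <= rho by rewrite ler_norml; lra.
have bz : - (b * r) <= b * z.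
  have : 0 <= b * (z + r) by rewrite mulr_ge0; lra using b01 zI.
  lra.
have bz0 : b * z <= 0 by rewrite mulr_ge0_le0; lra using b01 z0.
have hz : - rho <= (1 - b) * z - al by lra using ral rr br0 wI zw.
have zhz : (1 - b) * z - al <= z by lra using ral bz.
have hz' : (1 - b) * z - al <= rho by lra using ral rr br0 zI bz.
have wr : - rho <= w by lra using ral rr br0 wI.
have h1 := bowl_homo bw1 wr zw hz'.
apply: le_trans h1 _.
have h2 := bowl_l bw1 hz zhz z0.
have h3 := cl _ zr; rewrite ler_norml in h3; case/andP: h3 => h3 _.
have h4 := bowl_lo bw0 zr.
have h5 : b * (e0 + s / 2 * z ^+ 2) <= b * G0 z by rewrite ler_wpM2l//; lra using b01.
have h6 : mu * z ^+ 2 <= b * (s / 2) * z ^+ 2.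
  rewrite ler_wpM2r ?sqr_ge0//.
  have sb : 0 <= s * b by rewrite mulr_ge0; lra using s0 b01.
  lra using mub sb.
rewrite mulrBr; lra using ee h2 h3 h5 h6.
Qed.

Lemma bowl_close_sym rho mu e0 e1 G0 G1 :
  bowl_close rho mu e0 e1 G0 G1 -> bowl_close rho mu e1 e0 G1 G0.
Proof. by move=> h z /h; rewrite distrC. Qed.

(** When one orbit has passed the bottom and the other has not, both are close
    to it: the first one was caught by the barrier when it arrived there, and the
    step by which the second one will pass is short. *)
Lemma transit_mixed s K rho e0 e1 G0 G1 b r A n x y k :
  0 < s -> 0 <= K -> bowl s K rho e0 G0 -> bowl s K rho e1 G1 -> r <= rho ->
  transit G0 x n r -> transit G1 y n r -> 0 < y 0%N -> x n <= 0 ->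
  e0 - e1 <= b * e0 -> 0 <= b -> e0 <= 1 -> 0 <= A ->
  (forall k, (k <= n)%N -> (forall j, (j < k)%N -> 0 <= y j) -> x k <= y k + A) ->
  (forall k, (k <= n)%N -> x k <= 0 -> x k - A <= y k) ->
  (k <= n)%N -> 0 < x k -> y k <= 0 -> x k - y k <= 2 * A + b + K * A ^+ 2.
Proof.
move=> s0 K0 bw0 bw1 rr tx ty y0 xn ee b0 e01 A0 right left kn xk yk.
have ex : exists i, y i <= 0 by exists k.
case: (ex_minnP ex) => i yi imin.
have ik : (i <= k)%N by exact: imin.
have xi : x i <= y i + A.
  apply: right; first exact: leq_trans kn.
  by move=> j ji; rewrite leNgt; apply/negP => /ltW /imin; rewrite leqNgt ji.
have xkA : x k <= A.
  by have := transit_le s0 bw0 rr tx ik kn; lra.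
have ex' : exists i, (k <= i)%N && (x i <= 0) by exists n; rewrite kn.
case: (ex_minnP ex') => j /andP[kj xj] jmin.
have jn : (j <= n)%N by apply: jmin; rewrite kn.
case: j kj xj jmin jn => [|j] kj xj jmin jn.
  by move: kj xj; rewrite leqn0 => /eqP <-; lra.
have kj' : (k <= j)%N.
  by move: kj; rewrite leq_eqVlt => /orP[/eqP E|//]; move: xj; rewrite -E; lra.
have xj0 : 0 < x j.
  by rewrite ltNge; apply/negP => h; have := jmin j; rewrite kj' h ltnn => /(_ isT).
have xjA : x j <= A by apply: le_trans xkA; exact: (transit_le s0 bw0 rr tx kj' (ltnW jn)).
have h1 := left _ jn xj.
rewrite (tx.1 _ jn) (ty.1 _ jn) in h1.
have xjr : `|x j| <= rho by have := tx.2 _ (ltnW jn); rewrite ler_norml; lra using rr.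
have yjr : `|y j| <= rho by have := ty.2 _ (ltnW jn); rewrite ler_norml; lra using rr.
have h2 := bowl_up bw0 xjr.
have h3 := bowl_lo bw1 yjr.
have h4 : 0 <= s / 2 * y j ^+ 2 by rewrite mulr_ge0 ?sqr_ge0//; lra using s0.
have h5 : K * x j ^+ 2 <= K * A ^+ 2 by rewrite ler_wpM2l// ler_sqr ?nnegrE//; lra using xj0.
have h6 : b * e0 <= b by rewrite ler_piMr.
have h7 := transit_le s0 bw1 rr ty kj' (ltnW jn).
lra using ee xkA xj0 h1 h2 h3 h4 h5 h6 h7.
Qed.

(** The four barriers, for either orbit before and after the bottom. The bound
    does not depend on the duration of the transit. *)
Lemma transit_close s K rho mu e0 e1 G0 G1 b r r0 al n x y :
  0 < s -> 0 <= K -> bowl s K rho e0 G0 -> bowl s K rho e1 G1 ->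
  bowl_close rho mu e0 e1 G0 G1 -> 0 <= b <= 1 / 2 -> 4 * mu <= s * b ->
  e0 <= 1 -> e1 <= 1 -> 0 < r0 -> 0 <= al < b * r0 ->
  r + (al + b * r) <= rho -> transit G0 x n r -> transit G1 y n r ->
  r0 <= x 0%N -> x n <= - r0 -> r0 <= y 0%N -> y n <= - r0 ->
  `|x 0%N - y 0%N| <= al -> `|x n - y n| < al ->
  let A := al + 2 * (b * r) in
  (e0 - e1 <= b * e0 /\ e1 - e0 <= b * e1) /\
  forall k, (k <= n)%N -> `|x k - y k| <= 2 * A + b + K * A ^+ 2.
Proof.
move=> s0 K0 bw0 bw1 cl b01 mub e01 e11 r00 alb rr tx ty x0 xn y0 yn.
rewrite ler_norml ltr_norml => xy0 xyn A.
have cl' := bowl_close_sym cl.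
have r_0 : 0 <= r by have := tx.2 _ (leq0n n); lra.
have br0 : 0 <= b * r by rewrite mulr_ge0//; lra.
have rr' : r <= rho by lra.
have ee : e0 - e1 <= b * e0.
  by apply: (transit_gap s0 bw0 bw1 cl b01 mub rr' tx ty x0 xn); lra using alb xy0 xyn.
have ee' : e1 - e0 <= b * e1.
  by apply: (transit_gap s0 bw1 bw0 cl' b01 mub rr' ty tx y0 yn); lra using alb xy0 xyn.
split=> //.
have bral : b * r <= al + b * r by lra.
have b0 : 0 <= b by lra.
have bnd (u : nat -> R) G k : transit G u n r -> (k <= n)%N -> - (b * r) <= b * u k <= b * r.
  move=> tu kn; have /andP[u1 u2] := tu.2 _ kn; rewrite -mulrN.
  by apply/andP; split; rewrite ler_wpM2l.
have R1 : forall k, (k <= n)%N -> (forall j, (j < k)%N -> 0 <= x j) -> y k <= x k + A.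
  move=> k kn xp; have h0 : y 0%N <= x 0%N + (al + b * r - b * r) by lra using xy0.
  have h := transit_right s0 bw0 bw1 cl b01 mub bral rr ee tx ty h0 kn xp.
  by have := bnd _ _ _ tx kn; rewrite /A; lra using h.
have R2 : forall k, (k <= n)%N -> (forall j, (j < k)%N -> 0 <= y j) -> x k <= y k + A.
  move=> k kn xp; have h0 : x 0%N <= y 0%N + (al + b * r - b * r) by lra using xy0.
  have h := transit_right s0 bw1 bw0 cl' b01 mub bral rr ee' ty tx h0 kn xp.
  by have := bnd _ _ _ ty kn; rewrite /A; lra using h.
have L1 : forall k, (k <= n)%N -> x k <= 0 -> x k - A <= y k.
  move=> k kn xk; have h0 : x n - (al + b * r - b * r) < y n by lra using xyn.
  have h := transit_left s0 bw0 bw1 cl b01 mub bral rr ee tx ty h0 kn xk.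
  by have := bnd _ _ _ tx kn; rewrite /A; lra using h.
have L2 : forall k, (k <= n)%N -> y k <= 0 -> y k - A <= x k.
  move=> k kn xk; have h0 : y n - (al + b * r - b * r) < x n by lra using xyn.
  have h := transit_left s0 bw1 bw0 cl' b01 mub bral rr ee' ty tx h0 kn xk.
  by have := bnd _ _ _ ty kn; rewrite /A; lra using h.
have A0 : 0 <= A by rewrite /A; lra using alb br0.
have KA : 0 <= K * A ^+ 2 by rewrite mulr_ge0// sqr_ge0.
move=> k kn.
have posx : 0 < x k -> forall j, (j < k)%N -> 0 <= x j.
  by move=> xk j jk; have := transit_le s0 bw0 rr' tx (ltnW jk) kn; lra using xk.
have posy : 0 < y k -> forall j, (j < k)%N -> 0 <= y j.
  by move=> xk j jk; have := transit_le s0 bw1 rr' ty (ltnW jk) kn; lra using xk.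
have y00 : 0 < y 0%N by lra using r00 y0.
have x00 : 0 < x 0%N by lra using r00 x0.
have xn0 : x n <= 0 by lra using r00 xn.
have yn0 : y n <= 0 by lra using r00 yn.
have [xk|xk] := ltP 0 (x k); have [yk|yk] := ltP 0 (y k).
- by have := R1 _ kn (posx xk); have := R2 _ kn (posy yk); rewrite ler_norml; lra using b01 KA.
- have := transit_mixed s0 K0 bw0 bw1 rr' tx ty y00 xn0 ee b0 e01 A0 R2 L1 kn xk yk.
  by rewrite ger0_norm; lra using xk yk.
- have := transit_mixed s0 K0 bw1 bw0 rr' ty tx x00 yn0 ee' b0 e11 A0 R1 L2 kn yk xk.
  by rewrite ler0_norm; lra using xk yk.
- by have := L1 _ kn xk; have := L2 _ kn yk; rewrite ler_norml; lra using b01 KA.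
Qed.

End Window.

(** * Second-order Taylor quotients *)

Section Taylor.
Variable R : realType.
Implicit Types (f d dd ddd : R -> R) (M lo hi B h t : R).

(** The remainder of the first-order expansion at [B], divided by [h^2]. *)
Definition tau f d (B h : R) : R := (f (B + h) - f B - d B * h) / h ^+ 2.

Lemma tau_bound f d dd M lo hi B h : 0 <= M ->
  (forall x, lo < x < hi -> is_derive x 1 f (d x)) ->
  (forall x, lo < x < hi -> is_derive x 1 d (dd x)) ->
  (forall x, lo < x < hi -> `|dd x| <= M) ->
  lo < B < hi -> lo < B + h < hi -> h != 0 -> `|tau f d B h| <= M.
Proof.
move=> M0 hf hd bd BI BhI h0.
have h2 : 0 < h ^+ 2 by rewrite exprn_even_gt0.
rewrite /tau normrM normfV [`|h ^+ 2|]gtr0_norm// ler_pdivrMr//.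
suff [c [ch cI E]] : exists c, [/\ `|c - B| <= `|h|, lo < c < hi & f (B + h) - f B = d c * h].
  rewrite E -mulrBl normrM -[h ^+ 2]real_normK ?num_real// expr2 mulrA ler_wpM2r//.
  apply: le_trans (lip_open M0 hd bd cI BI) _.
  by rewrite ler_wpM2l.
have [lt|lt|E] := ltgtP 0 h; last by rewrite -E eqxx in h0.
- have [|||c cI E] := @mvt_open _ f d lo hi B (B + h) _ _ _ hf; [lra..|].
  exists c; rewrite E; split; [|lra|by congr (_ * _); ring].
  by rewrite gtr0_norm ?(gtr0_norm lt); lra.
- have [|||c cI E] := @mvt_open _ f d lo hi (B + h) B _ _ _ hf; [lra..|].
  exists c; split; [|lra|]; last by rewrite -opprB E; ring.
  by rewrite ltr0_norm ?(ltr0_norm lt); lra.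
Qed.

Lemma tau_lipB f d dd ddd M lo hi B B' h : 0 <= M ->
  (forall x, lo < x < hi -> is_derive x 1 f (d x)) ->
  (forall x, lo < x < hi -> is_derive x 1 d (dd x)) ->
  (forall x, lo < x < hi -> is_derive x 1 dd (ddd x)) ->
  (forall x, lo < x < hi -> `|ddd x| <= M) ->
  lo < B < hi -> lo < B + h < hi -> lo < B' < hi -> lo < B' + h < hi -> h != 0 ->
  `|tau f d B h - tau f d B' h| <= M * `|B - B'|.
Proof.
move=> M0 hf hd hdd bd BI BhI BI' BhI' h0.
pose lo' := Num.max lo (lo - h); pose hi' := Num.min hi (hi - h).
have inn x : (lo' < x < hi') = ((lo < x < hi) && (lo < x + h < hi)).
  rewrite /lo' /hi' gt_max lt_min; apply/idP/idP; lra.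
apply: (@lip_open _ (tau f d ^~ h) (tau d dd ^~ h) M lo' hi') => //.
- move=> x; rewrite inn => /andP[xI xhI].
  have h1 : is_derive x 1 (fun y => f (y + h)) (d (x + h)).
    apply: dv_eq (@dv_comp _ f (fun y => y + h) x _ _ (hf _ xhI) (dvD (dvI x) (dvC h x))) _; ring.
  have h2 := dvB (dvB h1 (hf _ xI)) (dvM (hd _ xI) (dvC h x)).
  apply: dv_eq (dvM h2 (dvC (h ^+ 2)^-1 x)) _.
  by rewrite /tau; ring.
- move=> x; rewrite inn => /andP[xI xhI].
  exact: (tau_bound M0 hd hdd bd).
- by rewrite inn BI BhI.
- by rewrite inn BI' BhI'.
Qed.

(* numerator of the derivative of [tau f d B] *)
Let W f d B h := (d (B + h) - d B) * h - 2 * (f (B + h) - f B - d B * h).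

Let dv_shift f d lo hi B h : (forall x, lo < x < hi -> is_derive x 1 f (d x)) ->
  lo < B + h < hi -> is_derive h 1 (fun t => f (B + t)) (d (B + h)).
Proof.
move=> hf BI; apply: dv_eq (@dv_comp _ f (fun t => B + t) h _ _ (hf _ BI) (dvD (dvC B h) (dvI h))) _; ring.
Qed.

Let W_bound f d dd ddd M lo hi B h : 0 <= M ->
  (forall x, lo < x < hi -> is_derive x 1 f (d x)) ->
  (forall x, lo < x < hi -> is_derive x 1 d (dd x)) ->
  (forall x, lo < x < hi -> is_derive x 1 dd (ddd x)) ->
  (forall x, lo < x < hi -> `|ddd x| <= M) ->
  lo < B < hi -> lo < B + h < hi -> `|W f d B h| <= M * `|h| ^+ 3.
Proof.
move=> M0 hf hd hdd bd BI BhI.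
pose W' t := dd (B + t) * t - (d (B + t) - d B).
have dW t : lo - B < t < hi - B -> is_derive t 1 (W f d B) (W' t).
  move=> tI; have tI' : lo < B + t < hi by lra.
  have h1 := dvM (dvB (dv_shift hd tI') (dvC (d B) t)) (dvI t).
  have h2 := dvB (dvB (dv_shift hf tI') (dvC (f B) t)) (dvM (dvC (d B) t) (dvI t)).
  by apply: dv_eq (dvB h1 (dvM (dvC 2 t) h2)) _; rewrite /W'; ring.
have bW' t : lo - B < t < hi - B -> `|t| <= `|h| -> `|W' t| <= M * `|h| ^+ 2.
  move=> tI th; have tI' : lo < B + t < hi by lra.
  suff [c [ct cI E]] : exists c, [/\ `|B + t - c| <= `|t|, lo < c < hi & d (B + t) - d B = dd c * t].
    rewrite /W' E -mulrBl normrM expr2 mulrA.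
    apply: ler_pM => //.
    apply: le_trans (lip_open M0 hdd bd tI' cI) _.
    by rewrite ler_wpM2l// (le_trans ct).
  have [lt|lt|E] := ltgtP 0 t.
  - have [|||c cI E] := @mvt_open _ d dd lo hi B (B + t) _ _ _ hd; [lra using BI lt tI..|].
    exists c; rewrite E; split; [|lra|by congr (_ * _); ring].
    by rewrite gtr0_norm ?(gtr0_norm lt); lra.
  - have [|||c cI E] := @mvt_open _ d dd lo hi (B + t) B _ _ _ hd; [lra using tI lt BI..|].
    exists c; split; [|lra|]; last by rewrite -opprB E; ring.
    by rewrite ltr0_norm ?(ltr0_norm lt); lra using cI.
  - by exists B; rewrite -E addr0 !subrr mulr0.
have W0 : W f d B 0 = 0 by rewrite /W addr0; ring.
have -> : `|h| ^+ 3 = `|h| ^+ 2 * `|h| by rewrite exprSr.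
rewrite mulrA -[W f d B h]subr0 -W0.
have [lt|lt|E] := ltgtP 0 h.
- have [|||c cI ->] := @mvt_open _ (W f d B) W' (lo - B) (hi - B) 0 h _ _ _ dW; [lra using BI lt BhI..|].
  rewrite normrM subr0 ler_wpM2r// bW'//; first lra.
  by rewrite !gtr0_norm; lra using cI lt.
- have [|||c cI E] := @mvt_open _ (W f d B) W' (lo - B) (hi - B) h 0 _ _ _ dW; [lra using BhI lt BI..|].
  rewrite distrC E normrM sub0r normrN ler_wpM2r// bW'//; first lra using BI BhI cI.
  by rewrite !ltr0_norm; lra using cI lt.
- by rewrite -E subrr normr0 mulr0.
Qed.

(** The increments have the same sign, so that the segment between them avoids 0,
    where the quotient is not defined; third derivatives bound the derivative. *)
Lemma tau_liph f d dd ddd M lo hi B h h' : 0 <= M ->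
  (forall x, lo < x < hi -> is_derive x 1 f (d x)) ->
  (forall x, lo < x < hi -> is_derive x 1 d (dd x)) ->
  (forall x, lo < x < hi -> is_derive x 1 dd (ddd x)) ->
  (forall x, lo < x < hi -> `|ddd x| <= M) ->
  lo < B < hi -> lo < B + h < hi -> lo < B + h' < hi -> 0 < h * h' ->
  `|tau f d B h - tau f d B h'| <= M * `|h - h'|.
Proof.
move=> M0 hf hd hdd bd BI BhI BhI' hh.
have main lo' hi' : (forall t, lo' < t < hi' -> t != 0) -> lo - B <= lo' -> hi' <= hi - B ->
    lo' < h < hi' -> lo' < h' < hi' -> `|tau f d B h - tau f d B h'| <= M * `|h - h'|.
  move=> t0 lo1 hi1 hI hI'.
  apply: (@lip_open _ (tau f d B) (fun t => W f d B t / t ^+ 3) M lo' hi') => //.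
  - move=> t tI; have tI' : lo < B + t < hi by lra.
    have tn0 := t0 _ tI; have t2 : t ^+ 2 != 0 by rewrite expf_neq0.
    have h2 := dvB (dvB (dv_shift hf tI') (dvC (f B) t)) (dvM (dvC (d B) t) (dvI t)).
    have h3 := dvV (f := fun t => t ^+ 2) t2 (dvM (dvI t) (dvI t)).
    apply: dv_eq (dvM h2 h3) _; rewrite /W.
    by field.
  - move=> t tI; have tI' : lo < B + t < hi by lra.
    have tn0 : 0 < `|t| by rewrite normr_gt0 t0.
    rewrite normrM normfV normrX ler_pdivrMr ?exprn_gt0//.
    exact: (W_bound M0 hf hd hdd bd).
have [lt|lt|E] := ltgtP 0 h; last by move: hh; rewrite -E mul0r ltxx.
- have lt' : 0 < h' by rewrite -(pmulr_rgt0 _ lt).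
  apply: (main 0 (hi - B)); try lra using M0 BI BhI BhI' hh lt lt'.
  by move=> t tI; rewrite gt_eqF//; lra.
- have lt' : h' < 0 by rewrite -(nmulr_rgt0 _ lt).
  apply: (main (lo - B) 0); try lra using M0 BI BhI BhI' hh lt lt'.
  by move=> t tI; rewrite lt_eqF//; lra.
Qed.

Lemma tau_lip f d dd ddd M lo hi B B' h h' : 0 <= M ->
  (forall x, lo < x < hi -> is_derive x 1 f (d x)) ->
  (forall x, lo < x < hi -> is_derive x 1 d (dd x)) ->
  (forall x, lo < x < hi -> is_derive x 1 dd (ddd x)) ->
  (forall x, lo < x < hi -> `|ddd x| <= M) ->
  lo < B < hi -> lo < B + h < hi -> lo < B' < hi -> lo < B' + h' < hi -> 0 < h * h' ->
  `|tau f d B h - tau f d B' h'| <= M * (`|B - B'| + `|h - h'|).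
Proof.
move=> M0 hf hd hdd bd.
wlog lt : B B' h h' / B <= B' => [H|] BI BhI BI' BhI' hh.
  have [le|le] := leP B B'; first exact: H.
  rewrite distrC [`|B - _|]distrC [`|h - _|]distrC; apply: H => //; first exact: ltW.
  by rewrite mulrC.
have h0 : h != 0 by apply/eqP => E; move: hh; rewrite E mul0r ltxx.
have h0' : h' != 0 by apply/eqP => E; move: hh; rewrite E mulr0 ltxx.
rewrite mulrDr; have [hp|hn] := ltP 0 h.
- have hp' : 0 < h' by rewrite -(pmulr_rgt0 _ hp).
  have I : lo < B + h' < hi by lra.
  have T1 := tau_liph M0 hf hd hdd bd BI BhI I hh.
  have T2 := tau_lipB M0 hf hd hdd bd BI I BI' BhI' h0'.
  have := ler_normD (tau f d B h - tau f d B h') (tau f d B h' - tau f d B' h').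
  by rewrite addrA subrK; lra.
- have hn0 : h < 0 by rewrite lt_neqAle h0.
  have hp' : h' < 0 by rewrite -(nmulr_rgt0 _ hn0).
  have I : lo < B' + h < hi by lra.
  have T1 := tau_liph M0 hf hd hdd bd BI' I BhI' hh.
  have T2 := tau_lipB M0 hf hd hdd bd BI BhI BI' I h0.
  have := ler_normD (tau f d B h - tau f d B' h) (tau f d B' h - tau f d B' h').
  by rewrite addrA subrK; lra.
Qed.

End Taylor.

(** * Ratios along an orbit *)

Section Gronwall.
Variable R : realType.
Implicit Types (C d K U : R) (e t r w D u : nat -> R).

Lemma gronwall_exp C e t n : 0 <= C -> (forall k, (k <= n)%N -> 0 <= e k) ->
  (forall k, (k < n)%N -> e k.+1 <= (1 + C * t k) * e k) ->
  e n <= expR (C * \sum_(k < n) t k) * e 0%N.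
Proof.
move=> C0; elim: n => [|n IH] e0 eS.
  by rewrite big_ord0 mulr0 expR0 mul1r.
apply: le_trans (eS _ (ltnSn n)) _.
rewrite big_ord_recr /= mulrDr expRD [expR _ * expR _]mulrC -mulrA.
have h := IH (fun k kn => e0 k (leqW kn)) (fun k kn => eS k (ltnW kn)).
apply: (@le_trans _ _ (expR (C * t n) * e n)).
  by rewrite ler_wpM2r ?e0// expR_ge1Dx.
by rewrite ler_wpM2l// expR_ge0.
Qed.

(** The ratios change by [D k * w k] and [D' k * w' k], and [D' - D] is the
    difference of successive terms of [u], which are small but whose increments
    need not be summable. Adding [w u] to the difference of the two ratios is a
    summation by parts that moves the differences to [w], which varies slowly;
    then the discrete Gronwall inequality applies. *)
Lemma ratio_close C K U : 0 <= C -> 0 <= K -> 0 <= U -> exists L : R, 0 <= L /\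
  forall (d : R) n r r' w w' D D' u, 0 <= d ->
  (forall k, (k < n)%N -> r k.+1 = r k + D k * w k) ->
  (forall k, (k < n)%N -> r' k.+1 = r' k + D' k * w' k) ->
  (forall k, (k < n)%N -> D' k - D k = u k - u k.+1) ->
  (forall k, (k < n)%N -> `|w' k - w k| <= C * (d + `|r' k - r k|)) ->
  (forall k, (k.+1 < n)%N -> `|w k.+1 - w k| <= C * D k) ->
  (forall k, (k < n)%N -> `|w k| <= C) ->
  (forall k, (k <= n)%N -> `|u k| <= U * d) ->
  (forall k, (k < n)%N -> 0 <= D k /\ 0 <= D' k) ->
  \sum_(k < n) D k <= K -> \sum_(k < n) D' k <= K ->
  `|r' 0%N - r 0%N| <= U * d ->
  `|r' n - r n| <= L * d.
Proof.
move=> C0 K0 U0.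
pose M := C * U + C * (1 + C * U).
have CU : 0 <= C * U by rewrite mulr_ge0.
have M0 : 0 <= M by rewrite addr_ge0// mulr_ge0//; lra.
exists (expR (M * (3 * K)) * (U + C * U + 1) + C * U); split.
  by rewrite addr_ge0// mulr_ge0 ?expR_ge0//; lra.
move=> d n r r' w w' D D' u d0 rS r'S Du ww wS wC uU DD sD sD' ini.
case: n => [|n] in rS r'S Du ww wS wC uU DD sD sD' *.
  apply: le_trans ini _; rewrite ler_wpM2r//.
  have h1 : 1 <= expR (M * (3 * K)).
    apply: le_trans (expR_ge1Dx _); rewrite lerDl mulr_ge0//; lra.
  have h2 : 1 * (U + C * U + 1) <= expR (M * (3 * K)) * (U + C * U + 1).
    by rewrite ler_wpM2r//; lra.
  lra.
pose eh k := (r' k - r k) + w k.-1 * u k.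
pose f k := `|eh k| + d.
have ewu k : (k <= n.+1)%N -> `|w k.-1 * u k| <= C * U * d.
  move=> kn; rewrite normrM -mulrA; apply: ler_pM => //; last exact: uU.
  by apply: wC; case: k kn => //= k; rewrite ltnS.
have er k : (k <= n.+1)%N -> `|r' k - r k| <= `|eh k| + C * U * d.
  move=> kn; have := ewu _ kn; have := ler_normB (eh k) (w k.-1 * u k).
  by rewrite /eh addrK; lra.
have fS k : (k < n.+1)%N -> f k.+1 <= (1 + M * (D k.-1 + D' k)) * f k.
  move=> kn; have [Dk Dk'] := DD _ kn.
  have Dk1 : 0 <= D k.-1 by case: k kn {Dk Dk'} => [|k] kn; [exact: (DD 0%N _).1|exact: (DD k (ltnW kn)).1].
  have E : eh k.+1 = eh k + (w k - w k.-1) * u k + D' k * (w' k - w k).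
    have := Du _ kn; rewrite /eh (rS _ kn) (r'S _ kn) /= => E.
    have -> : D k = D' k - u k + u k.+1 by lra.
    ring.
  have h1 : `|(w k - w k.-1) * u k| <= C * D k.-1 * (U * d).
    rewrite normrM; apply: ler_pM => //; last by apply: uU; exact: ltnW.
    case: k kn {Dk Dk' E} Dk1 => [|k] kn Dk1 /=; last exact: wS.
    by rewrite subrr normr0 mulr_ge0.
  have h2 : `|D' k * (w' k - w k)| <= D' k * (C * (d + (`|eh k| + C * U * d))).
    rewrite normrM (ger0_norm Dk') ler_wpM2l//.
    apply: le_trans (ww _ kn) _; rewrite ler_wpM2l// lerD2l.
    by apply: er; exact: ltnW.
  rewrite /f E.
  have h3 := ler_normD (eh k + (w k - w k.-1) * u k) (D' k * (w' k - w k)).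
  have h4 := ler_normD (eh k) ((w k - w k.-1) * u k).
  have N0 : 0 <= `|eh k| by [].
  move: (`|eh k|) N0 h1 h2 h3 h4 => N N0 h1 h2 h3 h4.
  have h5 : C * D k.-1 * (U * d) <= M * D k.-1 * (N + d).
    have -> : C * D k.-1 * (U * d) = (C * U) * D k.-1 * d by ring.
    apply: ler_pM => //; rewrite ?mulr_ge0//; last lra using N0.
    by rewrite ler_wpM2r// lerDl mulr_ge0//; lra using CU.
  have h6 : D' k * (C * (d + (N + C * U * d))) <= M * D' k * (N + d).
    rewrite -subr_ge0 (_ : _ - _ =
      C * U * D' k * (N + d) + C * D' k * (C * U * N)); last by rewrite /M; ring.
    by rewrite addr_ge0// !mulr_ge0//; lra using d0 N0.
  have -> : (1 + M * (D k.-1 + D' k)) * (N + d) = N + d + M * D k.-1 * (N + d) + M * D' k * (N + d) by ring.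
  lra using h1 h2 h3 h4 h5 h6.
have := gronwall_exp M0 (fun k _ => addr_ge0 (normr_ge0 (eh k)) d0) fS.
rewrite big_split /=.
have sD1 : \sum_(k < n.+1) D k.-1 <= 2 * K.
  rewrite big_ord_recl /=.
  have h1 : D 0%N <= K.
    apply: le_trans sD; rewrite big_ord_recl /= lerDl sumr_ge0// => i _.
    by have [] := DD _ (ltn_ord (lift ord0 i)).
  have h2 : \sum_(i < n) D (bump 0 i).-1 <= K.
    apply: le_trans sD; rewrite big_ord_recr /=.
    rewrite (eq_bigr (fun i : 'I_n => D i)) => [|i _]; last by rewrite /bump.
    by rewrite lerDl; have [] := DD n (ltnSn n).
  lra using h1 h2.
move=> h; have f0 : f 0%N <= (U + C * U + 1) * d.
  have := ewu _ (leq0n n.+1); have := ler_normD (r' 0%N - r 0%N) (w 0%N * u 0%N).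
  by rewrite /f /eh /=; lra using ini.
have h2 : f n.+1 <= expR (M * (3 * K)) * ((U + C * U + 1) * d).
  apply: le_trans h _.
  apply: ler_pM; [exact: expR_ge0|by rewrite addr_ge0| |exact: f0].
  by rewrite ler_expR ler_wpM2l//; lra using sD' sD1.
have := er _ (leqnn n.+1); rewrite /f in h2; lra using d0 h2.
Qed.

End Gronwall.

Section Ratio.
Variable R : realType.
Implicit Types (f d : R -> R) (r B D S v c V K Q M : R).

(** [slope] and [bend] describe the image of a pair of adjacent intervals
    [B - D, B] and [B, B + r D] of ratio [r]: the first is the mean derivative on
    [B - D, B], and [D] times their quotient is the change of the ratio. *)
Definition slope f B D := (f B - f (B - D)) / D.

Definition bend f d r B D := r ^+ 2 * tau f d B (r * D) + r * tau f d B (- D).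

Definition ratio_rate f d r B D := bend f d r B D / slope f B D.

Lemma ratio_step f d r B D : r * D != 0 -> slope f B D != 0 ->
  (f (B + r * D) - f B) / (f B - f (B - D)) = r + D * ratio_rate f d r B D.
Proof.
move=> rD; have D0 : D != 0 by apply: contraNneq rD => ->; rewrite mulr0.
have r0 : r != 0 by apply: contraNneq rD => ->; rewrite mul0r.
rewrite /slope mulf_eq0 invr_eq0 negb_or D0 andbT => S0.
rewrite /ratio_rate /bend /slope /tau.
by field; rewrite S0 r0 D0.
Qed.

Lemma quot_lip v v' S S' c V : 0 < c -> c <= S -> c <= S' -> `|v'| <= V ->
  `|v / S - v' / S'| <= c^-1 * `|v - v'| + V * c^-1 ^+ 2 * `|S - S'|.
Proof.
move=> c0 cS cS' vV.
have S0 : 0 < S by lra.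
have S0' : 0 < S' by lra.
have iS : S^-1 <= c^-1 by rewrite lef_pV2.
have iS' : S'^-1 <= c^-1 by rewrite lef_pV2.
have E : v / S - v' / S' = (v - v') * S^-1 + v' * (S^-1 * S'^-1) * (S' - S).
  by field; rewrite !gt_eqF.
rewrite E; apply: le_trans (ler_normD _ _) _; apply: lerD.
  by rewrite normrM mulrC ler_wpM2r// ger0_norm ?invr_ge0// ltW.
rewrite !normrM [`|S' - S|]distrC ler_wpM2r//.
apply: ler_pM => //; rewrite -?normrM//.
rewrite ger0_norm ?mulr_ge0 ?invr_ge0 ?(ltW S0) ?(ltW S0')//.
by rewrite expr2; apply: ler_pM; rewrite ?invr_ge0 ?(ltW S0) ?(ltW S0').
Qed.

Definition ratio_ok (m q Q K r B D : R) : Prop :=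
  [/\ 0 < r <= Q, 0 < D <= K, m <= B - D & B + r * D < q].

Lemma bend_combine (M K Q r r' a a' b b' bB bD : R) : 0 <= M -> 0 <= K -> 0 <= Q ->
  0 < r <= Q -> 0 < r' <= Q -> `|a| <= M -> `|b| <= M ->
  `|a - a'| <= M * (bB + (K * `|r - r'| + Q * bD)) -> `|b - b'| <= M * (bB + bD) ->
  0 <= bB -> 0 <= bD ->
  `|r ^+ 2 * a + r * b - (r' ^+ 2 * a' + r' * b')| <=
  (2 * Q * M + M + Q ^+ 2 * M * (1 + K + Q) + Q * M) * (`|r - r'| + bB + bD).
Proof.
move=> M0 K0 Q0 /andP[r0 rQ] /andP[r0' rQ'] t1 t2 l1 l2 bB0 bD0; set br := `|r - r'|.
have -> : r ^+ 2 * a + r * b - (r' ^+ 2 * a' + r' * b') =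
  (r - r') * (r + r') * a + r' ^+ 2 * (a - a') + (r - r') * b + r' * (b - b') by ring.
have h1 : `|(r - r') * (r + r') * a| <= br * (2 * Q) * M.
  rewrite 2!normrM; apply: ler_pM => //; rewrite ?mulr_ge0//.
  by rewrite ler_wpM2l// ger0_norm; lra using rQ rQ' r0 r0'.
have h2 : `|r' ^+ 2 * (a - a')| <= Q ^+ 2 * (M * (bB + (K * br + Q * bD))).
  rewrite normrM normrX (gtr0_norm r0'); apply: ler_pM; rewrite ?sqr_ge0//.
  by rewrite ler_sqr ?nnegrE//; lra using r0'.
have h3 : `|(r - r') * b| <= br * M by rewrite normrM ler_wpM2l.
have h4 : `|r' * (b - b')| <= Q * (M * (bB + bD)).
  by rewrite normrM (gtr0_norm r0'); apply: ler_pM => //; lra using r0'.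
have n1 := ler_normD ((r - r') * (r + r') * a + r' ^+ 2 * (a - a') + (r - r') * b) (r' * (b - b')).
have n2 := ler_normD ((r - r') * (r + r') * a + r' ^+ 2 * (a - a')) ((r - r') * b).
have n3 := ler_normD ((r - r') * (r + r') * a) (r' ^+ 2 * (a - a')).
apply: (@le_trans _ _ (br * (2 * Q) * M + Q ^+ 2 * (M * (bB + (K * br + Q * bD))) + br * M + Q * (M * (bB + bD)))).
  by lra using h1 h2 h3 h4 n1 n2 n3.
rewrite -subr_ge0 (_ : _ - _ = 2 * Q * M * (bB + bD) + M * (bB + bD) +
  Q ^+ 2 * M * (br + bD + K * (bB + bD) + Q * (br + bB)) + Q * M * br); last by ring.
have br0 : 0 <= br := normr_ge0 _.
by nonneg.
Qed.

Variables (q m M Q K : R) (f d dd ddd : R -> R).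
Hypothesis m0 : 0 < m.
Hypothesis M0 : 0 <= M.
Hypothesis K0 : 0 <= K.
Hypothesis Q0 : 0 <= Q.
Hypothesis hf : forall x, 0 < x < q -> is_derive x 1 f (d x).
Hypothesis hd : forall x, 0 < x < q -> is_derive x 1 d (dd x).
Hypothesis bdd : forall x, 0 < x < q -> `|dd x| <= M.

Lemma ratio_ok_in r B D : ratio_ok m q Q K r B D ->
  [/\ 0 < B < q, 0 < B + r * D < q, 0 < B + - D < q, r * D != 0 & - D != 0].
Proof.
move=> [/andP[r0 rQ] /andP[D0 DK] mB Bq]; have m0' := m0.
have rD : 0 < r * D by rewrite mulr_gt0.
by split; [lra|lra|lra|rewrite gt_eqF|rewrite lt_eqF ?oppr_lt0].
Qed.

Lemma bend_bound r B D : ratio_ok m q Q K r B D ->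
  `|bend f d r B D| <= (Q ^+ 2 + Q) * M.
Proof.
move=> ok; have [BI CI AI rD nD] := ratio_ok_in ok.
have t1 := tau_bound M0 hf hd bdd BI CI rD.
have t2 := tau_bound M0 hf hd bdd BI AI nD.
have [/andP[r0 rQ] _ _ _] := ok.
have Q0' := Q0; rewrite mulrDl; apply: le_trans (ler_normD _ _) _.
apply: lerD; rewrite normrM ?normrX (ger0_norm (ltW r0)).
  apply: ler_pM; rewrite ?sqr_ge0//.
  by rewrite ler_sqr ?nnegrE//; lra.
by apply: ler_pM => //; lra.
Qed.

Lemma slopeE r B D : ratio_ok m q Q K r B D ->
  slope f B D = d B - D * tau f d B (- D).
Proof.
move=> ok; have [BI CI AI rD nD] := ratio_ok_in ok.
by rewrite /slope /tau; field; rewrite -oppr_eq0.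
Qed.

Lemma slope_bound N r B D : 0 <= N -> (forall x, 0 < x < q -> `|d x| <= N) ->
  ratio_ok m q Q K r B D -> `|slope f B D| <= N.
Proof.
move=> N0 bd ok; have [BI CI AI rD nD] := ratio_ok_in ok.
have [_ /andP[D0 _] _ _] := ok.
rewrite /slope normrM normfV (gtr0_norm D0) ler_pdivrMr//.
apply: le_trans (lip_open N0 hf bd BI AI) _.
by rewrite opprB addrC subrK gtr0_norm.
Qed.

Lemma slope_ge c r B D : (forall x, m <= x < q -> c <= d x) ->
  ratio_ok m q Q K r B D -> c <= slope f B D.
Proof.
move=> low ok; have [BI CI AI rD nD] := ratio_ok_in ok.
have [_ /andP[D0 _] mB _] := ok.
have [|||x xI E] := @mvt_open _ f d 0 q (B - D) B _ _ _ hf; [lra..|].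
rewrite /slope E ler_pdivlMr//.
have -> : B - (B - D) = D by ring.
by rewrite ler_pM2r//; apply: low; lra.
Qed.

Hypothesis hdd : forall x, 0 < x < q -> is_derive x 1 dd (ddd x).
Hypothesis bddd : forall x, 0 < x < q -> `|ddd x| <= M.

Lemma bend_lip r B D r' B' D' : ratio_ok m q Q K r B D -> ratio_ok m q Q K r' B' D' ->
  `|bend f d r B D - bend f d r' B' D'| <=
  (2 * Q * M + M + Q ^+ 2 * M * (1 + K + Q) + Q * M) *
  (`|r - r'| + `|B - B'| + `|D - D'|).
Proof.
move=> ok ok'; have [BI CI AI rD nD] := ratio_ok_in ok.
have [BI' CI' AI' rD' nD'] := ratio_ok_in ok'.
have t1 := tau_bound M0 hf hd bdd BI CI rD.
have t2 := tau_bound M0 hf hd bdd BI AI nD.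
have [/andP[r0 rQ] /andP[D0 DK] _ _] := ok.
have [/andP[r0' rQ'] /andP[D0' DK'] _ _] := ok'.
have s1 : 0 < r * D * (r' * D') by rewrite !mulr_gt0.
have s2 : 0 < - D * - D' by rewrite mulrNN mulr_gt0.
have l1 := tau_lip M0 hf hd hdd bddd BI CI BI' CI' s1.
have l2 := tau_lip M0 hf hd hdd bddd BI AI BI' AI' s2.
have rDl : `|r * D - r' * D'| <= K * `|r - r'| + Q * `|D - D'|.
  have -> : r * D - r' * D' = D * (r - r') + r' * (D - D') by ring.
  apply: le_trans (ler_normD _ _) _; rewrite !normrM (gtr0_norm D0) (gtr0_norm r0').
  by apply: lerD; rewrite ler_wpM2r.
have DDl : `|- D - - D'| = `|D - D'| by rewrite -opprD normrN.
rewrite DDl in l2; rewrite /bend.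
apply: (bend_combine M0 K0 Q0 _ _ t1 t2 _ l2) => //; [by rewrite r0 | by rewrite r0' |].
by apply: le_trans l1 _; rewrite ler_wpM2l// lerD2l.
Qed.

Lemma slope_lip r B D r' B' D' : ratio_ok m q Q K r B D -> ratio_ok m q Q K r' B' D' ->
  `|slope f B D - slope f B' D'| <= (2 * M + K * M) * (`|B - B'| + `|D - D'|).
Proof.
move=> ok ok'; rewrite (slopeE ok) (slopeE ok').
have [BI CI AI rD nD] := ratio_ok_in ok.
have [BI' CI' AI' rD' nD'] := ratio_ok_in ok'.
have [_ /andP[D0 DK] _ _] := ok.
have [_ /andP[D0' DK'] _ _] := ok'.
have t2 := tau_bound M0 hf hd bdd BI AI nD.
have s2 : 0 < - D * - D' by rewrite mulrNN mulr_gt0.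
have l2 := tau_lip M0 hf hd hdd bddd BI AI BI' AI' s2.
rewrite -[- D - - D']opprD normrN in l2.
have l1 := lip_open M0 hd bdd BI BI'.
move: (tau f d B (- D)) (tau f d B' (- D')) t2 l2 => b b' t2 l2.
have -> : d B - D * b - (d B' - D' * b') = (d B - d B') - ((D - D') * b + D' * (b - b')) by ring.
have n1 := ler_normB (d B - d B') ((D - D') * b + D' * (b - b')).
have n2 := ler_normD ((D - D') * b) (D' * (b - b')).
have h1 : `|(D - D') * b| <= `|D - D'| * M by rewrite normrM ler_wpM2l.
have h2 : `|D' * (b - b')| <= K * (M * (`|B - B'| + `|D - D'|)).
  by rewrite normrM (gtr0_norm D0'); apply: ler_pM => //; lra.
have h3 : 0 <= M * (`|B - B'| + `|D - D'|) by rewrite mulr_ge0// addr_ge0.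
have h4 : 0 <= M * `|B - B'| by rewrite mulr_ge0.
have h5 : 0 <= M * `|D - D'| by rewrite mulr_ge0.
lra.
Qed.

End Ratio.

(** * Perturbation of landing points *)

(** Seals the defining equation of a constant, which the arithmetic tactics then
    treat as an atom. *)
Variant boxed (P : Prop) : Prop := Box of P.
Lemma unbox P : boxed P -> P. Proof. by case. Qed.

Section Perturbation.
Variable R : realType.
Implicit Types (f e d : R -> R) (K Q m q delta : R).

Record small_map delta q e e1 e2 : Prop := SmallMap {
  sm_d : forall x, 0 < x < q -> is_derive x 1 e (e1 x);
  sm_dd : forall x, 0 < x < q -> is_derive x 1 e1 (e2 x);
  sm_0 : forall x, 0 < x < q -> `|e x| <= delta;
  sm_1 : forall x, 0 < x < q -> `|e1 x| <= delta;
  sm_2 : forall x, 0 < x < q -> `|e2 x| <= delta }.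

Lemma bm_m0 K q m f d dd ddd : base_map K q m f d dd ddd -> 0 < m.
Proof.
move=> bm; apply: lt_le_trans (bm_m bm); rewrite invr_gt0.
by apply: lt_le_trans (bm_K bm).
Qed.

Lemma ratio_rate_lip K Q : 1 <= K -> 0 <= Q -> exists2 C : R, 0 <= C &
  forall q m f d dd ddd, base_map K q m f d dd ddd ->
  forall r B D r' B' D', ratio_ok m q Q K r B D -> ratio_ok m q Q K r' B' D' ->
  `|ratio_rate f d r B D| <= C /\
  `|ratio_rate f d r B D - ratio_rate f d r' B' D'| <= C * (`|r - r'| + `|B - B'| + `|D - D'|).
Proof.
move=> K1 Q0; have K0 : 0 <= K by plra.
pose V := (Q ^+ 2 + Q) * K.
pose Cb := 2 * Q * K + K + Q ^+ 2 * K * (1 + K + Q) + Q * K.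
pose Cs := 2 * K + K * K.
have V0 : 0 <= V by rewrite /V; nonneg.
have Cb0 : 0 <= Cb by rewrite /Cb; nonneg.
have Cs0 : 0 <= Cs by rewrite /Cs; nonneg.
have P0 : 0 <= V * K ^+ 2 * Cs by nonneg.
have P1 : 0 <= K * Cb by nonneg.
have P2 : 0 <= V * K by nonneg.
exists (K * Cb + V * K ^+ 2 * Cs + V * K); first by nonneg.
move=> q m f d dd ddd bm r B D r' B' D' ok ok'.
have m0 := bm_m0 bm.
have Ki : 0 < K^-1 by rewrite invr_gt0; plra.
have S := slope_ge m0 (bm_d bm) (bm_low bm) ok.
have S' := slope_ge m0 (bm_d bm) (bm_low bm) ok'.
have b1 := bend_bound m0 K0 Q0 (bm_d bm) (bm_dd bm) (bm_ddK bm) ok.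
have b2 := bend_bound m0 K0 Q0 (bm_d bm) (bm_dd bm) (bm_ddK bm) ok'.
split.
  have S0 : 0 < slope f B D by plra.
  rewrite /ratio_rate normrM normfV (gtr0_norm S0).
  apply: (@le_trans _ _ (V * K)); last by rewrite lerDr addr_ge0.
  apply: ler_pM => //; first by rewrite invr_ge0 ltW.
  by rewrite -[K]invrK lef_pV2.
have q1 := quot_lip (bend f d r B D) Ki S S' b2.
have l1 := bend_lip m0 K0 K0 Q0 (bm_d bm) (bm_dd bm) (bm_ddK bm) (bm_ddd bm) (bm_dddK bm) ok ok'.
have l2 := slope_lip m0 K0 (bm_d bm) (bm_dd bm) (bm_ddK bm) (bm_ddd bm) (bm_dddK bm) ok ok'.
apply: le_trans q1 _; rewrite invrK.
have N1 : 0 <= `|r - r'| by []. have N2 : 0 <= `|B - B'| by []. have N3 : 0 <= `|D - D'| by [].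
move: (`|r - r'|) (`|B - B'|) (`|D - D'|) N1 N2 N3 l1 l2 => n1 n2 n3 N1 N2 N3 l1 l2.
have h1 := ler_wpM2l K0 l1.
have VK : 0 <= V * K ^+ 2 by nonneg.
have h2 := ler_wpM2l VK l2.
apply: le_trans (lerD h1 h2) _; rewrite -/Cb -/Cs -subr_ge0.
rewrite (_ : _ - _ = V * K ^+ 2 * Cs * n1 + V * K * (n1 + n2 + n3)); last by ring.
by nonneg.
Qed.

Lemma ratio_rate_perturb K Q : 1 <= K -> 0 <= Q -> exists2 C : R, 0 <= C &
  forall q m f d dd ddd delta e e1 e2, base_map K q m f d dd ddd ->
  0 <= delta -> small_map delta q e e1 e2 ->
  (forall x, m <= x < q -> (2 * K)^-1 <= d x + e1 x) ->
  forall r B D, ratio_ok m q Q K r B D ->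
  `|ratio_rate (fun x => f x + e x) (fun x => d x + e1 x) r B D - ratio_rate f d r B D| <= C * delta.
Proof.
move=> K1 Q0; have K0 : 0 <= K by plra.
pose V := (Q ^+ 2 + Q) * K.
exists (2 * K * (Q ^+ 2 + Q) + V * (2 * K) ^+ 2); first by rewrite /V; nonneg.
move=> q m f d dd ddd delta e e1 e2 bm d0 sm low r B D ok.
have m0 := bm_m0 bm.
have Ki : 0 < (2 * K)^-1 by rewrite invr_gt0; plra.
have KK : (2 * K)^-1 <= K^-1 by rewrite lef_pV2 ?posrE; plra.
have lowf x : m <= x < q -> (2 * K)^-1 <= d x by move=> /(bm_low bm); plra.
have hF x : 0 < x < q -> is_derive x 1 (fun x => f x + e x) (d x + e1 x).
  by move=> xq; exact: dvD (bm_d bm xq) (sm_d sm xq).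
have S := slope_ge m0 hF low ok.
have S' := slope_ge m0 (bm_d bm) lowf ok.
have b2 := bend_bound m0 K0 Q0 (bm_d bm) (bm_dd bm) (bm_ddK bm) ok.
have be := bend_bound m0 d0 Q0 (sm_d sm) (sm_dd sm) (sm_2 sm) ok.
have se := slope_bound m0 (sm_d sm) d0 (sm_1 sm) ok.
apply: le_trans (quot_lip _ Ki S S' b2) _; rewrite invrK.
have -> : bend (fun x => f x + e x) (fun x => d x + e1 x) r B D - bend f d r B D = bend e e1 r B D.
  by rewrite /bend /tau; ring.
have -> : slope (fun x => f x + e x) B D - slope f B D = slope e B D.
  by rewrite /slope; ring.
rewrite [X in _ <= X]mulrDl; apply: lerD.
  by rewrite -[X in _ <= X]mulrA ler_wpM2l//; plra.
by rewrite ler_wpM2l//; rewrite /V; nonneg.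
Qed.

Lemma sum_telescope (X : nat -> R) n : \sum_(k < n) (X k - X k.+1) = X 0%N - X n.
Proof.
elim: n => [|n IH]; first by rewrite big_ord0 subrr.
by rewrite big_ord_recr /= IH; ring.
Qed.

(** A fundamental domain of the orbit of [xs] contains [C]; its relative
    position there is comparable to 1 or smaller. *)
Lemma interlace (F d : R -> R) (q m c : R) a (xs C : R) : {homo F : x y / x <= y} ->
  (forall x, 0 < x < q -> is_derive x 1 F (d x)) -> 0 < m -> 0 < c ->
  (forall x, m <= x < q -> c <= d x) -> xs < C -> C < q -> F C <= xs ->
  (forall k, (k < a)%N -> m <= iter k F xs) ->
  (forall k, (k < a)%N -> iter k.+1 F xs < iter k F xs) ->
  forall k, (k < a)%N ->
  [/\ 0 < iter k F C - iter k F xs, iter k F C < q &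
      iter k F C - iter k F xs <= c^-1 * (iter k F xs - iter k.+1 F xs)].
Proof.
move=> hF dF m0 c0 low xC Cq FC mX dec.
have stepc x y : m <= x -> x < y -> y < q -> c * (y - x) <= F y - F x.
  move=> mx xy yq; have [|||z zI ->] := @mvt_open _ F d 0 q x y _ _ _ dF; [plra..|].
  by rewrite ler_wpM2r; [|plra|apply: low; plra].
have cX k : iter k.+1 F C <= iter k F xs.
  by elim: k => [//|k IH] /=; apply: hF.
have Xxs k : (k < a)%N -> iter k F xs <= xs.
  elim: k => [//|k IH ka]; apply: le_trans (IH (ltnW ka)); exact: ltW (dec _ (ltnW ka)).
have ltk k : (k < a)%N -> 0 < iter k F C - iter k F xs /\ iter k F C < q.
  elim: k => [_|k IH ka]; first by rewrite subr_gt0.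
  have [l0 cq] := IH (ltnW ka); split; last first.
    by apply: le_lt_trans (cX k) _; have := Xxs _ (ltnW ka); plra.
  have := stepc _ _ (mX _ (ltnW ka)) _ cq; rewrite -subr_gt0 => /(_ l0).
  by apply: lt_le_trans; rewrite mulr_gt0.
move=> k ka; have [l0 cq] := ltk k ka; split=> //.
rewrite mulrC ler_pdivlMr// mulrC.
have := stepc _ _ (mX _ ka) _ cq; rewrite -subr_gt0 => /(_ l0).
by move/le_trans; apply; rewrite lerD2r; exact: cX.
Qed.

(** Let X_k, Y_k be the orbits of [xs] and c_k, c'_k those of [C] under the two
    maps. The ratio (c_k - X_k) / (X_k - X_(k+1)) and its analogue for the
    perturbed map stay close by [ratio_close], as the lengths X_k - X_(k+1) have a
    bounded sum; so the positions of c_k and c'_k at the end are as close as those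
    of X_k and Y_k. The last step is made separately because X_a may have left
    [m, q]. *)
Lemma distortion K U : 1 <= K -> 1 <= U -> exists2 L : R, 0 <= L &
  forall q m f d dd ddd delta e e1 e2 a xs C,
  base_map K q m f d dd ddd -> 0 <= delta -> delta <= (2 * K)^-1 ->
  small_map delta q e e1 e2 ->
  {homo f : x y / x <= y} -> {homo (fun x => f x + e x) : x y / x <= y} ->
  xs < C -> C < q -> f C <= xs -> f C + e C <= xs -> U^-1 <= xs - f xs ->
  (0 < a)%N ->
  (forall k, (k < a)%N -> m <= iter k f xs) ->
  (forall k, (k < a)%N -> m <= iter k (fun x => f x + e x) xs) ->
  (forall k, (k < a)%N -> iter k.+1 (fun x => f x + e x) xs < iter k (fun x => f x + e x) xs) ->
  (forall k, (k <= a)%N -> `|iter k (fun x => f x + e x) xs - iter k f xs| <= U * delta) ->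
  `|iter a (fun x => f x + e x) C - iter a f C| <= L * delta.
Proof.
move=> K1 U1; have K0 : 0 <= K by plra.
have [Q QE] : {Q : R | Q = 2 * K} by exists (2 * K).
have Q0 : 0 <= Q by plra.
have [C1 C10 omL] := ratio_rate_lip K1 Q0.
have [C2 C20 omP] := ratio_rate_perturb K1 Q0.
have [C3 C3E] : {C3 : R | boxed (C3 = C1 * (3 * U + 1) + C2)} by eexists; constructor.
have C30 : 0 <= C3 by rewrite (unbox C3E); nonneg; plra.
have [C4 C4E] : {C4 : R | boxed (C4 = C3 + C1 * (C1 + K + 2))} by eexists; constructor.
have C40 : 0 <= C4 by rewrite (unbox C4E); nonneg.
have [U2 U2E] : {U2 : R | boxed (U2 = U + 2 * Q * U * U)} by eexists; constructor.
have U20 : 0 <= U2 by rewrite (unbox U2E); nonneg; lra using U1.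
have [L [L0 close]] := ratio_close C40 K0 U20.
have [L1 L1E] : {L1 : R | boxed (L1 = U + K * K * L + Q * (2 * U))} by eexists; constructor.
have U0 : 0 <= U by plra.
have L10 : 0 <= L1 by rewrite (unbox L1E); nonneg.
exists (1 + K * L1); first by nonneg.
move=> q m f d dd ddd delta e e1 e2 a xs C bm d0 dK sm hf.
have [F FE] : {F : R -> R | F = fun x => f x + e x} by eexists.
have [D1 D1E] : {D1 : R -> R | D1 = fun x => d x + e1 x} by eexists.
rewrite -FE.
move=> hF xC Cq fC FC Ug a0 mX mY decY uU.
have m0 := bm_m0 bm.
have Ki : 0 < (2 * K)^-1 by rewrite invr_gt0; plra.
have KK : K^-1 = 2 * (2 * K)^-1 by field; lra using K1.
have lowf x : m <= x < q -> (2 * K)^-1 <= d x by move=> /(bm_low bm); lra using d0 dK.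
have lowF0 x : m <= x < q -> (2 * K)^-1 <= d x + e1 x.
  move=> xq; have xq' : 0 < x < q by lra using m0 xq.
  by have := bm_low bm xq; have := sm_1 sm xq'; rewrite ler_norml; lra using dK.
have lowF x : m <= x < q -> (2 * K)^-1 <= D1 x by rewrite D1E; exact: lowF0.
clear KK.
have dF x : 0 < x < q -> is_derive x 1 F (D1 x).
  by move=> xq; rewrite FE D1E; exact: dvD (bm_d bm xq) (sm_d sm xq).
have FC' : F C <= xs by rewrite FE.
have decX k : (k < a)%N -> iter k f xs <= xs /\ iter k.+1 f xs < iter k f xs.
  have bel j : (j < a)%N -> iter j f xs <= xs -> iter j.+1 f xs < iter j f xs.
    move=> ja le; rewrite iterS; apply: (bm_below bm).
    by rewrite mX//=; lra using xC Cq le.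
  elim: k => [ka|k IH ka]; first by split=> //; exact: bel.
  have [le lt] := IH (ltnW ka); have le' : iter k.+1 f xs <= xs by lra using le lt.
  by split=> //; exact: bel.
have I0 := interlace hf (bm_d bm) m0 Ki lowf xC Cq fC mX (fun k ka => (decX k ka).2).
have I1 := interlace hF dF m0 Ki lowF xC Cq FC' mY decY.
rewrite invrK -QE in I0 I1.
have [X XE] : {X : nat -> R | forall k, iter k f xs = X k} by eexists.
have [Y YE] : {Y : nat -> R | forall k, iter k F xs = Y k} by eexists.
have [c cE] : {c : nat -> R | forall k, iter k f C = c k} by eexists.
have [c' cE'] : {c' : nat -> R | forall k, iter k F C = c' k} by eexists.
have XS k : X k.+1 = f (X k) by rewrite -!XE.
have YS k : Y k.+1 = F (Y k) by rewrite -!YE.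
have cS k : c k.+1 = f (c k) by rewrite -!cE.
have cS' k : c' k.+1 = F (c' k) by rewrite -!cE'.
have [D DE] : {D : nat -> R | forall k, D k = X k - X k.+1} by eexists.
have [D' DE'] : {D' : nat -> R | forall k, D' k = Y k - Y k.+1} by eexists.
have [r rdef] : {r : nat -> R | forall k, r k = (c k - X k) / D k} by eexists.
have [r' rdef'] : {r' : nat -> R | forall k, r' k = (c' k - Y k) / D' k} by eexists.
have [X0 Y0 c0 c0'] : [/\ X 0%N = xs, Y 0%N = xs, c 0%N = C & c' 0%N = C].
  by rewrite -XE -YE -cE -cE'.
have {}mX k : (k < a)%N -> m <= X k by rewrite -XE; exact: mX.
have {}mY k : (k < a)%N -> m <= Y k by rewrite -YE; exact: mY.
have {}decY k : (k < a)%N -> Y k.+1 < Y k by rewrite -!YE; exact: decY.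
have {}decX k : (k < a)%N -> X k <= xs /\ X k.+1 < X k by rewrite -!XE; exact: decX.
have uS k : (k <= a)%N -> `|Y k - X k| <= U * delta by rewrite -XE -YE; exact: uU.
have {}I0 k : (k < a)%N -> [/\ 0 < c k - X k, c k < q & c k - X k <= Q * D k].
  by rewrite DE -cE -!XE; exact: I0.
have {}I1 k : (k < a)%N -> [/\ 0 < c' k - Y k, c' k < q & c' k - Y k <= Q * D' k].
  by rewrite DE' -cE' -!YE; exact: I1.
rewrite cE cE'; clear uU.
have Dp k : (k < a)%N -> 0 < D k by move=> ka; rewrite DE subr_gt0; exact: (decX k ka).2.
have Dp' k : (k < a)%N -> 0 < D' k by move=> ka; rewrite DE' subr_gt0; exact: decY.
have rE k : (k < a)%N -> r k * D k = c k - X k.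
  by move=> ka; rewrite rdef divfK// gt_eqF// Dp.
have rE' k : (k < a)%N -> r' k * D' k = c' k - Y k.
  by move=> ka; rewrite rdef' divfK// gt_eqF// Dp'.
have rQ k : (k < a)%N -> 0 < r k <= Q.
  move=> ka; have [l0 _ lQ] := I0 _ ka; rewrite rdef divr_gt0 ?Dp//=.
  by rewrite ler_pdivrMr// Dp.
have rQ' k : (k < a)%N -> 0 < r' k <= Q.
  move=> ka; have [l0 _ lQ] := I1 _ ka; rewrite rdef' divr_gt0 ?Dp'//=.
  by rewrite ler_pdivrMr// Dp'.
have XI k : (k < a)%N -> m <= X k < q.
  move=> ka; have [l0 lq _] := I0 _ ka; rewrite mX//=.
  lra using l0 lq.
have YI k : (k < a)%N -> m <= Y k < q.
  move=> ka; have [l0 lq _] := I1 _ ka; rewrite mY//=.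
  lra using l0 lq.
have qK := bm_q bm.
have ok k : (k.+1 < a)%N -> ratio_ok m q Q K (r k) (X k) (D k).
  move=> ka; have ka' := ltnW ka; have XIk := XI _ ka'; have XIk' := XI _ ka.
  have [_ lq _] := I0 _ ka'; have Dk := Dp _ ka'.
  have DEk := DE k; split; [exact: rQ|lra using m0 qK XIk XIk' Dk DEk|lra using XIk' DEk|].
  by rewrite rE// addrC subrK.
have ok' k : (k.+1 < a)%N -> ratio_ok m q Q K (r' k) (Y k) (D' k).
  move=> ka; have ka' := ltnW ka; have YIk := YI _ ka'; have YIk' := YI _ ka.
  have [_ lq _] := I1 _ ka'; have Dk := Dp' _ ka'.
  have DEk := DE' k; split; [exact: rQ'|lra using m0 qK YIk YIk' Dk DEk|lra using YIk' DEk|].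
  by rewrite rE'// addrC subrK.
have DD k : (k < a)%N -> `|D' k - D k| <= 2 * (U * delta).
  move=> ka; have h1 := uS _ (ltnW ka); have h2 := uS _ ka.
  have := ler_normB (Y k - X k) (Y k.+1 - X k.+1).
  by rewrite (_ : _ - _ = D' k - D k); [lra using h1 h2|rewrite DE DE'; ring].
case: a a0 mX mY decY decX I0 I1 Dp Dp' rE rE' rQ rQ' XI YI ok ok' uS DD
  => // n _ mX mY decY decX I0 I1 Dp Dp' rE rE' rQ rQ' XI YI ok ok' uS DD.
have CI : 0 < C < q by have := mX _ (ltn0Sn n); lra using xC Cq m0 X0.
have lipf x y : 0 < x < q -> 0 < y < q -> `|f x - f y| <= K * `|x - y|.
  by move=> xI yI; exact: lip_open K0 (bm_d bm) (bm_dK bm) xI yI.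
have last : `|c' n - c n| <= L1 * delta ->
    `|c' n.+1 - c n.+1| <= (1 + K * L1) * delta.
  move=> h; have [l0 lq _] := I0 _ (ltnSn n); have [l0' lq' _] := I1 _ (ltnSn n).
  have XIn := XI _ (ltnSn n); have YIn := YI _ (ltnSn n).
  have cI : 0 < c n < q by lra using m0 l0 lq XIn.
  have cI' : 0 < c' n < q by lra using m0 l0' lq' YIn.
  rewrite cS cS' FE.
  have h1 := lipf _ _ cI' cI; have h2 := sm_0 sm cI'.
  have h3 := ler_wpM2l K0 h.
  have := ler_normD (e (c' n)) (f (c' n) - f (c n)).
  by rewrite addrA [e _ + f _]addrC; lra using h1 h2 h3.
have Ud : 0 <= U * delta by nonneg.
case: n => [|n] in last mX mY decY decX I0 I1 Dp Dp' rE rE' rQ rQ' XI YI ok ok' uS DD *.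
  by apply: last; rewrite c0 c0' subrr normr0; nonneg.
apply: last.
have rS k : (k < n.+1)%N -> r k.+1 = r k + D k * ratio_rate f d (r k) (X k) (D k).
  move=> kn; have kn' := ltnW kn : (k < n.+2)%N; have okk := ok _ kn.
  have [/andP[r0 _] /andP[Dk _] _ _] := okk.
  have Sk := slope_ge m0 (bm_d bm) lowf okk.
  rewrite -ratio_step; last 2 first.
  - by rewrite mulf_neq0 ?gt_eqF.
  - by rewrite gt_eqF//; lra using Ki Sk.
  have e1' : X k + r k * D k = c k by rewrite rE//; ring.
  have e2' : X k - D k = X k.+1 by rewrite DE; ring.
  by rewrite e1' e2' rdef DE -cS -!XS.
have rS' k : (k < n.+1)%N -> r' k.+1 = r' k + D' k * ratio_rate F D1 (r' k) (Y k) (D' k).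
  move=> kn; have kn' := ltnW kn : (k < n.+2)%N; have okk := ok' _ kn.
  have [/andP[r0 _] /andP[Dk _] _ _] := okk.
  have Sk := slope_ge m0 dF lowF okk.
  rewrite -ratio_step; last 2 first.
  - by rewrite mulf_neq0 ?gt_eqF.
  - by rewrite gt_eqF//; lra using Ki Sk.
  have e1' : Y k + r' k * D' k = c' k by rewrite rE'//; ring.
  have e2' : Y k - D' k = Y k.+1 by rewrite DE'; ring.
  by rewrite e1' e2' rdef' DE' -cS' -!YS.
have h := close delta n.+1 r r' (fun k => ratio_rate f d (r k) (X k) (D k))
  (fun k => ratio_rate F D1 (r' k) (Y k) (D' k)) D D' (fun k => Y k - X k) d0 rS rS'.
have DL k : (k < n.+1)%N -> D k.+1 <= K * D k.
  move=> kn; have XIk := XI _ (ltnW kn : (k < n.+2)%N); have XIk' := XI k.+1 kn.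
  have X1 : 0 < X k < q by lra using m0 XIk.
  have X2 : 0 < X k.+1 < q by lra using m0 XIk'.
  have := lipf _ _ X1 X2; rewrite -!XS -!DE (gtr0_norm (Dp _ (ltnW kn : (k < n.+2)%N))).
  exact: le_trans (ler_norm _).
have {}h : `|r' n.+1 - r n.+1| <= L * delta.
  apply: h.
  - by move=> k _; rewrite DE DE'; ring.
  - move=> k kn; have okk := ok _ kn; have okk' := ok' _ kn.
    have p1 := omP _ _ _ _ _ _ _ _ _ _ bm d0 sm lowF0 _ _ _ okk'.
    rewrite -FE -D1E in p1.
    have [_ p2] := omL _ _ _ _ _ _ bm _ _ _ _ _ _ okk' okk.
    have p3 := DD _ (ltnW kn : (k < n.+2)%N); have p4 := uS _ (leqW (ltnW kn)).
    have := ler_normD (ratio_rate F D1 (r' k) (Y k) (D' k) - ratio_rate f d (r' k) (Y k) (D' k))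
      (ratio_rate f d (r' k) (Y k) (D' k) - ratio_rate f d (r k) (X k) (D k)).
    rewrite addrA subrK => p5.
    have p6 : C1 * (`|r' k - r k| + `|Y k - X k| + `|D' k - D k|) <=
              C1 * (`|r' k - r k| + 3 * (U * delta)) by rewrite ler_wpM2l//; lra using p3 p4.
    have nr : 0 <= `|r' k - r k| by [].
    apply: le_trans p5 _; apply: le_trans (lerD p1 (le_trans p2 p6)) _.
    move: (`|r' k - r k|) nr => N N0.
    rewrite (unbox C4E) (unbox C3E) -subr_ge0 (_ : _ - _ = C1 * delta + C1 * 3 * U * N + C2 * N +
      C1 * (C1 + K + 2) * (delta + N)); last by ring.
    by nonneg.
  - move=> k kn; have kn' := ltnW kn.
    have [p0 p1] := omL _ _ _ _ _ _ bm _ _ _ _ _ _ (ok _ kn') (ok _ kn').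
    have [_ p2] := omL _ _ _ _ _ _ bm _ _ _ _ _ _ (ok k.+1 kn) (ok k kn').
    apply: le_trans p2 _.
    have Dk := Dp k (ltnW kn'); have Dk1 := Dp k.+1 kn'; have DLk := DL k kn'.
    have e1' : `|r k.+1 - r k| <= D k * C1.
      by rewrite rS// addrC addKr normrM (gtr0_norm Dk) ler_pM2l.
    have e2' : `|X k.+1 - X k| = D k by rewrite distrC -DE gtr0_norm.
    have e3' : `|D k.+1 - D k| <= (K + 1) * D k by rewrite ler_norml; lra using Dk Dk1 DLk.
    rewrite e2'; apply: (@le_trans _ _ (C1 * (D k * C1 + D k + (K + 1) * D k))).
      by rewrite ler_wpM2l//; lra using e1' e3'.
    rewrite (unbox C4E) -subr_ge0 (_ : _ - _ = C3 * D k); last by ring.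
    by nonneg.
  - move=> k kn; have [p0 _] := omL _ _ _ _ _ _ bm _ _ _ _ _ _ (ok _ kn) (ok _ kn).
    apply: le_trans p0 _; rewrite (unbox C4E).
    have : C1 <= C1 * (C1 + K + 2) by rewrite ler_peMr//; lra using K1 C10.
    lra using C30.
  - move=> k kn; apply: le_trans (uS k (leqW kn)) _; rewrite ler_wpM2r// (unbox U2E) lerDl; nonneg.
  - by move=> k kn; rewrite !ltW// ?Dp ?Dp'// ltnW.
  - rewrite (eq_bigr (fun k : 'I_n.+1 => X k - X k.+1)) => [|k _]; last exact: DE.
    rewrite sum_telescope; have := XI _ (ltnSn n.+1); have := XI _ (ltn0Sn n.+1); lra using m0 qK.
  - rewrite (eq_bigr (fun k : 'I_n.+1 => Y k - Y k.+1)) => [|k _]; last exact: DE'.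
    rewrite sum_telescope; have := YI _ (ltnSn n.+1); have := YI _ (ltn0Sn n.+1); lra using m0 qK.
  - have D00 := Dp _ (ltn0Sn n.+1); have D00' := Dp' _ (ltn0Sn n.+1).
    have /andP[r0 r0Q] := rQ' _ (ltn0Sn n.+1).
    have E : r' 0%N - r 0%N = r' 0%N * (D 0%N - D' 0%N) * (D 0%N)^-1.
      by rewrite rdef rdef' c0 c0' X0 Y0; field; rewrite !gt_eqF.
    rewrite E !normrM distrC.
    have U00 : 0 < U by lra using U1.
    have iD : `|(D 0%N)^-1| <= U.
      rewrite ger0_norm ?invr_ge0 ?(ltW D00)// -[U]invrK lef_pV2 ?posrE ?invr_gt0//.
      by rewrite DE XS X0.
    have p1 := DD _ (ltn0Sn n.+1).
    apply: (@le_trans _ _ (Q * (2 * (U * delta)) * U)).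
      apply: ler_pM => //; rewrite ?mulr_ge0//; apply: ler_pM => //.
      by rewrite gtr0_norm.
    rewrite (unbox U2E) -subr_ge0 (_ : _ - _ = U * delta); last by ring.
    by [].
have /andP[r0 r0Q] := rQ' _ (ltnSn n.+1).
have p1 := DD _ (ltnSn n.+1); have p2 := uS _ (leqnSn n.+1).
have p3 : D n.+1 <= K * K.
  apply: le_trans (DL _ (ltnSn n)) _; rewrite ler_wpM2l//.
  have [_ /andP[_ ?] _ _] := ok _ (ltnSn n.+1 : (n.+1 < n.+2)%N); by [].
have p4 := Dp _ (ltnSn n.+1).
have E : c' n.+1 - c n.+1 = (Y n.+1 - X n.+1) +
  ((r' n.+1 - r n.+1) * D n.+1 + r' n.+1 * (D' n.+1 - D n.+1)).
  have := rE _ (ltnSn n.+1); have := rE' _ (ltnSn n.+1); clear; lra.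
rewrite E; apply: le_trans (ler_normD _ _) _.
have q1 := ler_normD ((r' n.+1 - r n.+1) * D n.+1) (r' n.+1 * (D' n.+1 - D n.+1)).
have q2 : `|(r' n.+1 - r n.+1) * D n.+1| <= L * delta * (K * K).
  by rewrite normrM (gtr0_norm p4); apply: ler_pM => //; exact: ltW.
have q3 : `|r' n.+1 * (D' n.+1 - D n.+1)| <= Q * (2 * (U * delta)).
  by rewrite normrM (gtr0_norm r0); apply: ler_pM => //; exact: ltW.
rewrite (unbox L1E); lra using p2 q1 q2 q3.
Qed.

End Perturbation.

(** * Bowls from bounds on derivatives *)

Section Bowls.
Variable R : realType.
Implicit Types (G : R -> R) (s K rho : R).

(** The contraction property is convexity of [G z - s z^2 / 2]. *)
Lemma bowl_of_derivs G G1 G2 s K rho rho' : 0 < s -> 0 <= K -> 0 < rho -> rho < rho' ->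
  (forall z, - rho' < z < rho' -> is_derive z 1 G (G1 z)) ->
  (forall z, - rho' < z < rho' -> is_derive z 1 G1 (G2 z)) ->
  (forall z, - rho' < z < rho' -> s <= G2 z <= K) ->
  G1 0 = 0 -> 0 <= G 0 -> {homo (fun z => z - G z) : x y / x <= y} ->
  bowl s K rho (G 0) G.
Proof.
move=> s0 K0 r0 rr dG dG1 bG2 G10 G0 hom.
(* H is convex and vanishes to first order at 0 *)
pose H z := G z - s / 2 * z ^+ 2; pose H1 z := G1 z - s * z.
have dH z : - rho' < z < rho' -> is_derive z 1 H (H1 z).
  move=> zI; have h := dvM (dvC (s / 2) z) (dvM (dvI z) (dvI z)).
  by apply: dv_eq (dvB (dG z zI) h) _; rewrite /H1; field.
have dH1 z : - rho' < z < rho' -> is_derive z 1 H1 (G2 z - s).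
  move=> zI; apply: dv_eq (dvB (dG1 z zI) (dvM (dvC s z) (dvI z))) _; ring.
have H1mono u v : - rho' < u -> u <= v -> v < rho' -> H1 u <= H1 v.
  by apply: homo_open dH1 _ => z /bG2; lra.
have H10 : H1 0 = 0 by rewrite /H1 G10; ring.
have H1pos z : 0 <= z < rho' -> 0 <= H1 z.
  by move=> zI; rewrite -H10; apply: H1mono; lra.
have H1neg z : - rho' < z <= 0 -> H1 z <= 0.
  by move=> zI; rewrite -H10; apply: H1mono; lra using zI r0 rr.
have H0 : H 0 = G 0 by rewrite /H expr2; ring.
have Hge z : `|z| <= rho -> G 0 <= H z.
  rewrite ler_norml -H0 => zI; have [z0|z0] := leP 0 z.
  - move: z0; rewrite le_eqVlt => /orP[/eqP <- //|z0].
    have [|||c cI E] := @mvt_open _ H H1 (- rho') rho' 0 z _ _ _ dH; [lra using r0 rr z0 zI..|].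
    have h : 0 <= H1 c by apply: H1pos; lra.
    by have := mulr_ge0 h (ltW z0); lra.
  - have [|||c cI E] := @mvt_open _ H H1 (- rho') rho' z 0 _ _ _ dH; [lra using rr zI z0 r0..|].
    have h : H1 c <= 0 by apply: H1neg; lra.
    have : H1 c * (0 - z) <= 0 by rewrite mulr_le0_ge0; lra using s0 h z0.
    lra.
have G1E z : G1 z = H1 z + s * z by rewrite /H1; ring.
split=> //.
- by move=> z /Hge; rewrite /H; lra.
- move=> z; rewrite ler_norml => zI.
  have [z0|z0|->] := ltgtP z 0; last by rewrite expr2; clear; lra.
  + have [|||c cI E] := @mvt_open _ G G1 (- rho') rho' z 0 _ _ _ dG; [lra using rr zI z0 r0..|].
    have [|||c' cI' E'] := @mvt_open _ G1 G2 (- rho') rho' c 0 _ _ _ dG1; [lra using rr zI cI r0..|].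
    have g2 : s <= G2 c' <= K by apply: bG2; lra.
    have h1 : K * z <= G1 c.
      have h2 : 0 <= (K - G2 c') * - c by rewrite mulr_ge0; lra using s0 g2 cI.
      have h3 : 0 <= K * (c - z) by rewrite mulr_ge0; lra using s0 K0 cI.
      lra.
    have h2 : 0 <= (G1 c - K * z) * (- z) by rewrite mulr_ge0; lra using s0 h1 z0.
    by rewrite expr2; lra.
  + have [|||c cI E] := @mvt_open _ G G1 (- rho') rho' 0 z _ _ _ dG; [lra using r0 rr z0 zI..|].
    have [|||c' cI' E'] := @mvt_open _ G1 G2 (- rho') rho' 0 c _ _ _ dG1; [lra using r0 rr cI zI..|].
    have g2 : s <= G2 c' <= K by apply: bG2; lra.
    have h1 : G1 c <= K * z.
      have h2 : 0 <= (K - G2 c') * c by rewrite mulr_ge0; lra using s0 g2 cI.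
      have h3 : 0 <= K * (z - c) by rewrite mulr_ge0; lra using s0 K0 cI.
      lra.
    have h2 : 0 <= (K * z - G1 c) * z by rewrite mulr_ge0; lra using s0 h1 z0.
    by rewrite expr2; lra using E h2.
- move=> b z b01; rewrite ler_norml => zI; set t := 1 - b.
  suff conv : H (t * z) <= t * H z + b * G 0.
    move: conv; rewrite /H exprMn /t; set X := G _; set Y := G z; rewrite !expr2; clear; lra.
  have zI' : - rho' < z < rho' by lra.
  have tz : - rho' < t * z < rho'.
    have : `|t * z| <= rho.
      by rewrite normrM; apply: le_trans (_ : `|z| <= rho); rewrite ?ler_norml ?ler_piMl// ler_norml /t; lra using b01.
    by rewrite ler_norml; lra using rr.
  have I0 : - rho' < 0 < rho' by lra.
  have T1 := tangent_below dH H1mono tz zI'.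
  have T2 := tangent_below dH H1mono tz I0.
  have t01 : 0 <= t by rewrite /t; lra.
  have b0 : 0 <= b by lra using b01.
  have := lerD (ler_wpM2l t01 T1) (ler_wpM2l b0 T2); rewrite H0.
  have -> : t * (H (t * z) + H1 (t * z) * (z - t * z)) +
    b * (H (t * z) + H1 (t * z) * (0 - t * z)) = H (t * z) by rewrite /t; ring.
  by [].
- move=> u v u0; rewrite le_eqVlt => /orP[/eqP -> //|uv] vr.
  have [|||c cI E] := @mvt_open _ G G1 (- rho') rho' u v _ _ _ dG; [lra using r0 rr u0 uv vr..|].
  have h : 0 <= H1 c by apply: H1pos; lra using rr u0 vr cI.
  have h1 : 0 <= s * c by rewrite mulr_ge0; lra using s0 u0 cI.
  by rewrite -subr_ge0 E G1E mulr_ge0//; lra using h h1 uv.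
- move=> u v u0; rewrite le_eqVlt => /orP[/eqP -> //|uv] vr.
  have [|||c cI E] := @mvt_open _ G G1 (- rho') rho' u v _ _ _ dG; [lra using rr u0 uv r0 vr..|].
  have h : H1 c <= 0 by apply: H1neg; lra using rr u0 vr cI.
  have h1 : s * c <= 0 by rewrite mulr_ge0_le0; lra using s0 vr cI.
  by rewrite -subr_le0 E G1E mulr_le0_ge0//; lra using h h1 uv.
- by move=> u v _ uv _; exact: hom.
Qed.

Lemma bowl_close_derivs G0 G1 D1 D2 mu rho rho' : 0 <= mu -> 0 < rho -> rho < rho' ->
  (forall z, - rho' < z < rho' -> is_derive z 1 (fun z => G1 z - G0 z) (D1 z)) ->
  (forall z, - rho' < z < rho' -> is_derive z 1 D1 (D2 z)) ->
  (forall z, - rho' < z < rho' -> `|D2 z| <= mu) -> D1 0 = 0 ->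
  bowl_close rho mu (G0 0) (G1 0) G0 G1.
Proof.
move=> mu0 r0 rr dD dD1 bD2 D10 z zr.
have -> : G1 z - G1 0 - (G0 z - G0 0) = (G1 z - G0 z) - (G1 0 - G0 0) by ring.
have I0 : - rho' < 0 < rho' by lra.
rewrite ler_norml in zr.
have bD1 c : `|c| <= `|z| -> `|D1 c| <= mu * `|z|.
  move=> cz; have cI : - rho' < c < rho'.
    have : `|z| <= rho by rewrite ler_norml.
    by move: cz; rewrite ler_norml; lra.
  have := lip_open mu0 dD1 bD2 cI I0; rewrite D10 !subr0 => /le_trans; apply.
  by rewrite ler_wpM2l.
have [z0|z0|->] := ltgtP z 0; last by rewrite subrr normr0 expr2 mulr0 mulr0.
- have [|||c cI E] := @mvt_open _ _ _ (- rho') rho' z 0 _ _ _ dD; [lra..|].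
  have h : `|D1 c| <= mu * `|z| by apply: bD1; rewrite !ler0_norm; lra.
  rewrite distrC E normrM sub0r normrN -[z ^+ 2]real_normK ?num_real// expr2 mulrA.
  by rewrite ler_wpM2r.
- have [|||c cI E] := @mvt_open _ _ _ (- rho') rho' 0 z _ _ _ dD; [lra..|].
  have h : `|D1 c| <= mu * `|z| by apply: bD1; rewrite !ger0_norm; lra.
  rewrite E normrM subr0 -[z ^+ 2]real_normK ?num_real// expr2 mulrA.
  by rewrite ler_wpM2r.
Qed.

End Bowls.

(** * Two orbits near the minimum of the gap and away from it *)

Section NearMinimum.
Variable R : realType.
Implicit Types (f d dd ddd e : R -> R) (K q m : R).

(** Used when a common origin is followed by boundedly many steps. *)
Lemma forward_gap K (delta : R) q f e (X Y : nat -> R) k : 1 <= K -> 0 <= delta ->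
  (forall x y, 0 < x < q -> 0 < y < q -> `|f x - f y| <= K * `|x - y|) ->
  (forall x, 0 < x < q -> `|e x| <= delta) ->
  (forall j, X j.+1 = f (X j)) -> (forall j, Y j.+1 = f (Y j) + e (Y j)) ->
  X 0%N = Y 0%N ->
  (forall j, (j < k)%N -> 0 < X j < q /\ 0 < Y j < q) ->
  `|Y k - X k| <= (K + 1) ^+ k * delta.
Proof.
move=> K1 d0 lip eb XS YS XY; elim: k => [_|k IH inI].
  by rewrite XY subrr normr0 expr0 mul1r.
have {}IH := IH (fun j jk => inI j (ltnW jk)).
have [XI YI] := inI k (ltnSn k).
rewrite XS YS.
have h1 := lip _ _ YI XI; have h2 := eb _ YI.
have h3 := ler_normD (f (Y k) - f (X k)) (e (Y k)); rewrite addrAC in h3.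
have h4 := ler_wpM2l (_ : 0 <= K) IH.
have P1 : 1 <= (K + 1) ^+ k by apply: exprn_ege1; lra using K1.
have h5 : delta <= (K + 1) ^+ k * delta by rewrite ler_peMl.
rewrite exprS -mulrA mulrDl mul1r; have := h4 (le_trans ler01 K1); lra using h1 h2 h3 h5.
Qed.

(** Used for the boundedly many steps after the window, where the distance is
    known at the end. *)
Lemma backward_gap K (C' delta : R) q m f e (X Y : nat -> R) n : 1 <= K ->
  0 <= C' -> 0 <= delta -> 0 < m ->
  (forall x y, m <= x < q -> m <= y < q -> `|x - y| <= K * `|f x - f y|) ->
  (forall x, 0 < x < q -> `|e x| <= delta) ->
  (forall j, X j.+1 = f (X j)) -> (forall j, Y j.+1 = f (Y j) + e (Y j)) ->
  forall k, (forall j, (k <= j < k + n)%N -> m <= X j < q /\ m <= Y j < q) ->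
  `|Y (k + n)%N - X (k + n)%N| <= C' * delta ->
  `|Y k - X k| <= (C' + 1) * (2 * K) ^+ n * delta.
Proof.
move=> K1 C0 d0 m0 lip eb XS YS; elim: n => [|n IH] k.
  by rewrite addn0 expr0 mulr1 mulrDl => _ h; lra.
rewrite addnS -addSn => inI uC.
have IH' : `|Y k.+1 - X k.+1| <= (C' + 1) * (2 * K) ^+ n * delta.
  by apply: IH => // j /andP[h1 h2]; apply: inI; rewrite (ltnW h1).
have kI : (k <= k < k.+1 + n)%N by rewrite leqnn addSn ltnS leq_addr.
have [XI YI] := inI k kI.
have YI' : 0 < Y k < q by lra.
rewrite XS YS in IH'.
have h1 := lip _ _ YI XI; have h2 := eb _ YI'.
have h3 := ler_normB (f (Y k) + e (Y k) - f (X k)) (e (Y k)).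
rewrite addrAC addrK in h3.
have h5 : delta <= (C' + 1) * (2 * K) ^+ n * delta.
  rewrite ler_peMl// -[1]mulr1; apply: ler_pM => //; first lra using C0.
  by apply: exprn_ege1; lra using K1.
have h6 : K * `|f (Y k) - f (X k)| <= K * (2 * ((C' + 1) * (2 * K) ^+ n * delta)).
  by rewrite ler_wpM2l; lra using K1 IH' h2 h3 h5.
apply: le_trans h1 _; apply: le_trans h6 _.
by rewrite exprS le_eqVlt; apply/orP; left; apply/eqP; ring.
Qed.

Lemma passage_count (gam : R) (X : nat -> R) i n :
  (forall j, (i <= j < i + n)%N -> gam <= X j - X j.+1) ->
  n%:R * gam <= X i - X (i + n)%N.
Proof.
elim: n => [_|n IH h]; first by rewrite mul0r addn0 subrr.
have h1 : n%:R * gam <= X i - X (i + n)%N.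
  by apply: IH => j /andP[ij jn]; apply: h; rewrite ij addnS ltnW.
have nI : (i <= i + n < i + n.+1)%N by rewrite leq_addr addnS ltnSn.
have := h _ nI; rewrite -natr1 mulrDl mul1r addnS; lra.
Qed.

Lemma bm_lip K q m f d dd ddd : base_map K q m f d dd ddd ->
  forall x y, 0 < x < q -> 0 < y < q -> `|f x - f y| <= K * `|x - y|.
Proof.
move=> bm x y xI yI; apply: lip_open (bm_d bm) (bm_dK bm) xI yI.
by have := bm_K bm; lra.
Qed.

Lemma bm_colip K q m f d dd ddd : base_map K q m f d dd ddd ->
  forall x y, m <= x < q -> m <= y < q -> `|x - y| <= K * `|f x - f y|.
Proof.
move=> bm; have m0 := bm_m0 bm; have K1 := bm_K bm.
have main x y : m <= x < q -> m <= y < q -> x < y -> `|x - y| <= K * `|f x - f y|.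
  move=> xI yI xy; have [|||c cI E] := @mvt_open _ f d 0 q x y _ _ _ (bm_d bm); [lra..|].
  have low : K^-1 <= d c by apply: (bm_low bm); lra.
  rewrite distrC [X in _ * X]distrC E normrM mulrA ler_peMl//.
  rewrite -(_ : K * K^-1 = 1); last by rewrite divff// gt_eqF//; lra.
  by rewrite ler_wpM2l; [|lra|apply: le_trans low _; exact: ler_norm].
move=> x y xI yI; have [lt|lt|->] := ltgtP x y; first exact: main.
  by rewrite distrC [X in _ * X]distrC; exact: main.
by rewrite !subrr normr0 mulr0.
Qed.

Definition nat_above (x : R) : exists N : nat, x <= N%:R.
Proof. by exists (Num.bound `|x|); apply: le_trans (ler_norm _) (ltW (archi_boundP _)). Qed.

(** Near [p] the derivative of the gap changes at a rate of at least [s], so that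
    [e1] can move its zero by [O(delta)] only. *)
Lemma perturbed_min K q m f d dd ddd (delta : R) e e1 e2 p rho s :
  base_map K q m f d dd ddd -> small_map delta q e e1 e2 -> 0 < delta -> 0 < s ->
  0 < p - rho -> p + rho < q -> d p = 1 ->
  (forall x, `|x - p| <= rho -> dd x <= - s) -> 2 / s * delta <= rho ->
  exists2 p1, `|p1 - p| <= 2 / s * delta & d p1 + e1 p1 = 1.
Proof.
move=> bm sm d0 s0 p1 p2 dp ddw; set t := 2 / s * delta => tr.
have t0 : 0 < t by rewrite !mulr_gt0 ?invr_gt0.
have st : s * t = 2 * delta by rewrite /t; field; rewrite gt_eqF.
have [|||c1 cI1 E1] := @mvt_open _ d dd 0 q p (p + t) _ _ _ (bm_dd bm); [lra using p1 tr t0 p2..|].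
have [|||c2 cI2 E2] := @mvt_open _ d dd 0 q (p - t) p _ _ _ (bm_dd bm); [lra using p1 tr t0 p2..|].
have h1 : dd c1 <= - s by apply: ddw; rewrite ler_norml; lra.
have h2 : dd c2 <= - s by apply: ddw; rewrite ler_norml; lra.
have g1 : 0 <= (- s - dd c1) * t by rewrite mulr_ge0; lra using d0 h1 t0.
have g2 : 0 <= (- s - dd c2) * t by rewrite mulr_ge0; lra using d0 h2 t0.
have eb x : 0 < x < q -> - delta <= e1 x <= delta by move=> /(sm_1 sm); rewrite ler_norml.
have b1 : - delta <= e1 (p + t) <= delta by apply: eb; lra using p1 p2 tr t0.
have b2 : - delta <= e1 (p - t) <= delta by apply: eb; lra using p1 p2 tr t0.
have cont : {within `[p - t, p + t], continuous (fun x => d x + e1 x)}.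
  apply: continuous_in_subspaceT => x; rewrite inE /= in_itv /= => xI.
  have xI' : 0 < x < q by lra using p1 p2 tr xI.
  by apply: dv_cont (dvD (bm_dd bm xI') (sm_dd sm xI')).
have [||p' + E] := @IVT _ _ (p - t) (p + t) 1 _ cont _; [lra using t0| |].
  rewrite ge_min le_max; apply/andP; split; apply/orP; [right|left]; lra using dp st E1 g1 b1 E2 g2 b2.
by rewrite in_itv /= => pI; exists p' => //; rewrite ler_norml; lra using pI.
Qed.

Lemma shifted_bowl K q m f d dd ddd p rho rho' s :
  base_map K q m f d dd ddd -> {homo f : x y / x <= y} -> 0 < s -> 0 < rho -> rho < rho' ->
  0 < p - rho' -> p + rho' < q -> d p = 1 -> f p <= p ->
  (forall x, `|x - p| <= rho' -> dd x <= - s) ->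
  bowl s K rho (p - f p) (fun z => p + z - f (p + z)).
Proof.
move=> bm hf s0 r0 rr p1 p2 dp fp ddw.
have K1 := bm_K bm.
have K0 : 0 <= K by lra.
pose G z := p + z - f (p + z).
have -> : p - f p = G 0 by rewrite /G addr0.
apply: (@bowl_of_derivs _ G (fun z => 1 - d (p + z)) (fun z => - dd (p + z)) s K rho rho') => //.
- move=> z zI; have zI' : 0 < p + z < q by lra.
  have h : is_derive z 1 (fun z => p + z) 1 by apply: dv_eq (dvD (dvC p z) (dvI z)) _; ring.
  apply: dv_eq (dvB h (@dv_comp _ f (fun z => p + z) z _ _ (bm_d bm zI') h)) _; ring.
- move=> z zI; have zI' : 0 < p + z < q by lra.
  have h : is_derive z 1 (fun z => p + z) 1 by apply: dv_eq (dvD (dvC p z) (dvI z)) _; ring.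
  apply: dv_eq (dvB (dvC 1 z) (@dv_comp _ d (fun z => p + z) z _ _ (bm_dd bm zI') h)) _; ring.
- move=> z zI; have zI' : 0 < p + z < q by lra.
  have h1 := bm_ddK bm zI'; rewrite ler_norml in h1.
  have h2 : dd (p + z) <= - s by apply: ddw; rewrite ler_norml; lra.
  lra.
- by rewrite addr0 dp subrr.
- by rewrite /G addr0 subr_ge0.
- move=> u v uv /=; rewrite /G.
  have : f (p + u) <= f (p + v) by apply: hf; lra.
  lra.
Qed.

Lemma shifted_bowl_perturbed K q m f d dd ddd (delta : R) e e1 e2 p p1 rho rho' s :
  base_map K q m f d dd ddd -> small_map delta q e e1 e2 -> delta <= s / 2 -> delta <= 1 ->
  {homo (fun x => f x + e x) : x y / x <= y} -> 0 < s -> 0 < rho -> rho < rho' ->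
  0 < p1 - rho' -> p1 + rho' < q -> d p1 + e1 p1 = 1 -> f p1 + e p1 <= p1 ->
  `|p1 - p| + rho' <= 2 * rho' ->
  (forall x, `|x - p| <= 2 * rho' -> dd x <= - s) ->
  bowl (s / 2) (2 * K) rho (p1 - (f p1 + e p1)) (fun z => p1 + z - (f (p1 + z) + e (p1 + z))).
Proof.
move=> bm sm ds d1 hf s0 r0 rr p1' p2 dp fp pp ddw.
have K1 := bm_K bm.
have K0 : 0 <= 2 * K by lra.
have s0' : 0 < s / 2 by lra.
pose F x := f x + e x.
pose G z := p1 + z - F (p1 + z).
have -> : p1 - (f p1 + e p1) = G 0 by rewrite /G addr0.
apply: (@bowl_of_derivs _ G (fun z => 1 - (d (p1 + z) + e1 (p1 + z)))
  (fun z => - (dd (p1 + z) + e2 (p1 + z))) (s / 2) (2 * K) rho rho') => //.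
- move=> z zI; have zI' : 0 < p1 + z < q by lra.
  have h : is_derive z 1 (fun z => p1 + z) 1 by apply: dv_eq (dvD (dvC p1 z) (dvI z)) _; ring.
  have hF := dvD (bm_d bm zI') (sm_d sm zI').
  apply: dv_eq (dvB h (@dv_comp _ F (fun z => p1 + z) z _ _ hF h)) _; ring.
- move=> z zI; have zI' : 0 < p1 + z < q by lra using p1' p2 zI.
  have h : is_derive z 1 (fun z => p1 + z) 1 by apply: dv_eq (dvD (dvC p1 z) (dvI z)) _; ring.
  have hF := dvD (bm_dd bm zI') (sm_dd sm zI').
  apply: dv_eq (dvB (dvC 1 z) (@dv_comp _ (fun x => d x + e1 x) (fun z => p1 + z) z _ _ hF h)) _; ring.
- move=> z zI; have zI' : 0 < p1 + z < q by lra using p1' p2 zI.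
  have h1 := bm_ddK bm zI'; rewrite ler_norml in h1.
  have h3 := sm_2 sm zI'; rewrite ler_norml in h3.
  have h2 : dd (p1 + z) <= - s.
    apply: ddw; apply: le_trans pp; rewrite addrAC.
    by apply: le_trans (ler_normD _ _) _; rewrite lerD2l ler_norml; lra using zI.
  lra using ds h1 h3 h2.
- by rewrite addr0 dp subrr.
- by rewrite /G addr0 subr_ge0.
- move=> u v uv /=; rewrite /G.
  have : F (p1 + u) <= F (p1 + v) by apply: hf; lra using uv.
  clear; lra.
Qed.

(** Each map is centred at the minimum of its own gap, so that the difference of
    the two gaps is constant up to a quadratic term with a small coefficient. *)
Lemma shifted_close K q m f d dd ddd (delta : R) e e1 e2 p p1 rho rho' (c : R) :
  base_map K q m f d dd ddd -> small_map delta q e e1 e2 -> 0 <= delta ->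
  0 < rho -> rho < rho' ->
  0 < p - rho' -> p + rho' < q -> 0 < p1 - rho' -> p1 + rho' < q ->
  d p = 1 -> d p1 + e1 p1 = 1 -> `|p1 - p| <= c * delta ->
  bowl_close rho ((1 + K * c) * delta) (p - f p) (p1 - (f p1 + e p1))
    (fun z => p + z - f (p + z)) (fun z => p1 + z - (f (p1 + z) + e (p1 + z))).
Proof.
move=> bm sm d0 r0 rr pa pb p1a p1b dp dp1 pp.
have K1 := bm_K bm.
have K0 : 0 <= K by lra.
pose F x := f x + e x.
pose G z := p + z - f (p + z); pose G' z := p1 + z - F (p1 + z).
have -> : p - f p = G 0 by rewrite /G addr0.
have -> : p1 - (f p1 + e p1) = G' 0 by rewrite /G' addr0.
apply: (@bowl_close_derivs _ G G' (fun z => d (p + z) - (d (p1 + z) + e1 (p1 + z)))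
  (fun z => dd (p + z) - (dd (p1 + z) + e2 (p1 + z))) _ rho rho') => //.
- have cd : 0 <= c * delta by exact: le_trans (normr_ge0 _) pp.
  by rewrite mulrDl mul1r -mulrA addr_ge0// mulr_ge0.
- move=> z zI; have zI' : 0 < p1 + z < q by lra.
  have zI0 : 0 < p + z < q by lra.
  have h : is_derive z 1 (fun z => p1 + z) 1 by apply: dv_eq (dvD (dvC p1 z) (dvI z)) _; ring.
  have h0 : is_derive z 1 (fun z => p + z) 1 by apply: dv_eq (dvD (dvC p z) (dvI z)) _; ring.
  have hF := dvD (bm_d bm zI') (sm_d sm zI').
  apply: dv_eq (dvB (dvB h (@dv_comp _ F (fun z => p1 + z) z _ _ hF h))
     (dvB h0 (@dv_comp _ f (fun z => p + z) z _ _ (bm_d bm zI0) h0))) _; ring.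
- move=> z zI; have zI' : 0 < p1 + z < q by lra.
  have zI0 : 0 < p + z < q by lra.
  have h : is_derive z 1 (fun z => p1 + z) 1 by apply: dv_eq (dvD (dvC p1 z) (dvI z)) _; ring.
  have h0 : is_derive z 1 (fun z => p + z) 1 by apply: dv_eq (dvD (dvC p z) (dvI z)) _; ring.
  have hF := dvD (bm_dd bm zI') (sm_dd sm zI').
  apply: dv_eq (dvB (@dv_comp _ d (fun z => p + z) z _ _ (bm_dd bm zI0) h0)
    (@dv_comp _ (fun x => d x + e1 x) (fun z => p1 + z) z _ _ hF h)) _; ring.
- move=> z zI; have zI' : 0 < p1 + z < q by lra.
  have zI0 : 0 < p + z < q by lra.
  have h1 := lip_open K0 (bm_ddd bm) (bm_dddK bm) zI0 zI'.
  have h3 := sm_2 sm zI'.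
  rewrite (_ : p + z - (p1 + z) = - (p1 - p)) ?normrN in h1; last by ring.
  have h4 := ler_wpM2l K0 pp.
  have := ler_normB (dd (p + z) - dd (p1 + z)) (e2 (p1 + z)).
  by rewrite -addrA -opprD; lra using h3 h1 h4.
- by rewrite !addr0 dp dp1 subrr.
Qed.

End NearMinimum.

Section Passages.
Variable R : realType.
Implicit Types (f d dd ddd e : R -> R) (K q m : R).

Lemma bowl_weaken (s K s' K' rho eps : R) G : s' <= s -> K <= K' ->
  bowl s K rho eps G -> bowl s' K' rho eps G.
Proof.
move=> ss KK bw; split; [exact: bowl_eps bw| | | |exact: bowl_r bw|exact: bowl_l bw|exact: bowl_homo bw].
- move=> z /(bowl_lo bw); apply: le_trans; rewrite lerD2l ler_wpM2r ?sqr_ge0//; lra.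
- move=> z /(bowl_up bw) /le_trans; apply; rewrite lerD2l ler_wpM2r ?sqr_ge0//.
- move=> b z b01 /(bowl_contr bw b01) /le_trans; apply; rewrite lerD2l lerN2.
  rewrite -subr_ge0 (_ : _ - _ = (s - s') / 2 * (b * (1 - b) * z ^+ 2)); last by ring.
  apply: mulr_ge0; first by lra.
  by apply: mulr_ge0; [apply: mulr_ge0; lra|exact: sqr_ge0].
Qed.

(** Outside the window around [p] both orbits move at a definite speed, so
    that there they stay together for the bounded time that they spend. *)
Lemma orbits_close_outside K q m f d dd ddd (C' delta r1 gam p xs : R) e e1 e2 a N (X Y : nat -> R) :
  base_map K q m f d dd ddd -> small_map delta q e e1 e2 -> 0 <= C' -> 0 < delta ->
  {homo f : x y / x <= y} -> {homo (fun x => f x + e x) : x y / x <= y} ->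
  (forall x, -1 <= f x) -> (0 < a)%N -> f q <= xs -> xs < q ->
  (forall k, X k.+1 = f (X k)) -> (forall k, Y k.+1 = f (Y k) + e (Y k)) ->
  X 0%N = xs -> Y 0%N = xs ->
  (forall k, (k < a)%N -> m <= X k) -> X a <= m ->
  (forall k, (k < a)%N -> m <= Y k) -> (forall k, (k < a)%N -> Y k.+1 < Y k) ->
  `|Y a - X a| <= C' * delta -> (C' + 1) * delta <= r1 ->
  m + 8 * r1 < p -> p < q - 8 * r1 -> 0 < r1 -> 0 < gam ->
  (forall x, `|x - p| <= r1 -> x - f x <= r1 / 2) ->
  (forall x, m <= x <= q -> r1 <= `|x - p| -> gam <= x - f x) ->
  (K + 1) + gam <= N%:R * gam ->
  exists k0 k1, [/\ (k0 <= k1)%N, (k1 < a)%N, p + r1 / 2 <= X k0 <= p + r1,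
    p - r1 <= X k1 <= p - r1 / 2 & Y a.-1 < p - r1] /\
    [/\ (forall k, (k <= k0)%N -> `|Y k - X k| <= (K + 1) ^+ N * delta),
    (forall k, (k1 <= k)%N -> (k <= a)%N -> `|Y k - X k| <= (C' + 1) * (2 * K) ^+ N * delta),
    (forall i j, (i <= j)%N -> (j <= a)%N -> X j <= X i) &
    (forall i j, (i <= j)%N -> (j <= a)%N -> Y j <= Y i)].
Proof.
move=> bm sm C0 d0 hf hF fm1 a0 fq xq XS YS X0 Y0 mX Xam mY decY uC t6 mp pq r10 g0 gapr out hNg.
have K1 := bm_K bm; have qK := bm_q bm; have m0 := bm_m0 bm.
have decX k : (k < a)%N -> X k <= xs /\ X k.+1 < X k.
  have bel j : (j < a)%N -> X j <= xs -> X j.+1 < X j.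
    by move=> ja le; rewrite XS; apply: (bm_below bm); rewrite mX//=; plra.
  elim: k => [ka|k IH ka]; first by split; [rewrite X0|apply: bel; rewrite ?X0].
  have [le lt] := IH (ltnW ka); have le' : X k.+1 <= xs by plra.
  by split=> //; exact: bel.
have monX i j : (i <= j)%N -> (j <= a)%N -> X j <= X i.
  elim: j => [|j IH]; first by rewrite leqn0 => /eqP ->.
  rewrite leq_eqVlt => /orP[/eqP -> //|]; rewrite ltnS => ij ja.
  by apply: le_trans (IH ij (ltnW ja)); exact: ltW (decX _ ja).2.
have monY i j : (i <= j)%N -> (j <= a)%N -> Y j <= Y i.
  elim: j => [|j IH]; first by rewrite leqn0 => /eqP ->.
  rewrite leq_eqVlt => /orP[/eqP -> //|]; rewrite ltnS => ij ja.
  by apply: le_trans (IH ij (ltnW ja)); exact: ltW (decY _ ja).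
have inI j : (j < a)%N -> (m <= X j < q /\ m <= Y j < q).
  move=> ja; rewrite (mX _ ja) (mY _ ja) /=.
  have := monX 0%N j (leq0n _) (ltnW ja); have := monY 0%N j (leq0n _) (ltnW ja).
  by rewrite X0 Y0; split; lra using xq H0 H.
have inI' j : (j < a)%N -> (0 < X j < q /\ 0 < Y j < q).
  by move=> /inI[h1 h2]; split; lra using m0 h1 h2.
have outX j : (j < a)%N -> r1 <= `|X j - p| -> gam <= X j - X j.+1.
  move=> ja h; rewrite XS; apply: out => //.
  by have [? _] := inI _ ja; plra.
have fpr : p + r1 / 2 <= f (p + r1).
  have := gapr (p + r1); rewrite (_ : p + r1 - p = r1); last by ring.
  by rewrite gtr0_norm// lexx => /(_ isT); plra.
(* k0: entrance time into the window *)
have ex0 : exists k, X k <= p + r1 by exists a; plra.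
case: (ex_minnP ex0) => k0 Xk0 k0min.
have k0a : (k0 <= a)%N by apply: k0min; plra.
have Xk0' : p + r1 / 2 <= X k0.
  apply: le_trans fpr _; case: k0 Xk0 k0min k0a => [|k] Xk kmin ka.
    by rewrite X0; apply: le_trans fq; apply: hf; plra.
  rewrite XS; apply: hf; rewrite leNgt; apply/negP => lt.
  by have := kmin k (ltW lt); rewrite ltnn.
have {}k0a : (k0 < a)%N.
  rewrite ltn_neqAle k0a andbT; apply/eqP => E; rewrite E in Xk0'; lra using Xam mp r10 Xk0'.
have k0N : (k0 <= N)%N.
  have h : k0%:R * gam <= X 0%N - X (0 + k0)%N.
    apply: passage_count => j /andP[_ jk]; rewrite add0n in jk.
    apply: outX; first exact: ltn_trans k0a.
    have : p + r1 < X j by rewrite ltNge; apply/negP => /k0min; rewrite leqNgt jk.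
    by move=> lt; rewrite gtr0_norm; lra using lt r10.
  rewrite add0n X0 in h.
  rewrite -(ler_nat R) -(ler_pM2r g0); lra using xq mp r10 g0 hNg qK m0 Xk0' h.
(* k1: exit time from the window *)
have ex1 : exists k, X k < p - r1 by exists a; lra using Xam mp r10.
case: (ex_minnP ex1) => j1 Xj1 j1min.
have j1a : (j1 <= a)%N by apply: j1min; lra using Xam mp r10.
case: j1 Xj1 j1min j1a => [|k1] Xj1 j1min j1a.
  by have := monX 0%N k0 (leq0n _) (ltnW k0a); plra.
have Xk1 : p - r1 <= X k1.
  by rewrite leNgt; apply/negP => /j1min; rewrite ltnn.
have k01 : (k0 <= k1)%N.
  rewrite leqNgt; apply/negP => lt; have := monX k1.+1 k0 lt (ltnW k0a); lra using r10 Xk0' Xj1.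
have Xk1' : X k1 <= p - r1 / 2.
  have h1 := monX _ _ k01 (ltnW j1a).
  have := gapr (X k1); rewrite -XS ler_norml => h; have := h _; lra using Xk0 Xj1 h1.
have Xa : -1 <= X a by rewrite -(prednK a0) XS.
have akN : (a - k1 <= N)%N.
  have h : (a - k1.+1)%:R * gam <= X k1.+1 - X (k1.+1 + (a - k1.+1))%N.
    apply: passage_count => j /andP[kj ja]; rewrite subnKC// in ja.
    apply: outX => //; have := monX _ _ kj (ltnW ja) => h.
    by rewrite ltr0_norm; lra using Xj1 h r10.
  rewrite subnKC// in h.
  have : (a - k1)%:R = (a - k1.+1)%:R + 1 :> R by rewrite natr1 -subSn// subSS.
  move=> E; have hX := monX 0%N k1.+1 (leq0n _) j1a; rewrite X0 in hX.
  by rewrite -(ler_nat R) -(ler_pM2r g0) E mulrDl mul1r; lra using pq r10 hNg qK Xj1 Xa h.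
have powK (x : R) n : 1 <= x -> (n <= N)%N -> x ^+ n <= x ^+ N.
  by move=> x1 nN; rewrite ler_weXn2l.
have XY0 : X 0%N = Y 0%N by rewrite X0 Y0.
have fwd k : (k <= k0)%N -> `|Y k - X k| <= (K + 1) ^+ N * delta.
  move=> kk.
  have h := forward_gap K1 (ltW d0) (bm_lip bm) (sm_0 sm) XS YS XY0
    (fun j (jk : (j < k)%N) => inI' j (leq_trans jk (leq_trans kk (ltnW k0a)))).
  apply: le_trans h _; rewrite ler_pM2r//.
  by apply: powK; [lra using K1|exact: leq_trans kk k0N].
have bwd k : (k1 <= k)%N -> (k <= a)%N -> `|Y k - X k| <= (C' + 1) * (2 * K) ^+ N * delta.
  move=> kk ka.
  have inn j : (k <= j < k + (a - k))%N -> m <= X j < q /\ m <= Y j < q.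
    by move=> /andP[_]; rewrite subnKC// => /inI.
  have uC' : `|Y (k + (a - k))%N - X (k + (a - k))%N| <= C' * delta by rewrite subnKC.
  have h := backward_gap K1 C0 (ltW d0) m0 (bm_colip bm) (sm_0 sm) XS YS inn uC'.
  apply: le_trans h _; rewrite ler_pM2r//.
  have h1 : (2 * K) ^+ (a - k) <= (2 * K) ^+ N.
    by apply: powK; [lra using K1|apply: leq_trans akN; exact: leq_sub2l].
  by rewrite ler_wpM2l//; lra using C0.
have Yend : Y a.-1 < p - r1.
  rewrite ltNge; apply/negP => le.
  have := hF _ _ le; rewrite /= -YS prednK//.
  have r1I : 0 < p - r1 < q by lra using mp pq r10 m0.
  have := sm_0 sm r1I; rewrite ler_norml.
  have := gapr (p - r1); rewrite (_ : p - r1 - p = - r1); last by ring.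
  rewrite normrN gtr0_norm// lexx => /(_ isT).
  by move: uC; rewrite ler_norml; lra using Xam t6 mp.
exists k0, k1; split; first by rewrite Xk0 Xk0' Xk1 Xk1'.
by split.
Qed.

(** The bound of [transit_close] is of first order in its small parameters. *)
Lemma window_arith K (al be r1 : R) : 1 <= K -> 0 <= al -> al <= r1 / 4 -> 0 <= be ->
  be <= 1 / 2 -> 0 < r1 -> r1 <= 1 / 8 ->
  2 * (3 / 2 * al + 2 * (be * (5 / 4 * r1))) + be +
    2 * K * (3 / 2 * al + 2 * (be * (5 / 4 * r1))) ^+ 2 <=
  (2 + 2 * K) * (2 * al + 2 * (be * (5 / 4 * r1))) + be.
Proof.
move=> K1 al0 alr be0 be1 r0 r1'.
have hB : be * (5 / 4 * r1) <= 1 / 2 * (5 / 4 * r1) by rewrite ler_wpM2r//; lra.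
have hB0 : 0 <= be * (5 / 4 * r1) by rewrite mulr_ge0//; lra.
move: (be * (5 / 4 * r1)) hB hB0 => w w1 w0.
have A0 : 0 <= 3 / 2 * al + 2 * w <= 1 by lra.
have hA : 3 / 2 * al + 2 * w <= 2 * al + 2 * w by lra.
move: (3 / 2 * al + 2 * w) (2 * al + 2 * w) A0 hA => A A' A0 hA.
have A2 : A ^+ 2 <= A by rewrite expr2 ler_piMr//; lra.
have K0 : 0 <= K by lra.
have h1 := ler_wpM2l K0 A2; have h2 := ler_wpM2l K0 hA.
lra.
Qed.

(** [transit_close] applied to the bowls centred at [p] and [p1], with the slope
    [b = B * delta] of the barriers and [al = 3 / 2 * (E1 + c) * delta]. *)
Lemma orbits_close_inside K q m f d dd ddd (delta r1 p p1 s c E1 B : R) e e1 e2 a k0 k1 (X Y : nat -> R) :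
  base_map K q m f d dd ddd -> small_map delta q e e1 e2 -> 0 < delta ->
  {homo f : x y / x <= y} -> {homo (fun x => f x + e x) : x y / x <= y} ->
  (forall k, X k.+1 = f (X k)) -> (forall k, Y k.+1 = f (Y k) + e (Y k)) ->
  (k0 <= k1)%N -> (k1 < a)%N ->
  p + r1 / 2 <= X k0 <= p + r1 -> p - r1 <= X k1 <= p - r1 / 2 ->
  (forall i j, (i <= j)%N -> (j <= a)%N -> X j <= X i) ->
  (forall i j, (i <= j)%N -> (j <= a)%N -> Y j <= Y i) ->
  `|Y k0 - X k0| <= E1 * delta -> `|Y k1 - X k1| <= E1 * delta -> 0 <= E1 ->
  m + 8 * r1 < p -> p < q - 8 * r1 -> 0 < r1 -> r1 <= 1 / 8 -> d p = 1 -> d p1 + e1 p1 = 1 ->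
  (forall x, `|x - p| <= 8 * r1 -> dd x <= - s) -> 0 < s -> delta <= s / 2 ->
  p - f p <= r1 / 4 -> f p1 + e p1 <= p1 -> `|p1 - p| <= c * delta -> 0 < c ->
  c * delta <= r1 -> delta <= 1 / 4 -> 4 * (E1 + c) * delta <= r1 -> 2 * B * delta <= 1 ->
  4 * (1 + K) * c * delta <= 1 -> 0 < B ->
  8 * (E1 + c) + r1 <= B * r1 -> 8 * (1 + K * c) <= s * B ->
  forall k, (k0 <= k <= k1)%N ->
  `|Y k - X k| <= (2 + 2 * K) * (2 * (E1 + c) + 2 * (B * (5 / 4 * r1))) * delta + B * delta + c * delta.
Proof.
move=> bm sm d0 hf hF XS YS k01 j1a Xk0 Xk1 monX monY E1d E1d' E10 mp pq r10 r18 dp dp1 ddw s0 ds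
  small Fp1 pp1 c0 t3 t1 t4 t5 t7 B0 Br Bs.
have K1 := bm_K bm; have K0 : 0 <= K by lra using K1.
have m0 := bm_m0 bm.
have fp : f p <= p by apply: ltW; apply: (bm_below bm); lra using Xk0 mp pq.
have pp1' : - (c * delta) <= p1 - p <= c * delta by rewrite -ler_norml.
have bw0 : bowl s K (3 * r1) (p - f p) (fun z => p + z - f (p + z)).
  have pI1 : 0 < p - 4 * r1 by lra using Xk0 mp m0.
  have pI2 : p + 4 * r1 < q by lra using Xk0 pq.
  have r3 : 0 < 3 * r1 by lra using r10.
  have r34 : 3 * r1 < 4 * r1 by lra using r10.
  apply: (shifted_bowl bm hf s0 r3 r34 pI1 pI2 dp fp).
  by move=> x xr; apply: ddw; lra using Xk0 xr.
have ab : [/\ 0 < p1 - 4 * r1, p1 + 4 * r1 < q, 0 < 3 * r1 & 3 * r1 < 4 * r1] by split; lra using mp t3 m0 pp1' pq r10.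
have [pa pb r3 r34] := ab.
have bw1 : bowl (s / 2) (2 * K) (3 * r1) (p1 - (f p1 + e p1))
    (fun z => p1 + z - (f (p1 + z) + e (p1 + z))).
  have d1 : delta <= 1 by lra using t1.
  have pw : `|p1 - p| + 4 * r1 <= 2 * (4 * r1) by lra using Xk0 pp1 t3.
  apply: (shifted_bowl_perturbed bm sm ds d1 hF s0 r3 r34 pa pb dp1 Fp1 pw).
  by move=> x xr; apply: ddw; lra using xr.
have bw0' : bowl (s / 2) (2 * K) (3 * r1) (p - f p) (fun z => p + z - f (p + z)).
  by apply: bowl_weaken bw0; lra using s0 K1.
have cl : bowl_close (3 * r1) ((1 + K * c) * delta) (p - f p) (p1 - (f p1 + e p1))
    (fun z => p + z - f (p + z)) (fun z => p1 + z - (f (p1 + z) + e (p1 + z))).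
  have pa0 : 0 < p - 4 * r1 by lra using Xk0 mp m0.
  have pb0 : p + 4 * r1 < q by lra using Xk0 pq.
  exact: (shifted_close bm sm (ltW d0) r3 r34 pa0 pb0 pa pb dp dp1 pp1).
clear ab; have [E2 E2E] : {E2 : R | E2 = E1 + c} by eexists.
rewrite -E2E in t4 Br *; have E20 : 0 < E2 by lra using E10 c0 E2E.
pose x j := X (k0 + j)%N - p; pose y j := Y (k0 + j)%N - p1.
pose n := (k1 - k0)%N.
have k0n : (k0 + n)%N = k1 by rewrite subnKC.
have k1a : (k1 <= a)%N by exact: ltnW.
have E2d : E2 * delta <= r1 / 4 by lra using t4.
have E1c : E1 * delta + c * delta = E2 * delta by rewrite E2E; ring.
rewrite ler_norml in E1d; rewrite ler_norml in E1d'.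
have tx : transit (fun z => p + z - f (p + z)) x n (5 / 4 * r1).
  split=> k kn.
  - by rewrite /x addnS XS; rewrite (_ : p + (X (k0 + k)%N - p) = X (k0 + k)%N); ring.
  - have h1 := monX k0 (k0 + k)%N (leq_addr _ _).
    have h2 := monX (k0 + k)%N k1; rewrite -k0n leq_add2l kn k0n in h2.
    have := h1 (leq_trans (_ : (k0 + k <= k1)%N) k1a); rewrite -{1}k0n leq_add2l kn => /(_ isT).
    by have := h2 isT k1a; rewrite /x; lra using Xk0 Xk1.
have ty : transit (fun z => p1 + z - (f (p1 + z) + e (p1 + z))) y n (5 / 4 * r1).
  split=> k kn.
  - by rewrite /y addnS YS; rewrite (_ : p1 + (Y (k0 + k)%N - p1) = Y (k0 + k)%N); ring.
  - have h1 := monY k0 (k0 + k)%N (leq_addr _ _).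
    have h2 := monY (k0 + k)%N k1; rewrite -k0n leq_add2l kn k0n in h2.
    have := h1 (leq_trans (_ : (k0 + k <= k1)%N) k1a); rewrite -{1}k0n leq_add2l kn => /(_ isT).
    by have := h2 isT k1a; rewrite /y; lra using Xk0 Xk1 pp1' t4 E1c E1d E1d'.
have xn : x n = X k1 - p by rewrite /x k0n.
have yn : y n = Y k1 - p1 by rewrite /y k0n.
have x0 : x 0%N = X k0 - p by rewrite /x addn0.
have y0 : y 0%N = Y k0 - p1 by rewrite /y addn0.
have s20 : 0 < s / 2 by lra using s0.
have K20 : 0 <= 2 * K by lra using K1.
have Bd0 : 0 <= B * delta by nonneg.
have b01 : 0 <= B * delta <= 1 / 2 by lra using t5 Bd0.
have mub : 4 * ((1 + K * c) * delta) <= s / 2 * (B * delta).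
  have : 8 * (1 + K * c) * delta <= s * B * delta by rewrite ler_pM2r.
  clear; lra.
have e01 : p - f p <= 1 by lra using r18 small.
have p1I : 0 < p1 < q by lra using mp pq t3 m0 pp1'.
have pI : 0 < p < q by lra using Xk0 mp pq m0.
have e11 : p1 - (f p1 + e p1) <= 1.
  have h1 := bm_lip bm pI p1I; have h2 := sm_0 sm p1I.
  rewrite distrC [`|p - _|]distrC in h1.
  have h3 := ler_wpM2l K0 pp1.
  have := le_trans h1 h3; move: h2; rewrite !ler_norml; lra using r18 small t1 t7 pp1'.
have r00 : 0 < r1 / 4 by lra using r10.
have alb : 0 <= (3 / 2 * E2) * delta < B * delta * (r1 / 4).
  have h1 : (8 * E2 + r1) * delta <= B * r1 * delta by rewrite ler_pM2r.
  have h2 : 0 < r1 * delta by rewrite mulr_gt0.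
  have h3 : 0 < E2 * delta by rewrite mulr_gt0.
  lra using pp1' E1c E1d h1 h2.
have rr : 5 / 4 * r1 + ((3 / 2 * E2) * delta + B * delta * (5 / 4 * r1)) <= 3 * r1.
  have : B * delta * (5 / 4 * r1) <= 1 / 2 * (5 / 4 * r1) by rewrite ler_pM2r//; lra using t5 r10.
  lra using Xk0 t4.
have h3 : 0 < E2 * delta by rewrite mulr_gt0.
have H1 : r1 / 4 <= x 0%N by rewrite x0; lra using Xk0.
have H2 : x n <= - (r1 / 4) by rewrite xn; lra using Xk1.
have H3 : r1 / 4 <= y 0%N by rewrite y0; lra using Xk0 pp1' t4 E1c E1d.
have H4 : y n <= - (r1 / 4) by rewrite yn; lra using Xk1 pp1' t4 E1c E1d'.
have H5 : `|x 0%N - y 0%N| <= 3 / 2 * E2 * delta by rewrite x0 y0 ler_norml; lra using pp1' E1c E1d.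
have H6 : `|x n - y n| < 3 / 2 * E2 * delta by rewrite xn yn ltr_norml; lra using pp1' E1c E1d' h3.
have [_ close] := transit_close s20 K20 bw0' bw1 cl b01 mub e01 e11 r00 alb rr tx ty
  H1 H2 H3 H4 H5 H6.
have Vd : 2 * (3 / 2 * E2 * delta + 2 * (B * delta * (5 / 4 * r1))) + B * delta +
    2 * K * (3 / 2 * E2 * delta + 2 * (B * delta * (5 / 4 * r1))) ^+ 2 <= (2 + 2 * K) * (2 * E2 + 2 * (B * (5 / 4 * r1))) * delta + B * delta.
  have E2d0 : 0 <= E2 * delta by exact: ltW.
  have Bd1 : B * delta <= 1 / 2 by lra using t5.
  have := window_arith K1 E2d0 E2d Bd0 Bd1 r10 r18.
  by rewrite [3 / 2 * (E2 * delta)]mulrA mulrA => h; apply: le_trans h _; clear; lra.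
move=> k /andP[kk0 kk1].
have kn : (k - k0 <= n)%N by exact: leq_sub2r.
have := le_trans (close _ kn) Vd; rewrite /x /y subnKC//.
have -> : Y k - X k = (p1 - p) - (X k - p - (Y k - p1)) by ring.
by have := ler_normB (p1 - p) (X k - p - (Y k - p1)); lra using pp1.
Qed.

End Passages.

Section OrbitsClose.
Variable R : realType.
Implicit Types (f d dd ddd e : R -> R) (K q m : R).

(** Smallness of [delta] needed in [orbits_close_outside] and [orbits_close_inside]. *)
Lemma small_delta (K C' s r1 E2 c B : R) : 0 <= K -> 0 <= C' -> 0 < s -> 0 < r1 -> 0 <= E2 ->
  0 < c -> 0 <= B -> exists2 dl : R, 0 < dl & forall delta : R, 0 < delta -> delta < dl ->
  [/\ delta <= s / 2, delta <= 1 / 4, c * delta <= r1 & 4 * E2 * delta <= r1] /\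
  [/\ 2 * B * delta <= 1, (C' + 1) * delta <= r1 & 4 * (1 + K) * c * delta <= 1].
Proof.
move=> K0 C0 s0 r0 E0 c0 B0.
have small (M b : R) : 0 <= M -> 0 < b -> exists2 dl : R, 0 < dl &
    forall delta : R, 0 < delta -> delta < dl -> M * delta <= b.
  move=> M0 b0; exists (b / (M + 1)); first by rewrite divr_gt0//; lra.
  move=> delta d0; rewrite ltr_pdivlMr; last by lra.
  lra.
have [d1 p1 h1] := small 1 (s / 2) ler01 (divr_gt0 s0 (ltr0n _ 2)).
have [d2 p2 h2] := small 1 (1 / 4) ler01 (divr_gt0 ltr01 (ltr0n _ 4)).
have [d3 p3 h3] := small c r1 (ltW c0) r0.
have [d4 p4 h4] : exists2 dl : R, 0 < dl &
    forall delta : R, 0 < delta -> delta < dl -> 4 * E2 * delta <= r1.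
  by apply: small => //; nonneg.
have [d5 p5 h5] : exists2 dl : R, 0 < dl &
    forall delta : R, 0 < delta -> delta < dl -> 2 * B * delta <= 1.
  by apply: small => //; nonneg.
have [d6 p6 h6] : exists2 dl : R, 0 < dl &
    forall delta : R, 0 < delta -> delta < dl -> (C' + 1) * delta <= r1.
  by apply: small => //; nonneg.
have [d7 p7 h7] : exists2 dl : R, 0 < dl &
    forall delta : R, 0 < delta -> delta < dl -> 4 * (1 + K) * c * delta <= 1.
  by apply: small => //; nonneg.
exists (Num.min d1 (Num.min d2 (Num.min d3 (Num.min d4 (Num.min d5 (Num.min d6 d7)))))).
  by rewrite !lt_min p1 p2 p3 p4 p5 p6 p7.
move=> delta d0; rewrite !lt_min => /andP[/(h1 _ d0) + /andP[/(h2 _ d0) + /andP[/(h3 _ d0) +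
  /andP[/(h4 _ d0) + /andP[/(h5 _ d0) + /andP[/(h6 _ d0) + /(h7 _ d0) +]]]]]].
by rewrite !mul1r.
Qed.

(** Two orbits that start together and leave the region together are close
    at every time, although they may spend arbitrarily long near [p]. *)
Lemma orbits_close_parabolic K (C' s r1 : R) : 1 <= K -> 0 <= C' -> 0 < s -> 0 < r1 ->
  r1 <= 1 / 8 -> 8 * K * r1 <= 1 ->
  exists2 dl : R, 0 < dl & exists2 U : R, 0 <= U &
  forall q m f d dd ddd (delta : R) e e1 e2 a (xs p : R) (X Y : nat -> R),
  base_map K q m f d dd ddd -> small_map delta q e e1 e2 -> 0 < delta -> delta < dl ->
  {homo f : x y / x <= y} -> {homo (fun x => f x + e x) : x y / x <= y} ->
  (forall x, -1 <= f x) -> (0 < a)%N -> f q <= xs -> xs < q ->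
  (forall k, X k.+1 = f (X k)) -> (forall k, Y k.+1 = f (Y k) + e (Y k)) ->
  X 0%N = xs -> Y 0%N = xs ->
  (forall k, (k < a)%N -> m <= X k) -> X a <= m ->
  (forall k, (k < a)%N -> m <= Y k) -> (forall k, (k < a)%N -> Y k.+1 < Y k) ->
  (forall y, Y a.-1 <= y -> y <= q -> f y + e y <= y) ->
  `|Y a - X a| <= C' * delta ->
  m + 8 * r1 < p -> p < q - 8 * r1 -> d p = 1 ->
  (forall x, `|x - p| <= 8 * r1 -> dd x <= - s) ->
  (forall x, m <= x <= q -> r1 <= `|x - p| -> s * r1 ^+ 2 / 4 <= x - f x) ->
  p - f p <= r1 / 4 ->
  forall k, (k <= a)%N -> `|Y k - X k| <= U * delta.
Proof.
move=> K1 C0 s0 r10 r18 Kr; have K0 : 0 <= K by lra.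
have [gam gE] : {gam : R | boxed (gam = s * r1 ^+ 2 / 4)} by eexists; constructor.
have g0 : 0 < gam by rewrite (unbox gE) divr_gt0// mulr_gt0// exprn_gt0.
have [N hN] := nat_above ((K + 1) / gam + 1).
have hNg : (K + 1) + gam <= N%:R * gam.
  have := ler_wpM2r (ltW g0) hN; rewrite mulrDl divfK ?gt_eqF// mul1r; lra.
have [c cE] : {c : R | boxed (c = 2 / s)} by eexists; constructor.
have c0 : 0 < c by rewrite (unbox cE) divr_gt0.
have [E1 E1E] : {E1 : R | boxed (E1 = (K + 1) ^+ N + (C' + 1) * (2 * K) ^+ N)}.
  by eexists; constructor.
have Ea : (K + 1) ^+ N <= E1.
  by rewrite (unbox E1E) lerDl mulr_ge0 ?exprn_ge0//; lra.
have Eb : (C' + 1) * (2 * K) ^+ N <= E1.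
  by rewrite (unbox E1E) lerDr exprn_ge0//; lra.
have E10 : 0 <= E1 by apply: le_trans Ea; rewrite exprn_ge0//; lra.
have [B BE] : {B : R | boxed (B = 8 * (E1 + c) / r1 + 1 + 8 * (1 + K * c) / s)}.
  by eexists; constructor.
have E20 : 0 <= E1 + c by lra.
have B1 : 1 <= B.
  rewrite (unbox BE) -addrA addrCA lerDl; nonneg.
have B0 : 0 < B by lra.
have Br : 8 * (E1 + c) + r1 <= B * r1.
  have -> : B * r1 = 8 * (E1 + c) + r1 + 8 * (1 + K * c) / s * r1.
    by rewrite (unbox BE); field; rewrite !gt_eqF.
  by rewrite lerDl; nonneg.
have Bs : 8 * (1 + K * c) <= s * B.
  have -> : s * B = 8 * (1 + K * c) + s * (8 * (E1 + c) / r1 + 1).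
    by rewrite (unbox BE); field; rewrite !gt_eqF.
  by rewrite lerDl; nonneg.
have [dl dl0 hdl] := small_delta K0 C0 s0 r10 E20 c0 (ltW B0).
exists dl => //.
have [V VE] : {V : R | boxed (V = (2 + 2 * K) * (2 * (E1 + c) + 2 * (B * (5 / 4 * r1))) + B + c)}.
  by eexists; constructor.
have V0 : 0 <= V by rewrite (unbox VE); nonneg; clear; lra.
exists (E1 + V); first by lra.
move=> q m f d dd ddd delta e e1 e2 a xs p X Y bm sm d0 ddl hf hF fm1 a0 fq xq XS YS X0 Y0
  mX Xam mY decY Fbelow uC mp pq dp ddw out small.
have [[t1 t2 t3 t4] [t5 t6 t7]] := hdl _ d0 ddl.
have m0 := bm_m0 bm.
have pI1 : 0 < p - 8 * r1 by lra using mp m0.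
have pI2 : p + 8 * r1 < q by lra using pq.
have gapr x : `|x - p| <= r1 -> x - f x <= r1 / 2.
  have pa : 0 < p - 4 * r1 by lra using r10 mp m0.
  have pb : p + 4 * r1 < q by lra using r10 pq.
  have r3 : 0 < 3 * r1 by lra using r10.
  have r34 : 3 * r1 < 4 * r1 by lra using r10.
  have fp : f p <= p by apply: ltW; apply: (bm_below bm); lra using r10 mp pq.
  have ddw4 x' : `|x' - p| <= 4 * r1 -> dd x' <= - s by move=> h; apply: ddw; lra using r10 h.
  have bw0 := shifted_bowl bm hf s0 r3 r34 pa pb dp fp ddw4.
  move=> xr; have xr3 : `|x - p| <= 3 * r1 by lra using r10 xr.
  have xpE : p + (x - p) = x by ring.
  have h := bowl_up bw0 xr3; rewrite xpE in h.
  apply: le_trans h _; have h1 : K * (x - p) ^+ 2 <= K * r1 ^+ 2.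
    by rewrite ler_wpM2l// -[X in X <= _]real_normK ?num_real// ler_sqr ?nnegrE//; lra using r10.
  have h2 : K * r1 ^+ 2 <= r1 / 8.
    rewrite (_ : K * r1 ^+ 2 = 8 * K * r1 * r1 / 8); last by field.
    have h3 : 8 * K * r1 * r1 <= 1 * r1 by rewrite ler_wpM2r//; lra using r10.
    lra using h3.
  lra using r10 small h1 h2.
have out' x : m <= x <= q -> r1 <= `|x - p| -> gam <= x - f x.
  by rewrite (unbox gE); exact: out.
have [k0 [k1 [[k01 k1a Xk0 Xk1 Yend] [fwd bwd monX monY]]]] :=
  orbits_close_outside bm sm C0 d0 hf hF fm1 a0 fq xq XS YS X0 Y0 mX Xam mY decY uC t6 mp pq r10 g0
    gapr out' hNg.
have cr : 2 / s * delta <= 8 * r1 by rewrite -(unbox cE); lra using r10 t3.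
have [p1 pp1 dp1] := perturbed_min bm sm d0 s0 pI1 pI2 dp ddw cr.
rewrite -(unbox cE) in pp1.
have Fp1 : f p1 + e p1 <= p1.
  by apply: Fbelow; move: pp1; rewrite ler_norml; lra using t3 Yend pq.
have Ea' := ler_wpM2r (ltW d0) Ea; have Eb' := ler_wpM2r (ltW d0) Eb.
have E1a k : (k <= k0)%N -> `|Y k - X k| <= E1 * delta.
  by move=> kk; exact: le_trans (fwd k kk) Ea'.
have E1b k : (k1 <= k)%N -> (k <= a)%N -> `|Y k - X k| <= E1 * delta.
  by move=> k1k ka; exact: le_trans (bwd k k1k ka) Eb'.
have E1c := E1a k0 (leqnn _).
have E1d := E1b k1 (leqnn _) (ltnW k1a).
have mid := orbits_close_inside bm sm d0 hf hF XS YS k01 k1a Xk0 Xk1 monX monY E1c E1d E10 mp pq r10 r18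
  dp dp1 ddw s0 t1 small Fp1 pp1 c0 t3 t2 t4 t5 t7 B0 Br Bs.
have V1 : 0 <= V * delta by nonneg.
have V2 : 0 <= E1 * delta by nonneg.
move=> k ka; rewrite mulrDl.
have [kk|kk] := leqP k k0.
  by apply: le_trans (E1a _ kk) _; rewrite lerDl.
have [kk'|kk'] := leqP k1 k.
  by apply: le_trans (E1b _ kk' ka) _; rewrite lerDl.
have kI : (k0 <= k <= k1)%N by rewrite (ltnW kk) (ltnW kk').
apply: le_trans (mid _ kI) _; rewrite -!mulrDl -(unbox VE).
by rewrite ler_pM2r// lerDr.
Qed.

(** If the gap is bounded below, the period is bounded. Otherwise its minimum is
    interior, the second derivative there is bounded away from 0 by negative
    Schwarzian, and [orbits_close_parabolic] applies with a window whose size depends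
    on [K] only. *)
Lemma orbits_close K (C' : R) : 1 <= K -> 0 <= C' ->
  exists2 dl : R, 0 < dl & exists2 U : R, 1 <= U &
  forall q m f d dd ddd (delta : R) e e1 e2 a (xs : R) (X Y : nat -> R),
  base_map K q m f d dd ddd -> small_map delta q e e1 e2 -> 0 < delta -> delta < dl ->
  {homo f : x y / x <= y} -> {homo (fun x => f x + e x) : x y / x <= y} ->
  (forall x, -1 <= f x) -> (0 < a)%N -> f q <= xs -> xs < q ->
  (forall k, X k.+1 = f (X k)) -> (forall k, Y k.+1 = f (Y k) + e (Y k)) ->
  X 0%N = xs -> Y 0%N = xs ->
  (forall k, (k < a)%N -> m <= X k) -> X a <= m ->
  (forall k, (k < a)%N -> m <= Y k) -> (forall k, (k < a)%N -> Y k.+1 < Y k) ->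
  (forall y, Y a.-1 <= y -> y <= q -> f y + e y <= y) ->
  `|Y a - X a| <= C' * delta ->
  forall k, (k <= a)%N -> `|Y k - X k| <= U * delta.
Proof.
move=> K1 C0; have K0 : 0 < K by lra.
have [k kE] : {k : R | k = K^-1} by eexists.
have k0 : 0 < k by rewrite kE invr_gt0.
have Kk : K * k = 1 by rewrite kE divff// gt_eqF.
have k1 : k <= 1 by rewrite kE invf_le1.
have k21 : k ^+ 2 <= k by rewrite expr2 ger_pMr.
have k20 : 0 < k ^+ 2 by rewrite exprn_gt0.
have k30 : 0 < k ^+ 3 by rewrite exprn_gt0.
have k40 : 0 < k ^+ 4 by rewrite exprn_gt0.
have k43 : k ^+ 4 <= k ^+ 3 by rewrite exprS ger_pMl.
have k32 : k ^+ 3 <= k ^+ 2 by rewrite exprS ger_pMl.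
have Kk3 : k ^+ 3 * K = k ^+ 2 by rewrite exprS mulrAC [k * K]mulrC Kk mul1r.
have Kk4 : k ^+ 4 * K = k ^+ 3 by rewrite exprS mulrAC [k * K]mulrC Kk mul1r.
have Kk2 : k ^+ 2 * K = k by rewrite expr2 -mulrA [k * K]mulrC Kk mulr1.
(* The curvature and the window are powers of 1/K: [s] is so small that
   [min_deriv2] applies, and [r1] so small that the curvature is at least [s] on
   the window of radius [8 r1]. *)
have [s sE] : {s : R | s = k ^+ 3 / 16} by eexists.
have [r1 rE] : {r1 : R | r1 = k ^+ 4 / 256} by eexists.
have s0 : 0 < s by lra.
have r10 : 0 < r1 by lra.
have Kr : 8 * K * r1 = k ^+ 3 / 32 by rewrite rE -Kk4; field.
have r18 : r1 <= 1 / 8 by lra.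
have Kr1 : 8 * K * r1 <= 1 by lra.
have [dl dl0 [U U0 par]] := orbits_close_parabolic K1 C0 s0 r10 r18 Kr1.
have [N hN] := nat_above ((K + 1) / (r1 / 4)).
have r40 : 0 < r1 / 4 by lra using k40 rE.
have hNg : K + 1 <= N%:R * (r1 / 4) by move: hN; rewrite ler_pdivrMr.
exists dl => //; have P1 : 1 <= (K + 1) ^+ N by apply: exprn_ege1; lra using K1.
exists ((K + 1) ^+ N + U); first by lra using U0 P1.
move=> q m f d dd ddd delta e e1 e2 a xs X Y bm sm d0 ddl hf hF fm1 a0 fq xq XS YS X0 Y0
  mX Xam mY decY Fbelow uC.
have [p [mp pq pmin]] := gap_min bm.
have qK := bm_q bm; have m0 := bm_m0 bm.
have [small|big] := ltP (p - f p) (r1 / 4); last first.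
  have decX j : (j < a)%N -> X j <= xs /\ X j.+1 < X j.
    have bel i : (i < a)%N -> X i <= xs -> X i.+1 < X i.
      by move=> ja le; rewrite XS; apply: (bm_below bm); rewrite mX//=; lra using xq le.
    elim: j => [ka|j IH ka]; first by split; [rewrite X0|apply: bel; rewrite ?X0].
    have [le lt] := IH (ltnW ka); have le' : X j.+1 <= xs by lra using le lt.
    by split=> //; exact: bel.
  have monY j : (j <= a)%N -> Y j <= xs.
    elim: j => [|j IH ja]; first by rewrite Y0.
    by apply: le_trans (IH (ltnW ja)); exact: ltW (decY _ ja).
  have aN : (a <= N)%N.
    have h : a%:R * (r1 / 4) <= X 0%N - X (0 + a)%N.
      apply: passage_count => j /andP[_ ja]; rewrite add0n in ja.
      apply: le_trans big _; rewrite XS; apply: pmin.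
      by rewrite mX//=; have [Xj _] := decX _ ja; lra using xq Xj.
    rewrite add0n X0 in h; have Xa : -1 <= X a by rewrite -(prednK a0) XS.
    rewrite -(ler_nat R) -(ler_pM2r r40); lra using hNg xq qK h Xa.
  move=> j ja; have XY : X 0%N = Y 0%N by rewrite X0 Y0.
  have inI i : (i < j)%N -> 0 < X i < q /\ 0 < Y i < q.
    move=> ij; have ia := leq_trans ij ja.
    have [Xi _] := decX _ ia; have Yi := monY _ (ltnW ia).
    by have mXi := mX _ ia; have mYi := mY _ ia; split; lra using xq m0 Xi Yi mXi mYi.
  apply: le_trans (forward_gap K1 (ltW d0) (bm_lip bm) (sm_0 sm) XS YS XY inI) _.
  rewrite ler_pM2r//; apply: le_trans (_ : (K + 1) ^+ N <= _); last by rewrite lerDl.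
  by rewrite ler_weXn2l//; [lra using K1|exact: leq_trans ja aN].
have rho0 : 0 < 8 * r1 by lra using k40 rE.
have c1 : (1 + K) * (8 * r1) <= K^-1 / 8.
  have E : (1 + K) * (8 * r1) = 8 * r1 + 8 * K * r1 by ring.
  by rewrite E Kr -kE; lra using k0 k21 k43 k32 rE.
have c2 : p - f p < K^-1 / 2 by rewrite -kE; lra using k0 k21 k43 k32 rE small.
have /andP[mp' pq'] := min_interior bm mp pq rho0 c1 c2.
have pI : m < p < q by lra using k40 rE mp' pq'.
have dp := min_deriv1 bm pI pmin.
have sK : s * K = k ^+ 2 / 16 by rewrite sE -Kk3; field.
have c3 : s * K <= 1 / 16 by lra using k1 k21 sK.
have c4 : 4 * (s * K) * K <= K^-1 / 4.
  by rewrite sK -kE (_ : 4 * (k ^+ 2 / 16) * K = k / 4); [clear; lra|rewrite -[in RHS]Kk2; field].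
have ddp := min_deriv2 bm pI dp s0 c3 c4 c2.
have pI1 : 0 < p - 8 * r1 by lra using m0 mp'.
have pI2 : p + 8 * r1 < q by lra using pq'.
have c5 : K * (8 * r1) <= s by rewrite mulrCA mulrA Kr sE; lra using k30.
have ddw := window_deriv2 bm pI1 pI2 ddp c5.
have c6 : s * (8 * r1) ^+ 2 / 4 <= K^-1.
  have h1 : (8 * r1) ^+ 2 <= 1 by rewrite expr_le1//; lra using k1 k21 k43 k32 rE k40.
  have h2 : s * (8 * r1) ^+ 2 <= s * 1 by rewrite ler_wpM2l// ltW.
  by rewrite -kE; lra using k0 k21 k32 sE h2.
have pm1 : m <= p - 8 * r1 by lra using mp'.
have out := window_outside bm pm1 pI2 dp s0 pmin ddw c6.
have out' x : m <= x <= q -> r1 <= `|x - p| -> s * r1 ^+ 2 / 4 <= x - f x.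
  by move=> xI xr; apply: out => //; lra using k40 rE.
have pe : p < q - 8 * r1 by lra using pq'.
have h := par q m f d dd ddd delta e e1 e2 a xs p X Y bm sm d0 ddl hf hF fm1 a0 fq xq XS YS X0 Y0
  mX Xam mY decY Fbelow uC mp' pe dp ddw out' (ltW small).
move=> j ja; apply: le_trans (h _ ja) _; rewrite ler_pM2r// lerDr; lra using P1.
Qed.

End OrbitsClose.

(** * The gap between two passage maps *)

Section PassageMaps.
Variable R : realType.
Implicit Types (f d dd ddd e : R -> R) (K q m : R).

Lemma cont_iter f n : continuous f -> continuous (iter n f).
Proof.
move=> cf; elim: n => [|n IH] x /=; first exact: cvg_id.
exact: continuous_comp (IH x) (cf _).
Qed.

Lemma iter_homo f n : {homo f : x y / x <= y} -> {homo iter n f : x y / x <= y}.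
Proof. by move=> hf; elim: n => [|n IH] x y xy //=; apply/hf/IH. Qed.

Lemma iter_decr f (q : R) n k : {homo f : x y / x <= y} -> f q <= q -> (k <= n)%N ->
  iter n f q <= iter k f q.
Proof.
move=> hf fq; elim: n => [|n IH]; first by rewrite leqn0 => /eqP ->.
rewrite leq_eqVlt => /orP[/eqP -> //|]; rewrite ltnS => /IH; apply: le_trans.
by rewrite iterSr; exact: iter_homo.
Qed.

(** A fixed point, or a point that moves up, would be a barrier for the orbit. *)
Lemma no_fixpoint f (q y : R) a : {homo f : x y / x <= y} ->
  f (iter a f q) < iter a f q -> iter a f q <= y <= q -> f y < y.
Proof.
move=> hf fa /andP[y1 y2]; rewrite ltNge; apply/negP => fy.
have h k : y <= iter k f q.
  by elim: k => [//|k IH]; apply: le_trans fy _; exact: hf.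
by have := h a.+1; rewrite /= leNgt (lt_le_trans fa).
Qed.

(** Bounded distortion: the image of [w0, w] is to a fundamental domain of the
    end of the orbit as [w0, w] is to the fundamental domain at its beginning,
    up to a factor that the total length of the domains controls. *)
Lemma lip_iterate (F d : R -> R) (q m c M : R) a : {homo F : x y / x <= y} -> continuous F ->
  (forall x, 0 < x < q -> is_derive x 1 F (d x)) ->
  (forall x y, 0 < x < q -> 0 < y < q -> `|d x - d y| <= M * `|x - y|) ->
  0 < m -> 0 < c -> 0 <= M -> (forall x, m <= x < q -> c <= d x) ->
  (forall k, (k <= a)%N -> m <= iter k F q) ->
  (forall k, (k <= a)%N -> iter k.+1 F q < iter k F q) ->
  forall w0 w, F q <= w0 -> w0 <= w -> w <= q ->
  iter a F w - iter a F w0 <=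
    expR (M / c * (q - iter a F q)) *
    ((w - w0) / (q - F q)) * (iter a F q - iter a.+1 F q).
Proof.
move=> hF cF dF lipd m0 c0 M0 low mc dec w0 w w0q w0w wq.
have [C CE] : {C : nat -> R | forall k, iter k F q = C k} by eexists.
have [A AE] : {A : nat -> R | forall k, iter k F w0 = A k} by eexists.
have [B BE] : {B : nat -> R | forall k, iter k F w = B k} by eexists.
have CS k : C k.+1 = F (C k) by rewrite -!CE.
have AS k : A k.+1 = F (A k) by rewrite -!AE.
have BS k : B k.+1 = F (B k) by rewrite -!BE.
have {}mc k : (k <= a)%N -> m <= C k by rewrite -CE; exact: mc.
have {}dec k : (k <= a)%N -> C k.+1 < C k by rewrite -!CE; exact: dec.
have AC k : C k.+1 <= A k by rewrite -CE -AE iterSr; exact: iter_homo.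
have AB k : A k <= B k by rewrite -AE -BE; exact: iter_homo.
have BC k : B k <= C k by rewrite -BE -CE; exact: iter_homo.
have Cq k : C k <= q.
  elim: k => [|k IH]; first by rewrite -CE.
  rewrite -CE iterSr -[q in _ <= q]/(iter 0 F q).
  have Fq : F q <= q by exact: le_trans w0q (le_trans w0w wq).
  by rewrite -iterSr; exact: iter_decr.
have [D DE] : {D : nat -> R | forall k, D k = C k - C k.+1} by eexists.
have [r rdef] : {r : nat -> R | forall k, r k = (B k - A k) / D k} by eexists.
have D0 k : (k <= a)%N -> 0 < D k by move=> /dec; rewrite DE subr_gt0.
have r0 k : (k <= a)%N -> 0 <= r k.
  by move=> ka; rewrite rdef divr_ge0 ?subr_ge0// ltW// D0.
have rS k : (k < a)%N -> r k.+1 <= (1 + M / c * D k) * r k.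
  move=> ka; have Dk := D0 _ (ltnW ka); have Dk1 := D0 _ ka.
  have mk1 := mc _ ka; have Cqk := Cq k.
  have mv x y : C k.+1 <= x -> x < y -> y <= C k ->
      exists2 t, C k.+1 < t < C k & F y - F x = d t * (y - x).
    move=> x1 xy y1; have dF' t : x < t < y -> is_derive t 1 F (d t).
      by move=> tI; apply: dF; lra.
    have [t tI E] := mvt xy (@within_cont _ _ _ cF) dF'.
    by exists t => //; lra.
  have [t tI Et] := mv _ _ (lexx _) (dec _ (ltnW ka)) (lexx _).
  have DS : D k.+1 = d t * D k by rewrite !DE -[C k.+2]/(C k.+1.+1) [C k.+1.+1]CS {1}CS.
  have ct : c <= d t by apply: low; lra.
  rewrite [r k.+1]rdef ler_pdivrMr//.
  have := AB k; rewrite le_eqVlt => /orP[/eqP E|lt].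
    by rewrite AS BS E subrr mulr_ge0 ?(ltW Dk1)// mulr_ge0 ?r0 ?(ltnW ka)//;
       rewrite addr_ge0// mulr_ge0 ?(ltW Dk)// divr_ge0// ltW.
  have [u uI Eu] := mv _ _ (AC k) lt (BC k).
  rewrite AS BS Eu DS.
  have rE : r k * D k = B k - A k by rewrite rdef divfK// gt_eqF.
  have -> : (1 + M / c * D k) * r k * (d t * D k) = (1 + M / c * D k) * d t * (B k - A k).
    by rewrite -rE; ring.
  rewrite ler_wpM2r ?subr_ge0//.
  have tI' : 0 < t < q by lra.
  have uI' : 0 < u < q by lra.
  have := lipd _ _ uI' tI'; rewrite ler_norml => /andP[_ h].
  have h2 : M * `|u - t| <= M * D k.
    by rewrite ler_wpM2l// ler_norml DE; lra.
  have h3 : M * D k <= M / c * D k * d t.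
    rewrite mulrAC -[X in X <= _](_ : M / c * c * D k = _); last by rewrite divfK ?gt_eqF.
    by rewrite ler_wpM2r ?(ltW Dk)// ler_wpM2l// divr_ge0// ltW.
  rewrite mulrDl mul1r; lra.
have Mc : 0 <= M / c by rewrite divr_ge0// ltW.
have := gronwall_exp Mc r0 rS.
move=> h.
have Da := D0 _ (leqnn a); have := ler_wpM2r (ltW Da) h.
rewrite [r a]rdef [r 0%N]rdef divfK ?gt_eqF//.
rewrite (eq_bigr (fun k : 'I_a => C k - C k.+1)) => [|k _]; last exact: DE.
by rewrite sum_telescope !DE -!CE -!AE -!BE.
Qed.

End PassageMaps.

Section GapCore.
Variable R : realType.
Implicit Types (f d dd ddd e : R -> R) (K q m : R).

(** Once the last landing points differ by a large multiple of [delta], all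
    pairs of nearby points of the fundamental domain land in the same order:
    otherwise two orbits would be synchronized, and by bounded distortion
    the last landing points would be close. *)
Lemma gap_core K (J : R) : 1 <= K -> 0 <= J ->
  exists2 dl : R, 0 < dl & exists2 L : R, 0 <= L &
  forall q m f d dd ddd (delta : R) e e1 e2 a F,
  base_map K q m f d dd ddd -> small_map delta q e e1 e2 -> 0 < delta -> delta < dl ->
  F = (fun x => f x + e x) ->
  {homo f : x y / x <= y} -> {homo F : x y / x <= y} -> continuous F ->
  (forall x, -1 <= f x) -> (forall x, -1 <= F x) -> (0 < a)%N -> iter a f q = m ->
  m + L * delta < iter a F q -> F (iter a F q) <= 0 ->
  forall w0 w1, f q <= w0 <= q -> F q <= w1 <= q -> `|w1 - w0| <= J * delta ->
  iter a f w0 + delta <= iter a F w1.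
Proof.
move=> K1 J0; have K0 : 0 < K by plra.
have [Lam LamE] : {Lam : R | boxed (Lam = expR (2 * K / (2 * K)^-1 * K) * (K + 1) * (2 * K))}.
  by eexists; constructor.
have Lam0 : 0 <= Lam.
  by rewrite (unbox LamE) !mulr_ge0 ?expR_ge0//; plra.
have [C' CE] : {C' : R | C' = Lam * J + 1} by eexists.
have LJ : 0 <= Lam * J by rewrite mulr_ge0.
have C0 : 0 <= C' by plra.
have [dl1 dl10 [U1 U11 syn]] := orbits_close K1 C0.
have [U2 U2E] : {U2 : R | boxed (U2 = U1 + K * (K + 1))} by eexists; constructor.
have U21 : U1 <= U2 by rewrite (unbox U2E) lerDl; nonneg; plra.
have U2K : K * (K + 1) <= U2 by rewrite (unbox U2E) lerDr; plra.
have U2_1 : 1 <= U2 by plra.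
have [L' L0 dist] := distortion K1 U2_1.
have k20 : 0 < (2 * K)^-1 by rewrite invr_gt0; plra.
have KK : K^-1 = 2 * (2 * K)^-1 by field; plra.
exists (Num.min dl1 ((2 * K)^-1 / (K + 1))).
  by rewrite lt_min dl10 divr_gt0//; plra.
exists (L' + C' + 1); first by plra.
move=> q m f d dd ddd delta e e1 e2 a F bm sm d0 ddl FE hf hF cF fm1 Fm1 a0 am Lm Fa
  w0 w1 w0I w1I w01.
move: ddl; rewrite lt_min => /andP[ddl1]; rewrite ltr_pdivlMr; last by lra using K1.
move=> ddl2.
have m0 := bm_m0 bm; have qK := bm_q bm; have mq := bm_mq bm.
have dK1 : 0 < K * delta by rewrite mulr_gt0.
have dK : delta <= (2 * K)^-1 by lra using ddl2 dK1.
have P1 : 0 < (L' + C' + 1) * delta by rewrite mulr_gt0//; lra using CE LJ L0.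
have [m1 m1E] : {m1 : R | iter a F q = m1} by eexists.
rewrite m1E in Lm Fa.
have mm1 : m < m1 by lra using P1 Lm.
have fq : f q <= q by have := bm_endq bm; lra using k20.
have e_q : `|e q| <= (K + 1) * delta.
  have ce : {within `[0, q], continuous e}.
    have -> : e = fun x => F x - f x by apply/funext => x; rewrite FE addrC addKr.
    by apply: within_cont => x; apply: cvgB; [exact: cF|exact: (bm_cont bm)].
  have mI : 0 < m < q by lra using m0 mq.
  have mI' : 0 <= m <= q by lra using m0 mq.
  have qI' : 0 <= q <= q by lra using m0 mq.
  have h := lip_within (ltW d0) ce (sm_d sm) (sm_1 sm) qI' mI'.
  have h2 := sm_0 sm mI.
  have h3 : delta * `|q - m| <= delta * K by rewrite ler_wpM2l ?(ltW d0)// gtr0_norm; lra using m0 qK mq.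
  have := ler_normD (e q - e m) (e m); rewrite subrK; lra using h h2 h3.
have Fq' : F q = f q + e q by rewrite FE.
have Fq : F q <= q - (2 * K)^-1.
  by move: e_q; rewrite ler_norml Fq'; have := bm_endq bm; lra using ddl2.
have Fqq : F q <= q by lra using w1I.
have lowF x : m <= x < q -> (2 * K)^-1 <= d x + e1 x.
  move=> xI; have xI' : 0 < x < q by lra using m0 xI.
  by have := bm_low bm xI; have := sm_1 sm xI'; rewrite ler_norml; lra using ddl2 dK1.
have dF x : 0 < x < q -> is_derive x 1 F (d x + e1 x).
  by move=> xI; rewrite FE; exact: dvD (bm_d bm xI) (sm_d sm xI).
have m1q : m1 <= q by rewrite -m1E; exact: (@iter_decr _ F q a 0 hF Fqq).
have Fbel y : m1 <= y <= q -> F y < y.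
  by rewrite -m1E; apply: no_fixpoint => //; rewrite m1E; lra using m0 P1 Lm Fa.
have orbF k : (k <= a)%N -> m1 <= iter k F q by move=> ka; rewrite -m1E; exact: iter_decr.
have orbf k : (k <= a)%N -> m <= iter k f q by move=> ka; rewrite -am; exact: iter_decr.
have Fleq k : iter k F q <= q by exact: (@iter_decr _ F q k 0 hF Fqq).
(* Lipschitz bound of the passage map of F *)
have lip u v : F q <= u -> u <= v -> v <= q -> iter a F v - iter a F u <= Lam * (v - u).
  move=> u1 uv v1.
  have lipd x y : 0 < x < q -> 0 < y < q ->
      `|(d x + e1 x) - (d y + e1 y)| <= 2 * K * `|x - y|.
    move=> xI yI; have h1 := lip_open (ltW K0) (bm_dd bm) (bm_ddK bm) xI yI.
    have h2 := lip_open (ltW d0) (sm_dd sm) (sm_2 sm) xI yI.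
    have h3 : delta * `|x - y| <= K * `|x - y|.
      rewrite ler_wpM2r//; have : (2 * K)^-1 <= 1 by rewrite invf_le1; lra using K1.
      lra using K1 ddl2 dK1.
    have -> : d x + e1 x - (d y + e1 y) = (d x - d y) + (e1 x - e1 y) by ring.
    by have := ler_normD (d x - d y) (e1 x - e1 y); lra using h1 h2 h3.
  have K20 : 0 <= 2 * K by lra using K1.
  have mk k : (k <= a)%N -> m <= iter k F q by move=> /orbF; lra using P1 Lm.
  have dk k : (k <= a)%N -> iter k.+1 F q < iter k F q.
    by move=> ka; rewrite iterS; apply: Fbel; rewrite orbF//= Fleq.
  have h := lip_iterate hF cF dF lipd m0 k20 K20 lowF mk dk u1 uv v1.
  apply: le_trans h _; rewrite m1E iterS m1E (unbox LamE).
  have -> : expR (2 * K / (2 * K)^-1 * K) * (K + 1) * (2 * K) * (v - u) =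
    expR (2 * K / (2 * K)^-1 * K) * ((2 * K) * (v - u)) * (K + 1) by ring.
  have gq : 0 < q - F q by lra using k20 Fq.
  apply: ler_pM.
  - by rewrite mulr_ge0 ?expR_ge0// divr_ge0 ?subr_ge0.
  - by lra using m0 P1 Lm Fa.
  - apply: ler_pM; rewrite ?expR_ge0// ?divr_ge0 ?subr_ge0//.
      rewrite ler_expR ler_wpM2l//; last by lra using m0 qK P1 Lm.
      by rewrite divr_ge0// ltW.
    rewrite mulrC ler_wpM2r ?subr_ge0// -[2 * K]invrK lef_pV2 ?posrE//.
    lra using Fq.
  - by have := Fm1 m1; lra using qK m1q.
rewrite leNgt; apply/negP => lt.
have [w wE] : {w : R | w = Num.max w0 w1} by eexists.
have [ww0 ww1] : w0 <= w /\ w1 <= w by rewrite wE !le_max !lexx orbT.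
have wq : w <= q by rewrite wE ge_max; lra using w0I w1I.
have w1J : w - w1 <= J * delta.
  have Jd : 0 <= J * delta by rewrite mulr_ge0// ltW.
  have : w <= w1 + J * delta; last by clear; lra.
  by rewrite wE ge_max; move: w01; rewrite ler_norml; clear; lra.
have fw : f q <= w by lra using w0I ww0.
have Fw : F q <= w by lra using w1I ww1.
(* h measures how far the orbit of F lags behind the orbit of f *)
have [h hE] : {h : R -> R | h = fun x => iter a F x - iter a f x} by eexists.
have hx x : h x = iter a F x - iter a f x by rewrite hE.
have ch : continuous h.
  rewrite hE => x; apply: cvgB; first exact: cont_iter.
  by apply: cont_iter; exact: (bm_cont bm).
have hw : h w < C' * delta.
  have h1 := lip w1 w (proj1 (andP w1I)) ww1 wq.
  have h2 := iter_homo a hf ww0.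
  have h3 := ler_wpM2l Lam0 w1J.
  rewrite hx CE mulrDl mul1r -mulrA; lra using lt h1 h2 h3.
have hq : (L' + C' + 1) * delta < h q by rewrite hx m1E am; lra using Lm.
have Cd : C' * delta < (L' + C' + 1) * delta by rewrite ltr_pM2r//; lra using L0.
(* Equality at [xs] makes the two orbits of [xs] comparable at all times; the
   value at [C] is larger than distortion allows. *)
have [xs xsI xsE] : exists2 c, c \in `[w, q] & h c = C' * delta.
  apply: IVT => //; first exact: within_cont.
  by rewrite ge_min le_max; apply/andP; split; apply/orP; [left|right]; lra using hw hq Cd.
rewrite in_itv /= in xsI.
have xsq : xs < q.
  rewrite lt_neqAle; apply/andP; split; last by lra using xsI.
  by apply/eqP => E; rewrite E in xsE; lra using hq Cd xsE.
have [C CI CE'] : exists2 c, c \in `[xs, q] & h c = (L' + C' + 1) * delta.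
  apply: IVT; [lra using xsI|exact: within_cont|].
  by rewrite ge_min le_max; apply/andP; split; apply/orP; [left|right]; lra using Cd xsE hq.
rewrite in_itv /= in CI.
have xC : xs < C.
  rewrite lt_neqAle; apply/andP; split; last by lra using CI.
  by apply/eqP => E; rewrite -E in CE'; lra using Cd xsE CE'.
have Cq : C < q.
  rewrite lt_neqAle; apply/andP; split; last by lra using CI.
  by apply/eqP => E; rewrite E in CE'; lra using hq CE'.
have fxs : f q <= xs by lra using w0I ww0 xsI.
have Fxs : F q <= xs by lra using w1I ww1 xsI.
have mX k : (k < a)%N -> m <= iter k f xs.
  move=> ka; apply: le_trans (orbf _ ka) _; rewrite iterSr; exact: iter_homo.
have mY1 k : (k < a)%N -> m1 <= iter k F xs.
  move=> ka; apply: le_trans (orbF _ ka) _; rewrite iterSr; exact: iter_homo.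
have mY k : (k < a)%N -> m <= iter k F xs by move=> /mY1; lra using P1 Lm.
have Yq k : iter k F xs <= q by apply: le_trans (Fleq k); apply: iter_homo => //; lra using xsI.
have decY k : (k < a)%N -> iter k.+1 F xs < iter k F xs.
  by move=> ka; rewrite iterS; apply: Fbel; rewrite mY1//= Yq.
have Xam : iter a f xs <= m by rewrite -am; apply: iter_homo => //; lra using xsI.
have uC : `|iter a F xs - iter a f xs| <= C' * delta.
  by rewrite -hx xsE ger0_norm// mulr_ge0// ltW.
have Fbelow y : iter a.-1 F xs <= y -> y <= q -> f y + e y <= y.
  move=> y1 y2; have := Fbel y; rewrite {1}FE => h1; apply/ltW/h1.
  by rewrite y2 andbT; apply: le_trans y1; apply: mY1; rewrite prednK.
have hF' : {homo (fun x => f x + e x) : x y / x <= y} by rewrite -FE.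
have XS k : iter k.+1 f xs = f (iter k f xs) by [].
have YS k : iter k.+1 F xs = f (iter k F xs) + e (iter k F xs) by rewrite iterS {1}FE.
have u := syn q m f d dd ddd delta e e1 e2 a xs (fun k => iter k f xs) (fun k => iter k F xs)
  bm sm d0 ddl1 hf hF' fm1 a0 fxs xsq XS YS erefl erefl mX Xam mY decY Fbelow uC.
have gxs : U2^-1 <= xs - f xs.
  have K11 : 0 < K * (K + 1) by rewrite mulr_gt0//; lra using K1.
  apply: (@le_trans _ _ (K * (K + 1))^-1); first by rewrite lef_pV2 ?posrE//; lra using U11 U21.
  rewrite -[X in X <= _]mul1r ler_pdivrMr//.
  have eq1 := bm_endq bm.
  have xsm : m <= xs by have := mX 0%N a0.
  have dfx t : xs < t < q -> is_derive t 1 f (d t) by move=> tI; apply: (bm_d bm); lra using m0 xsm tI.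
  have [t tI E] := mvt xsq (@within_cont _ _ _ (bm_cont bm)) dfx.
  have h1 : K^-1 <= d t by apply: (bm_low bm); lra using xsm tI.
  have h2 : K^-1 * (q - xs) <= d t * (q - xs) by rewrite ler_wpM2r; lra using K1 xsI h1.
  have h3 : K * (K^-1 * (q - xs)) = q - xs by rewrite mulrA divff ?gt_eqF// mul1r.
  have h4 : K * K^-1 = 1 by rewrite divff ?gt_eqF.
  have h5 : K * (K^-1 * (q - xs)) <= K * (xs - f xs) by rewrite ler_wpM2l ?(ltW K0)//; lra using w0I ww0 xsI E h2.
  have h6 : K * K^-1 <= K * (q - f xs).
    by rewrite ler_wpM2l ?(ltW K0)//; have := hf _ _ (ltW xsq); lra using eq1.
  have h7 : K * (q - xs) <= K * (K * (xs - f xs)) by rewrite ler_wpM2l ?(ltW K0)//; lra using h3 h5.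
  have -> : (xs - f xs) * (K * (K + 1)) = K * (K * (xs - f xs)) + K * (xs - f xs) by ring.
  lra using h4 h6 h7.
have fC : f C <= xs by apply: le_trans fxs; apply: hf; lra using CI.
have FC : f C + e C <= xs.
  have : F C <= xs by apply: le_trans Fxs; apply: hF; lra using CI.
  by rewrite {1}FE.
rewrite FE in mY decY u.
have u2 k : (k <= a)%N -> `|iter k (fun x => f x + e x) xs - iter k f xs| <= U2 * delta.
  by move=> /u h1; apply: le_trans h1 _; rewrite ler_wpM2r// ltW.
have := dist q m f d dd ddd delta e e1 e2 a xs C bm (ltW d0) dK sm hf hF' xC Cq fC FC gxs a0
  mX mY decY u2.
rewrite -FE -hx CE' ger0_norm ?(ltW P1)//.
have : 0 < (C' + 1) * delta by rewrite mulr_gt0//; lra using CE LJ.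
clear; lra.
Qed.

End GapCore.

(** * The Moebius coordinate of a normalized pair *)

Section Moebius.
Variable R : realType.
Implicit Types (q x y u v lo hi K : R).

Lemma mobiusE q x : mobius (-1) q x = (q + 1) * x / ((q - 1) * x + 2 * q).
Proof. by rewrite /mobius; congr (_ * _ / _); ring. Qed.

Lemma mobius_invE q y : mobius_inv (-1) q y = 2 * q * y / ((q + 1) - (q - 1) * y).
Proof.
rewrite /mobius_inv (_ : (-1 + q) * y - _ = - (q + 1 - (q - 1) * y)); last by ring.
by rewrite invrN mulrN -mulNr; congr (_ * _^-1); ring.
Qed.

Lemma mobius_den_ge K q x : 1 <= K -> K^-1 <= q -> -1 <= x <= q ->
  K^-1 <= (q - 1) * x + 2 * q.
Proof.
move=> K1 Kq /andP[x1 x2].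
have Ki : 0 < K^-1 by rewrite invr_gt0; lra.
have Ki1 : K^-1 <= 1 by rewrite invf_le1; lra.
by have [h|h] := leP q 1; nra.
Qed.

Lemma mobius_inv_den_ge K q y : 1 <= K -> K^-1 <= q -> -1 <= y <= 1 ->
  K^-1 <= (q + 1) - (q - 1) * y.
Proof.
move=> K1 Kq /andP[y1 y2].
have Ki : 0 < K^-1 by rewrite invr_gt0; lra.
have Ki1 : K^-1 <= 1 by rewrite invf_le1; lra.
by have [h|h] := leP q 1; nra.
Qed.

Lemma mobius_den_gt0 q x : 0 < q -> -1 <= x <= q -> 0 < (q - 1) * x + 2 * q.
Proof. by move=> q0 /andP[? ?]; have [h|h] := leP q 1; nra. Qed.

Lemma mobius_inv_den_gt0 q y : 0 < q -> -1 <= y <= 1 -> 0 < (q + 1) - (q - 1) * y.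
Proof. by move=> q0 /andP[? ?]; have [h|h] := leP q 1; nra. Qed.

Lemma mobius_lt q x y : 0 < q -> -1 <= x -> x < y -> y <= q ->
  mobius (-1) q x < mobius (-1) q y.
Proof.
move=> q0 x1 xy yq.
have dx : 0 < (q - 1) * x + 2 * q by apply: mobius_den_gt0; lra.
have dy : 0 < (q - 1) * y + 2 * q by apply: mobius_den_gt0; lra.
rewrite !mobiusE -subr_gt0 (_ : _ - _ =
  2 * q * (q + 1) * (y - x) / (((q - 1) * y + 2 * q) * ((q - 1) * x + 2 * q))).
  by rewrite divr_gt0 ?mulr_gt0//; lra.
by field; rewrite !gt_eqF.
Qed.

Lemma mobius_inv_sub q u v : 0 < q -> -1 <= u <= 1 -> -1 <= v <= 1 ->
  mobius_inv (-1) q u - mobius_inv (-1) q v =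
  2 * q * (q + 1) * (u - v) / (((q + 1) - (q - 1) * u) * ((q + 1) - (q - 1) * v)).
Proof.
move=> q0 uI vI.
have du := mobius_inv_den_gt0 q0 uI; have dv := mobius_inv_den_gt0 q0 vI.
by rewrite !mobius_invE; field; rewrite !gt_eqF.
Qed.

Lemma mobius_inv_lt q u v : 0 < q -> -1 <= u -> u < v -> v <= 1 ->
  mobius_inv (-1) q u < mobius_inv (-1) q v.
Proof.
move=> q0 u1 uv v1; rewrite -subr_gt0 mobius_inv_sub//; try lra.
rewrite divr_gt0 ?mulr_gt0 ?mobius_inv_den_gt0//; lra.
Qed.

Lemma mobius_le q x y : 0 < q -> -1 <= x -> x <= y -> y <= q ->
  mobius (-1) q x <= mobius (-1) q y.
Proof.
move=> q0 x1; rewrite le_eqVlt => /orP[/eqP -> //|xy] yq; exact/ltW/mobius_lt.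
Qed.

Lemma mobius_inv_le q u v : 0 < q -> -1 <= u -> u <= v -> v <= 1 ->
  mobius_inv (-1) q u <= mobius_inv (-1) q v.
Proof.
move=> q0 u1; rewrite le_eqVlt => /orP[/eqP -> //|uv] v1; exact/ltW/mobius_inv_lt.
Qed.

Lemma mobius_inv_lip K q u v : 1 <= K -> K^-1 <= q <= K -> -1 <= u <= 1 -> -1 <= v <= 1 ->
  `|mobius_inv (-1) q u - mobius_inv (-1) q v| <= 4 * K ^+ 4 * `|u - v|.
Proof.
move=> K1 /andP[q1 q2] uI vI; have Ki : 0 < K^-1 by rewrite invr_gt0; lra.
have q0 : 0 < q by lra.
rewrite mobius_inv_sub//.
have du := mobius_inv_den_ge K1 q1 uI; have dv := mobius_inv_den_ge K1 q1 vI.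
set a := _ - (q - 1) * u in du *; set b := _ - (q - 1) * v in dv *.
have a0 : 0 < a by lra. have b0 : 0 < b by lra.
rewrite normrM normfV (gtr0_norm (mulr_gt0 a0 b0)) ler_pdivrMr ?mulr_gt0// normrM ger0_norm; last first.
  by rewrite !mulr_ge0//; lra.
rewrite [X in _ <= X]mulrAC ler_wpM2r//.
have h1 : 1 <= K * a by rewrite -ler_pdivrMl ?mulr1//; lra.
have h2 : 1 <= K * b by rewrite -ler_pdivrMl ?mulr1//; lra.
have h3 : 1 <= (K * a) * (K * b) by rewrite mulr_ege1.
have h4 : q * (q + 1) <= 2 * K ^+ 2 by nra.
have -> : 4 * K ^+ 4 * (a * b) = 4 * K ^+ 2 * ((K * a) * (K * b)) by ring.
have : 4 * K ^+ 2 * 1 <= 4 * K ^+ 2 * ((K * a) * (K * b)).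
  by apply: ler_wpM2l => //; nonneg.
clear -h4; lra.
Qed.

Lemma mobiusK q x : 0 < q -> -1 <= x <= q -> mobius_inv (-1) q (mobius (-1) q x) = x.
Proof.
move=> q0 xI; have d := mobius_den_gt0 q0 xI.
have d' : (q + 1) - (q - 1) * mobius (-1) q x = 2 * q * (q + 1) / ((q - 1) * x + 2 * q).
  by rewrite mobiusE; field; rewrite gt_eqF.
rewrite mobius_invE d' mobiusE; field.
by rewrite !gt_eqF//; lra.
Qed.

Lemma mobius_mem q x : 0 < q -> -1 <= x <= q -> -1 <= mobius (-1) q x <= 1.
Proof.
move=> q0 xI; have d := mobius_den_gt0 q0 xI; rewrite mobiusE.
rewrite ler_pdivlMr// ler_pdivrMr//; move: xI => /andP[? ?].
by apply/andP; split; nra.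
Qed.

Lemma mobius0 q : mobius (-1) q 0 = 0.
Proof. by rewrite mobiusE mulr0 mul0r. Qed.

Lemma mobius_inv0 q : mobius_inv (-1) q 0 = 0.
Proof. by rewrite mobius_invE mulr0 mul0r. Qed.

Lemma mobius_end q : 0 < q -> mobius (-1) q q = 1.
Proof.
by move=> q0; have [] := @mobius_values R (-1) q _; rewrite // q0 andbT; lra.
Qed.

Lemma mobius_start q : 0 < q -> mobius (-1) q (-1) = -1.
Proof.
by move=> q0; have [] := @mobius_values R (-1) q _; rewrite // q0 andbT; lra.
Qed.

Lemma mobius_inv_end q : 0 < q -> mobius_inv (-1) q 1 = q.
Proof.
by move=> q0; have := @mobiusK q q q0; rewrite mobius_end// lexx andbT; apply; lra.
Qed.

Lemma mobius_inv_start q : 0 < q -> mobius_inv (-1) q (-1) = -1.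
Proof.
by move=> q0; have := @mobiusK q (-1) q0; rewrite mobius_start// lexx /=; apply; lra.
Qed.

Lemma mobius_inv_mem q y : 0 < q -> -1 <= y <= 1 -> -1 <= mobius_inv (-1) q y <= q.
Proof.
by move=> q0 yI; have [] := @mobius_invK R (-1) q y _ yI; rewrite // q0 andbT; lra.
Qed.

Lemma mobius_invK1 q y : 0 < q -> -1 <= y <= 1 -> mobius (-1) q (mobius_inv (-1) q y) = y.
Proof.
by move=> q0 yI; have [] := @mobius_invK R (-1) q y _ yI; rewrite // q0 andbT; lra.
Qed.

Lemma mobius_cont q x : 0 < q -> -1 <= x <= q -> {for x, continuous (mobius (-1) q)}.
Proof.
move=> q0 xI; have d := mobius_den_gt0 q0 xI.
rewrite (_ : mobius (-1) q = fun y => (q + 1) * y / ((q - 1) * y + 2 * q)); last first.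
  by apply/funext => y; rewrite mobiusE.
apply: cvgM; first by apply: cvgM; [exact: cvg_cst|exact: cvg_id].
apply: cvgV; first by rewrite gt_eqF.
apply: cvgD; last exact: cvg_cst.
by apply: cvgM; [exact: cvg_cst|exact: cvg_id].
Qed.

Lemma mobius_inv_cont q y : 0 < q -> -1 <= y <= 1 -> {for y, continuous (mobius_inv (-1) q)}.
Proof.
move=> q0 yI; have d := mobius_inv_den_gt0 q0 yI.
rewrite (_ : mobius_inv (-1) q = fun y => 2 * q * y / ((q + 1) - (q - 1) * y)); last first.
  by apply/funext => z; rewrite mobius_invE.
apply: cvgM; first by apply: cvgM; [exact: cvg_cst|exact: cvg_id].
apply: cvgV; first by rewrite gt_eqF.
apply: cvgB; first exact: cvg_cst.
by apply: cvgM; [exact: cvg_cst|exact: cvg_id].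
Qed.

Lemma mobius_inv_param K q q' y : 1 <= K -> K^-1 <= q -> K^-1 <= q' -> 0 <= y <= 1 ->
  `|mobius_inv (-1) q y - mobius_inv (-1) q' y| <= 4 * K ^+ 2 * `|q - q'|.
Proof.
move=> K1 q1 q1' /andP[y0 y1]; have Ki : 0 < K^-1 by rewrite invr_gt0; lra.
have yI : -1 <= y <= 1 by lra.
have du := mobius_inv_den_ge K1 q1 yI; have dv := mobius_inv_den_ge K1 q1' yI.
rewrite !mobius_invE.
set a := _ - (q - 1) * y in du *; set b := _ - (q' - 1) * y in dv *.
have a0 : 0 < a by lra. have b0 : 0 < b by lra.
have -> : 2 * q * y / a - 2 * q' * y / b = 2 * y * (1 + y) * (q - q') / (a * b).
  have -> : 2 * y * (1 + y) * (q - q') = 2 * q * y * b - 2 * q' * y * a by rewrite /a /b; ring.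
  by field; rewrite !gt_eqF.
rewrite normrM normfV (gtr0_norm (mulr_gt0 a0 b0)) ler_pdivrMr ?mulr_gt0// normrM ger0_norm; last first.
  by rewrite !mulr_ge0//; lra.
rewrite [X in _ <= X]mulrAC ler_wpM2r//.
have h1 : 1 <= K * a by rewrite -ler_pdivrMl ?mulr1//; lra.
have h2 : 1 <= K * b by rewrite -ler_pdivrMl ?mulr1//; lra.
have h3 : 1 <= (K * a) * (K * b) by rewrite mulr_ege1.
have -> : 4 * K ^+ 2 * (a * b) = 4 * ((K * a) * (K * b)) by ring.
clear -h3 y0 y1; nra.
Qed.

Definition clamp lo hi x := Num.max lo (Num.min hi x).

Lemma clamp_mem lo hi x : lo <= hi -> lo <= clamp lo hi x <= hi.
Proof. by move=> h; rewrite /clamp le_max lexx/= ge_max h/= ge_min lexx. Qed.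

Lemma clamp_id lo hi x : lo <= x <= hi -> clamp lo hi x = x.
Proof. by move=> /andP[h1 h2]; rewrite /clamp (min_idPr h2) (max_idPr h1). Qed.

Lemma clamp_homo lo hi : {homo clamp lo hi : x y / x <= y}.
Proof.
move=> x y xy; rewrite /clamp ge_max le_max lexx/= le_max.
by apply/orP; right; rewrite le_min ge_min lexx/= ge_min xy orbT.
Qed.

Lemma clamp_lip lo hi x y : `|clamp lo hi x - clamp lo hi y| <= `|x - y|.
Proof.
wlog xy : x y / x <= y.
  move=> W; have [|/ltW] := leP x y; first exact: W.
  by move=> h; rewrite distrC (distrC x); exact: W.
have h := clamp_homo lo hi xy.
rewrite distrC (distrC x) ger0_norm ?subr_ge0// ger0_norm ?subr_ge0//.
by rewrite /clamp /Num.max /Num.min; do ! case: ifP; lra.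
Qed.

Lemma clamp_cont lo hi : continuous (clamp lo hi).
Proof.
move=> x; apply/cvgrPdist_le => /= e e0; near=> t.
apply: le_trans (clamp_lip _ _ _ _) _.
by near: t; apply: cvgr_dist_le.
Unshelve. all: by end_near. Qed.

Lemma within_clamp (f : R -> R) lo hi : lo < hi -> {within `[lo, hi], continuous f} ->
  continuous (fun x => f (clamp lo hi x)).
Proof.
move=> lh cf x; apply/cvgrPdist_le => /= e e0.
have mem t : `[lo, hi]%classic (clamp lo hi t).
  by rewrite /= in_itv /=; apply: clamp_mem; exact: ltW.
have /subspace_continuousP cA := cf.
have /cvgrPdist_le h := cA _ (mem x).
have {}h := h _ e0; rewrite near_withinE in h.
have {}h : \forall t \near x, `[lo, hi]%classic (clamp lo hi t) ->
  `|f (clamp lo hi x) - f (clamp lo hi t)| <= e := @clamp_cont lo hi x _ h.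
by near=> t; apply: (near h t _) (mem t).
Unshelve. all: by end_near. Qed.

End Moebius.

(** * One-sided derivatives and maps with two bounded derivatives *)

Section OneSided.
Variable R : realType.
Implicit Types (f g : R -> R) (A : set R) (x l K : R).

(** At an interior point the relative derivative is the ordinary one. *)
Lemma diffq_cvgP A f x l : nbhs x A ->
  (diffq f x y @[y --> within A x^'] --> l) <-> is_derive x 1 f l.
Proof.
move=> xA.
have E : ((fun h : R => h^-1 *: ((f \o shift x) (h *: 1) - f x)) @ 0^' --> l) <->
    is_derive x 1 f l.
  split=> [cl|[cd]]; last by rewrite /derive => <-; exact: cd.
  by apply: DeriveDef; [apply/cvg_ex; exists l | exact: cvg_lim].
have [r0 /= r0p Ar0] := proj1 (nbhs_ballP _ _) xA.
rewrite -E; split=> /cvgrPdist_le h; apply/cvgrPdist_le => e e0; have := h e e0;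
  rewrite !near_withinE => /nbhs_ballP[r /= r0' hr]; apply/nbhs_ballP.
- exists (Num.min r r0); first by rewrite /= lt_min r0' r0p.
  move=> k; rewrite /ball /= sub0r normrN lt_min => /andP[k1 k2] k0 /=.
  have := hr (x + k); rewrite /diffq /GRing.scale /= mulr1 (addrC k) [x + k - x]addrC addKr mulrC.
  apply.
  + by rewrite /ball /= opprD addNKr normrN.
  + by rewrite -subr_eq0 addrC addKr.
  + by apply: Ar0; rewrite /ball /= opprD addNKr normrN.
- exists r => // y; rewrite /ball /= => xy yx yA.
  have := hr (y - x); rewrite /diffq /GRing.scale /= mulr1 subrK mulrC; apply.
  + by rewrite /ball /= sub0r normrN distrC.
  + by rewrite subr_eq0.
Qed.

Lemma within_dnbhs A x : nbhs x A -> within A x^' = x^'.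
Proof.
move=> xA; apply/funext => P; apply/propext; split; last exact: cvg_within.
move=> h; have {}h : \forall y \near x, y != x -> A y -> P y := h.
suff: \forall y \near x, y != x -> P y by [].
by near=> y => yx; apply: (near h y) => //; near: y; exact: xA.
Unshelve. all: by end_near. Qed.

Lemma deriv_within_eq A f g x l : nbhs x A -> (\forall y \near x, f y = g y) ->
  is_derive x 1 g l -> deriv_within A f x = l.
Proof.
move=> xA fg dg.
have dl : is_derive x 1 f l.
  by apply: near_eq_is_derive dg; apply: filterS fg => y ->.
have := proj2 (diffq_cvgP f l xA) dl; rewrite /deriv_within within_dnbhs//.
exact: cvg_lim.
Qed.

Lemma derivable_within_is_derive A f x : nbhs x A -> derivable_within A f x ->
  is_derive x 1 f (deriv_within A f x).
Proof. by move=> xA cf; exact: (proj1 (diffq_cvgP f _ xA) cf). Qed.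

Lemma nbhs_itvcc (a b x : R) : a < x < b -> nbhs x `[a, b]%classic.
Proof.
move=> xab; apply: (filterS _ (near_in_itvoo _)); last by rewrite in_itv /=; exact: xab.
by move=> y /=; rewrite !in_itv /= => /andP[/ltW -> /ltW ->].
Qed.

Lemma Cr_is_derive r a b f x k : Cr r `[a, b] f -> a < x < b -> (k < r)%N ->
  is_derive x 1 (derivn_within `[a, b] k f) (derivn_within `[a, b] k.+1 f x).
Proof.
move=> [cf _] xab kr; apply: derivable_within_is_derive; first exact: nbhs_itvcc.
by apply: cf => //=; rewrite in_itv /=; case/andP: xab => /ltW -> /ltW ->.
Qed.

Lemma Cr_norm_le r A f (K : R) j x : (Cr_norm r A f <= K%:E)%E -> (j <= r)%N -> A x ->
  `|derivn_within A j f x| <= K.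
Proof.
move=> h jr Ax; rewrite -lee_fin; apply: le_trans h.
by apply: ereal_sup_ubound; exists j, x.
Qed.

End OneSided.

Section TwiceBounded.
Variable R : realType.
Implicit Types (f g : R -> R) (a b c M N : R).

(** The derivatives are quantified existentially, so that bounds pass through
    products, inverses and compositions without formulas for the derivatives. *)
Definition C2_bounded a b M f : Prop := exists f1 f2 : R -> R, forall x, a < x < b ->
  [/\ is_derive x 1 f (f1 x), is_derive x 1 f1 (f2 x),
      `|f x| <= M, `|f1 x| <= M & `|f2 x| <= M].

Lemma C2_cst a b c : C2_bounded a b `|c| (fun=> c).
Proof.
by exists (fun=> 0), (fun=> 0) => x _; split; rewrite ?normr0 ?normr_ge0//; exact: dvC.
Qed.

Lemma C2_id a b M : 1 <= M -> - M <= a -> b <= M -> C2_bounded a b M id.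
Proof.
move=> M1 aM bM; exists (fun=> 1), (fun=> 0) => x /andP[xa xb]; split.
- exact: dvI.
- exact: dvC.
- by rewrite ler_norml; apply/andP; split; lra.
- by rewrite normr1.
- by rewrite normr0; lra.
Qed.

Lemma C2_le a b M N f : M <= N -> C2_bounded a b M f -> C2_bounded a b N f.
Proof.
move=> MN [f1 [f2 h]]; exists f1, f2 => x /h[? ? ? ? ?].
by split=> //; apply: le_trans MN.
Qed.

Lemma C2_eq a b M f g : (forall x, a < x < b -> f x = g x) ->
  C2_bounded a b M f -> C2_bounded a b M g.
Proof.
move=> fg [f1 [f2 h]]; exists f1, f2 => x xab; have [d1 d2 ? ? ?] := h _ xab; split=> //.
  apply: near_eq_is_derive d1; apply: (filterS _ (near_in_itvoo _)); last first.
    by rewrite in_itv /=; exact: xab.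
  by move=> y /=; rewrite in_itv /= => /fg ->.
by rewrite -fg.
Qed.

Lemma C2_add a b M N f g : C2_bounded a b M f -> C2_bounded a b N g ->
  C2_bounded a b (M + N) (fun x => f x + g x).
Proof.
move=> [f1 [f2 hf]] [g1 [g2 hg]].
exists (fun x => f1 x + g1 x), (fun x => f2 x + g2 x) => x xI.
have [? ? ? ? ?] := hf _ xI; have [? ? ? ? ?] := hg _ xI.
split; try exact: dvD; exact: le_trans (ler_normD _ _) (lerD _ _).
Qed.

Lemma C2_mul a b M N f g : 0 <= M -> 0 <= N ->
  C2_bounded a b M f -> C2_bounded a b N g ->
  C2_bounded a b (4 * (M * N)) (fun x => f x * g x).
Proof.
move=> M0 N0 [f1 [f2 hf]] [g1 [g2 hg]].
exists (fun x => f x * g1 x + g x * f1 x),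
  (fun x => (f x * g2 x + g1 x * f1 x) + (g x * f2 x + f1 x * g1 x)) => x xI.
have [df df1 f0M f1M f2M] := hf _ xI; have [dg dg1 g0N g1N g2N] := hg _ xI.
have MN0 : 0 <= M * N by rewrite mulr_ge0.
have p u v : `|u| <= M -> `|v| <= N -> `|u * v| <= M * N.
  by move=> uM vN; rewrite normrM ler_pM.
have p' u v : `|u| <= N -> `|v| <= M -> `|u * v| <= M * N by move=> uN vM; rewrite mulrC p.
split.
- exact: dvM.
- by apply: dvD; exact: dvM.
- by have := p _ _ f0M g0N; lra.
- by apply: le_trans (ler_normD _ _) _; have := p _ _ f0M g1N; have := p' _ _ g0N f1M; lra.
- have h1 := p _ _ f0M g2N; have h2 := p' _ _ g1N f1M.
  have h3 := p' _ _ g0N f2M; have h4 := p _ _ f1M g1N.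
  apply: le_trans (ler_normD _ _) _.
  by have := ler_normD (f x * g2 x) (g1 x * f1 x); have := ler_normD (g x * f2 x) (f1 x * g1 x); lra.
Qed.

Definition C2_inv_bound M c : R := c^-1 + M * c^-1 ^+ 2 + 2 * M ^+ 2 * c^-1 ^+ 3.

Lemma C2_inv a b M c f : 0 <= M -> 0 < c -> (forall x, a < x < b -> c <= f x) ->
  C2_bounded a b M f -> C2_bounded a b (C2_inv_bound M c) (fun x => (f x)^-1).
Proof.
move=> M0 c0 fc [f1 [f2 hf]].
exists (fun x => -1 * f1 x * (f x * f x)^-1), (fun x => - f2 x * (f x)^-1 ^+ 2 + 2 * (f1 x) ^+ 2 * (f x)^-1 ^+ 3) => x xI.
have [df df1 f0M f1M f2M] := hf _ xI.
have fx0 : 0 < f x by apply: lt_le_trans (fc _ xI).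
have fxn : f x != 0 by rewrite gt_eqF.
have ci : 0 <= c^-1 by rewrite invr_ge0 ltW.
have v0 : `|(f x)^-1| <= c^-1 by rewrite gtr0_norm ?invr_gt0// lef_pV2 ?posrE ?fc.
have vk k : `|(f x)^-1 ^+ k| <= c^-1 ^+ k by rewrite normrX; apply: lerXn2r; rewrite ?nnegrE.
have B1 : 0 <= M * c^-1 ^+ 2 by rewrite mulr_ge0 ?exprn_ge0.
have B2 : 0 <= M ^+ 2 * c^-1 ^+ 3 by rewrite mulr_ge0 ?exprn_ge0 ?sqr_ge0.
rewrite /C2_inv_bound; split.
- by apply: dv_eq (dvV fxn df) _; field.
- apply: dv_eq (dvM (dvZ (-1) df1) (dvV _ (dvM df df))) _; first by rewrite mulf_neq0.
  by field.
- by rewrite -[leLHS]addr0 -addrA lerD// addr_ge0// -mulrA mulr_ge0.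
- rewrite -expr2 -exprVn normrM mulN1r normrN.
  have := ler_pM (normr_ge0 _) (normr_ge0 _) f1M (vk 2%N); clear -B1 B2 ci; lra.
- apply: le_trans (ler_normD _ _) _; rewrite !normrM normrN.
  have h1 := ler_pM (normr_ge0 _) (normr_ge0 _) f2M (vk 2%N).
  have h2 : `|f1 x ^+ 2| <= M ^+ 2 by rewrite normrX; apply: lerXn2r; rewrite ?nnegrE.
  have h3 := ler_pM (normr_ge0 _) (normr_ge0 _) h2 (vk 3%N).
  rewrite (ger0_norm (ler0n _ 2)) -!mulrA.
  by rewrite !normrX in h1 h3; clear -h1 h3 ci; lra.
Qed.

Lemma C2_comp a b c d M N f g : 0 <= M -> 0 <= N ->
  (forall x, a < x < b -> c < f x < d) ->
  C2_bounded a b M f -> C2_bounded c d N g ->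
  C2_bounded a b (N * (1 + M + M ^+ 2)) (fun x => g (f x)).
Proof.
move=> M0 N0 fI [f1 [f2 hf]] [g1 [g2 hg]].
exists (fun x => g1 (f x) * f1 x), (fun x => g1 (f x) * f2 x + f1 x * (g2 (f x) * f1 x)) => x xI.
have [df df1 f0M f1M f2M] := hf _ xI; have [dg dg1 g0N g1N g2N] := hg _ (fI _ xI).
have NM : 0 <= N * M by rewrite mulr_ge0.
have NM2 : 0 <= N * M ^+ 2 by rewrite mulr_ge0 ?sqr_ge0.
rewrite !mulrDr mulr1; split.
- exact: dv_comp.
- by apply: dvM => //; exact: dv_comp.
- by clear -g0N NM NM2; lra.
- have := ler_pM (normr_ge0 _) (normr_ge0 _) g1N f1M; rewrite -normrM; clear -N0 NM2; lra.
- apply: le_trans (ler_normD _ _) _; rewrite !normrM.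
  have h1 := ler_pM (normr_ge0 _) (normr_ge0 _) g1N f2M.
  have h2 := ler_pM (mulr_ge0 (normr_ge0 _) (normr_ge0 _)) (normr_ge0 _)
    (ler_pM (normr_ge0 _) (normr_ge0 _) g2N f1M) f1M.
  rewrite [`|f1 x| * _]mulrC.
  have -> : N * M ^+ 2 = N * M * M by ring.
  clear -h1 h2 N0; lra.
Qed.

End TwiceBounded.

(** * Controlled pairs *)

Section GoodPairs.
Variable R : realType.
Implicit Types (z : map_pair R) (K q M delta x y : R) (d : R -> R).

(** What control, negative Schwarzian and the definition of a commuting pair
    say about the interior of [I_eta] in terms of ordinary derivatives. *)
Record good_pair K z (a : nat) d dd ddd : Prop := GoodPair {
  gp_K : 1 <= K;
  gp_norm : eta z 0 = -1;
  gp_q : K^-1 <= xi z 0 <= K;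
  gp_top : top_pair z;
  gp_lands : lands_in_eta z;
  gp_period : period z = Some a;
  gp_a : (0 < a)%N;
  gp_cont : {within `[0, xi z 0], continuous (eta z)};
  gp_lt : forall x y, 0 <= x -> x < y -> y <= xi z 0 -> eta z x < eta z y;
  gp_d : forall x, 0 < x < xi z 0 -> is_derive x 1 (eta z) (d x);
  gp_dd : forall x, 0 < x < xi z 0 -> is_derive x 1 d (dd x);
  gp_ddd : forall x, 0 < x < xi z 0 -> is_derive x 1 dd (ddd x);
  gp_dK : forall x, 0 < x < xi z 0 -> [/\ `|d x| <= K, `|dd x| <= K & `|ddd x| <= K];
  gp_etaK : forall x, 0 < x < xi z 0 -> `|eta z x| <= K;
  gp_low : forall x, iter a (eta z) (xi z 0) <= x < xi z 0 -> K^-1 <= d x;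
  gp_pos : forall x, 0 < x < xi z 0 -> 0 < d x;
  gp_schw : forall x, 0 < x < xi z 0 ->
    ddd x / d x - 3 / 2 * (dd x / d x) ^+ 2 < 0;
  gp_endq : K^-1 <= xi z 0 - eta z (xi z 0);
  gp_ca : K^-1 <= iter a (eta z) (xi z 0);
  gp_caq : iter a (eta z) (xi z 0) < xi z 0;
  gp_ca1 : iter a.+1 (eta z) (xi z 0) <= - K^-1;
  gp_xi_lip : forall x y, -1 <= x <= 0 -> -1 <= y <= 0 -> `|xi z x - xi z y| <= K * `|x - y| }.

Lemma controlled_top K z : controlled K z -> top_pair z.
Proof.
move=> [[/andP[e0 x0] [[[ei _ _] _] [[[xi_i _ _] _] [[com _] _]]]] _]; split=> // x y lx xy ly.
- move: xy; rewrite le_eqVlt => /orP[/eqP -> //|xy]; apply/ltW/ei => //.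
  + by rewrite /I_eta /= in_itv /=; lra.
  + by rewrite /I_eta /= in_itv /=; lra.
- move: xy; rewrite le_eqVlt => /orP[/eqP -> //|xy]; apply/ltW/xi_i => //.
  + by rewrite /I_xi /= in_itv /=; lra.
  + by rewrite /I_xi /= in_itv /=; lra.
Qed.

Lemma controlled_good K z : 1 < K -> controlled K z -> negative_schwarzian z ->
  exists a, good_pair K z a (derivn_within (I_eta z) 1 (eta z))
    (derivn_within (I_eta z) 2 (eta z)) (derivn_within (I_eta z) 3 (eta z)).
Proof.
move=> K1 ctl [schw _]; have tp := controlled_top ctl.
move: ctl => [[/andP[e0 x0] [[[ei ec _] eC] [[[xi_i xc _] xC] [_ [pos _]]]]] [nz]].
move=> [a [[le per] /= [q12 [endq [step [ca [ca1 [xiK [etaK low]]]]]]]]].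
have Ki : 0 < K^-1 by rewrite invr_gt0; lra.
have [inI _] : is_period_eta z a.
  have /periodP := per; rewrite /is_period; case: asboolP => //.
have a0 : (0 < a)%N.
  by rewrite lt0n; apply/eqP => E; move: step; rewrite E /=; lra.
have cq k : (k <= a)%N -> iter k (eta z) (xi z 0) <= xi z 0.
  by move=> /inI; rewrite /I_eta /= in_itv /= => /andP[].
have mem (x : R) : 0 < x < xi z 0 -> I_eta z x.
  by move=> /andP[h1 h2]; rewrite /I_eta /= in_itv /= !ltW.
exists a; split=> //.
- exact: ltW.
- move=> x y x1 xy y1; apply: ei => //; rewrite /I_eta /= in_itv /=; lra.
- by move=> x xI; apply: (@Cr_is_derive _ 3 0 (xi z 0) (eta z) x 0).
- by move=> x xI; apply: (@Cr_is_derive _ 3 0 (xi z 0) (eta z) x 1).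
- by move=> x xI; apply: (@Cr_is_derive _ 3 0 (xi z 0) (eta z) x 2).
- move=> x /mem xI; split; [exact: (@Cr_norm_le _ 3 _ _ K 1 x etaK) |
    exact: (@Cr_norm_le _ 3 _ _ K 2 x etaK) | exact: (@Cr_norm_le _ 3 _ _ K 3 x etaK)].
- by move=> x /mem xI; apply: (@Cr_norm_le _ 3 _ _ K 0 x etaK).
- by move=> x /andP[h1 /ltW h2]; apply: low; rewrite h1.
- by move=> x xI; apply: pos; [exact: mem | rewrite gt_eqF//; case/andP: xI].
- by move=> x xI; apply: schw; [exact: mem | rewrite gt_eqF//; case/andP: xI].
- by have := cq a.-1 (leq_pred a); lra.
- move=> x y xI yI.
  have L (u : R) : -1 < u < 0 -> is_derive u 1 (xi z) (derivn_within (I_xi z) 1 (xi z) u).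
    by move=> uI; apply: (@Cr_is_derive _ 3 (eta z 0) 0 (xi z) u 0) => //; rewrite nz.
  apply: (@lip_within _ (xi z) (derivn_within (I_xi z) 1 (xi z)) K (-1) 0) => //.
  + lra.
  + by move: xc; rewrite /I_xi nz.
  + move=> u uI; have -> : I_xi z = `[(-1), 0]%classic by rewrite /I_xi nz.
    apply: (@Cr_norm_le _ 3 _ _ K 1 u xiK) => //=; rewrite in_itv /=; lra.
Qed.

Section Facts.
Variables (K : R) (z : map_pair R) (a : nat) (d dd ddd : R -> R).
Hypothesis gp : good_pair K z a d dd ddd.

Lemma gp_q0 : 0 < xi z 0. Proof. exact: top_xi0 (gp_top gp). Qed.

Lemma gp_per : is_period_eta z a.
Proof.
have /periodP := gp_period gp; rewrite /is_period; case: asboolP => // h.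
by case: h; exact: gp_lands gp.
Qed.

Lemma gp_conj_eta_mem y : 0 <= y <= 1 -> -1 <= conj_eta z y <= 1.
Proof.
move=> yI; have q0 := gp_q0; have yI' : -1 <= y <= 1 by lra.
have xI := mobius_inv_mem q0 yI'.
have x0 : 0 <= mobius_inv (-1) (xi z 0) y.
  rewrite -[leLHS](mobius_inv0 (xi z 0)); apply: mobius_inv_le => //; lra.
have Ki : 0 < K^-1 by rewrite invr_gt0; have := gp_K gp; lra.
rewrite /conj_eta (gp_norm gp) /=; apply: mobius_mem => //; apply/andP; split.
  by rewrite -[leLHS](gp_norm gp); apply: (top_eta_homo (gp_top gp)); lra.
apply: (@le_trans _ _ (eta z (xi z 0))); last by have := gp_endq gp; lra.
by apply: (top_eta_homo (gp_top gp)); lra.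
Qed.

Lemma gp_conj_xi_mem y : -1 <= y <= 0 -> -1 <= conj_xi z y <= 1.
Proof.
move=> yI; have q0 := gp_q0; have yI' : -1 <= y <= 1 by lra.
have xI := mobius_inv_mem q0 yI'.
have x0 : mobius_inv (-1) (xi z 0) y <= 0.
  by rewrite -[leRHS](mobius_inv0 (xi z 0)); apply: mobius_inv_le => //; lra.
have /lands_in_etaE/andP[l1 l2] := gp_lands gp; rewrite (gp_norm gp) in l1 l2.
rewrite /conj_xi (gp_norm gp) /=; apply: mobius_mem => //; apply/andP; split.
  apply: (@le_trans _ _ (xi z (-1))); first lra.
  by apply: (top_xi_homo (gp_top gp)); rewrite ?(gp_norm gp); lra.
by apply: (top_xi_homo (gp_top gp)); rewrite ?(gp_norm gp); lra.
Qed.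

Lemma gp_base_map : base_map K (xi z 0) (iter a (eta z) (xi z 0))
  (fun x => eta z (clamp 0 (xi z 0) x)) d dd ddd.
Proof.
have q0 := gp_q0; have Ki : 0 < K^-1 by rewrite invr_gt0; have := gp_K gp; lra.
have ca := gp_ca gp; have caq := gp_caq gp; have ca1 := gp_ca1 gp.
have cl x : 0 <= x <= xi z 0 -> eta z (clamp 0 (xi z 0) x) = eta z x.
  by move=> xI; rewrite clamp_id.
have hom : {homo (fun x => eta z (clamp 0 (xi z 0) x)) : x y / x <= y}.
  move=> x y xy; have /andP[x1 x2] := clamp_mem x (ltW q0).
  have /andP[y1 y2] := clamp_mem y (ltW q0).
  by apply: (top_eta_homo (gp_top gp)) => //; exact: clamp_homo.
have itE k : (k <= a)%N ->
    iter k (fun x => eta z (clamp 0 (xi z 0) x)) (xi z 0) = iter k (eta z) (xi z 0).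
  elim: k => [//|k IH ka]; rewrite iterS (IH (ltnW ka)); apply: cl.
  by have [inI _] := gp_per; have := inI k (ltnW ka); rewrite /I_eta /= in_itv.
split=> //.
- exact: gp_K gp.
- by case/andP: (gp_q gp).
- by apply: within_clamp => //; exact: gp_cont gp.
- move=> x xI; apply: near_eq_is_derive (gp_d gp xI).
  apply: (filterS _ (near_in_itvoo _)); last by rewrite in_itv /=; exact: xI.
  by move=> y /=; rewrite in_itv /= => /andP[y1 y2]; rewrite cl// !ltW.
- exact: gp_dd gp.
- exact: gp_ddd gp.
- by move=> x /(gp_dK gp)[].
- by move=> x /(gp_dK gp)[].
- by move=> x /(gp_dK gp)[].
- exact: gp_low gp.
- exact: gp_pos gp.
- exact: gp_schw gp.
- by rewrite cl; [exact: gp_endq gp | rewrite lexx ltW].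
- by rewrite cl; [rewrite /= in ca1; lra | lra].
- move=> x; rewrite -itE// => xI; apply: (no_fixpoint hom) xI.
  by rewrite itE// cl; [rewrite /= in ca1; lra | lra].
Qed.

End Facts.

End GoodPairs.

(** * A pair read in the coordinate of another one *)

Section CommonCoordinate.
Variable R : realType.
Implicit Types (z : map_pair R) (K q M delta x y : R) (d : R -> R).

(** The maps of [z] in the coordinate in which the pair lives on [-1, q], extended
    by constants to the whole line. *)
Definition hat_eta q z x : R :=
  mobius_inv (-1) q (conj_eta z (mobius (-1) q (clamp 0 q x))).
Definition hat_xi q z x : R :=
  mobius_inv (-1) q (conj_xi z (mobius (-1) q (clamp (-1) 0 x))).
Definition hat_coord q z x : R := mobius_inv (-1) q (mobius (-1) (xi z 0) x).

Lemma cont_comp (f g : R -> R) x : {for x, continuous f} -> {for f x, continuous g} ->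
  {for x, continuous (fun y => g (f y))}.
Proof. exact: continuous_comp. Qed.

Section Facts.
Variables (K : R) (z : map_pair R) (a : nat) (d dd ddd : R -> R) (q : R).
Hypotheses (gp : good_pair K z a d dd ddd) (q0 : 0 < q).

Lemma hat_coord_lt x y : -1 <= x -> x < y -> y <= xi z 0 -> hat_coord q z x < hat_coord q z y.
Proof.
move=> x1 xy y1; have q1 := q0; have p0 := gp_q0 gp.
have /andP[mx _] : -1 <= mobius (-1) (xi z 0) x <= 1 by apply: mobius_mem => //; lra.
have /andP[_ my] : -1 <= mobius (-1) (xi z 0) y <= 1 by apply: mobius_mem => //; lra.
by apply: mobius_inv_lt => //; exact: mobius_lt.
Qed.

Lemma hat_coord0 : hat_coord q z 0 = 0.
Proof. by rewrite /hat_coord mobius0 mobius_inv0. Qed.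

Lemma hat_coord_end : hat_coord q z (xi z 0) = q.
Proof.
by rewrite /hat_coord mobius_end ?(gp_q0 gp)// mobius_inv_end.
Qed.

Lemma hat_coord_start : hat_coord q z (-1) = -1.
Proof. by rewrite /hat_coord mobius_start ?(gp_q0 gp)// mobius_inv_start. Qed.

Lemma hat_coord_le x y : -1 <= x -> x <= y -> y <= xi z 0 -> hat_coord q z x <= hat_coord q z y.
Proof.
by move=> x1; rewrite le_eqVlt => /orP[/eqP -> //|xy] yq; apply/ltW/hat_coord_lt.
Qed.

Lemma hat_coord_mem x : 0 <= x <= xi z 0 -> 0 <= hat_coord q z x <= q.
Proof.
move=> /andP[x1 x2]; apply/andP; split.
  by rewrite -[leLHS]hat_coord0; apply: hat_coord_le => //; lra.
by rewrite -[leRHS]hat_coord_end; apply: hat_coord_le => //; lra.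
Qed.

Lemma hat_models : models z (hat_coord q z) (hat_eta q z) (hat_xi q z).
Proof.
have q1 := q0; have p0 := gp_q0 gp; have nz := gp_norm gp; split.
- exact: hat_coord0.
- by rewrite nz => x y; exact: hat_coord_lt.
- move=> x xI; rewrite /hat_eta clamp_id ?hat_coord_mem//.
  have mx : -1 <= mobius (-1) (xi z 0) x <= 1 by apply: mobius_mem => //; lra.
  by rewrite /hat_coord mobius_invK1// /conj_eta nz /= mobiusK//; lra.
- rewrite nz => x xI; rewrite /hat_xi.
  have mx : -1 <= mobius (-1) (xi z 0) x <= 1 by apply: mobius_mem => //; lra.
  rewrite clamp_id; last first.
    apply/andP; split; first by case/andP: (mobius_inv_mem q0 mx).
    by rewrite -[leRHS]hat_coord0; apply: hat_coord_le; lra.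
  by rewrite /hat_coord mobius_invK1// /conj_xi nz /= mobiusK//; lra.
Qed.

Lemma unhat_mem y : 0 <= y <= 1 -> 0 <= mobius_inv (-1) (xi z 0) y <= xi z 0.
Proof.
move=> yI; have q1 := q0; have p0 := gp_q0 gp; apply/andP; split; last first.
  by have /andP[] := @mobius_inv_mem _ (xi z 0) y p0 ltac:(lra).
by rewrite -[leLHS](mobius_inv0 (xi z 0)); apply: mobius_inv_le => //; lra.
Qed.

Lemma unhat_mem' y : -1 <= y <= 0 -> -1 <= mobius_inv (-1) (xi z 0) y <= 0.
Proof.
move=> yI; have q1 := q0; have p0 := gp_q0 gp; apply/andP; split.
  by have /andP[] := @mobius_inv_mem _ (xi z 0) y p0 ltac:(lra).
by rewrite -[leRHS](mobius_inv0 (xi z 0)); apply: mobius_inv_le => //; lra.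
Qed.

Lemma coord_mem x : 0 <= x <= q -> 0 <= mobius (-1) q x <= 1.
Proof.
move=> xI; have q1 := q0; apply/andP; split; last by have /andP[] := @mobius_mem _ q x q0 ltac:(lra).
by rewrite -[leLHS](mobius0 q); apply: mobius_le => //; lra.
Qed.

Lemma coord_mem' x : -1 <= x <= 0 -> -1 <= mobius (-1) q x <= 0.
Proof.
move=> xI; have q1 := q0; apply/andP; split; first by have /andP[] := @mobius_mem _ q x q0 ltac:(lra).
by rewrite -[leRHS](mobius0 q); apply: mobius_le => //; lra.
Qed.

Lemma clamp_coord x : 0 <= mobius (-1) q (clamp 0 q x) <= 1.
Proof. by apply: coord_mem; apply: clamp_mem; exact: ltW. Qed.

Lemma clamp_coord' x : -1 <= mobius (-1) q (clamp (-1) 0 x) <= 0.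
Proof. by apply: coord_mem'; apply: clamp_mem; lra. Qed.

Lemma hat_eta_homo : {homo hat_eta q z : x y / x <= y}.
Proof.
move=> x y xy; have q1 := q0; have p0 := gp_q0 gp.
have mx := clamp_coord x; have my := clamp_coord y.
have cxy : mobius (-1) q (clamp 0 q x) <= mobius (-1) q (clamp 0 q y).
  have h1 := clamp_mem x (ltW q0); have h2 := clamp_mem y (ltW q0).
  by have h := clamp_homo 0 q xy; apply: mobius_le => //; lra.
have cx := gp_conj_eta_mem gp mx; have cy := gp_conj_eta_mem gp my.
rewrite /hat_eta; apply: mobius_inv_le => //; try by [case/andP: cx|case/andP: cy].
have ux := unhat_mem mx; have uy := unhat_mem my.
have u : mobius_inv (-1) (xi z 0) (mobius (-1) q (clamp 0 q x)) <=
  mobius_inv (-1) (xi z 0) (mobius (-1) q (clamp 0 q y)) by apply: mobius_inv_le => //; lra.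
have Ki : 0 < K^-1 by rewrite invr_gt0; have := gp_K gp; lra.
rewrite /conj_eta (gp_norm gp) /=; apply: mobius_le => //.
- by rewrite -[leLHS](gp_norm gp); apply: (top_eta_homo (gp_top gp)); lra.
- by apply: (top_eta_homo (gp_top gp)); lra.
- apply: (@le_trans _ _ (eta z (xi z 0))); last by have := gp_endq gp; lra.
  by apply: (top_eta_homo (gp_top gp)); lra.
Qed.

Lemma hat_xi_homo : {homo hat_xi q z : x y / x <= y}.
Proof.
move=> x y xy; have q1 := q0; have p0 := gp_q0 gp.
have mx := clamp_coord' x; have my := clamp_coord' y.
have cxy : mobius (-1) q (clamp (-1) 0 x) <= mobius (-1) q (clamp (-1) 0 y).
  have h1 := @clamp_mem _ (-1) 0 x ltac:(lra); have h2 := @clamp_mem _ (-1) 0 y ltac:(lra).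
  by have h := clamp_homo (-1) 0 xy; apply: mobius_le => //; lra.
have cx := gp_conj_xi_mem gp mx; have cy := gp_conj_xi_mem gp my.
rewrite /hat_xi; apply: mobius_inv_le => //; try by [case/andP: cx|case/andP: cy].
have ux := unhat_mem' mx; have uy := unhat_mem' my.
have u : mobius_inv (-1) (xi z 0) (mobius (-1) q (clamp (-1) 0 x)) <=
  mobius_inv (-1) (xi z 0) (mobius (-1) q (clamp (-1) 0 y)) by apply: mobius_inv_le => //; lra.
have /lands_in_etaE/andP[l1 l2] := gp_lands gp; rewrite (gp_norm gp) in l1 l2.
rewrite /conj_xi (gp_norm gp) /=; apply: mobius_le => //.
- apply: (@le_trans _ _ (xi z (-1))); first lra.
  by apply: (top_xi_homo (gp_top gp)); rewrite ?(gp_norm gp); lra.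
- by apply: (top_xi_homo (gp_top gp)); rewrite ?(gp_norm gp); lra.
- by apply: (top_xi_homo (gp_top gp)); rewrite ?(gp_norm gp); lra.
Qed.

Lemma hat_eta_ge x : -1 <= hat_eta q z x.
Proof.
have := gp_conj_eta_mem gp (clamp_coord x).
move=> h; have h' : -1 <= conj_eta z (mobius (-1) q (clamp 0 q x)) <= 1 by lra.
by case/andP: (mobius_inv_mem q0 h').
Qed.

Lemma hat_xi_mem x : hat_eta q z q <= hat_xi q z x <= q.
Proof.
have md := hat_models; have tp := gp_top gp; have q1 := q0; have p0 := gp_q0 gp; have nz := gp_norm gp.
have X0 : hat_xi q z 0 = q.
  have := @models_xi _ _ _ _ _ md 0; rewrite hat_coord0 hat_coord_end; apply.
  by rewrite nz lexx andbT; lra.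
have X1 : hat_xi q z (-1) = hat_eta q z q.
  have := @models_eta _ _ _ _ _ md (xi z 0); rewrite hat_coord_end (top_com tp) nz => ->; last first.
    by rewrite lexx andbT ltW.
  by have := @models_xi _ _ _ _ _ md (-1); rewrite hat_coord_start; apply; rewrite nz lexx; lra.
have c x' : hat_xi q z x' = hat_xi q z (clamp (-1) 0 x').
  by rewrite /hat_xi [in RHS]clamp_id// clamp_mem//; lra.
have /andP[h1 h2] := @clamp_mem _ (-1) 0 x ltac:(lra).
rewrite c; apply/andP; split; [rewrite -X1 | rewrite -[leRHS]X0]; exact: hat_xi_homo.
Qed.

Lemma hat_eta_cont : continuous (hat_eta q z).
Proof.
move=> x; have q1 := q0; have p0 := gp_q0 gp; have nz := gp_norm gp.
pose g y := eta z (clamp 0 (xi z 0) y).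
have cg : continuous g by apply: within_clamp => //; exact: gp_cont gp.
have -> : hat_eta q z = fun x => mobius_inv (-1) q (mobius (-1) (xi z 0)
    (g (mobius_inv (-1) (xi z 0) (mobius (-1) q (clamp 0 q x))))).
  apply/funext => y; by rewrite /hat_eta /conj_eta nz /= /g (clamp_id (unhat_mem (clamp_coord y))).
have m := clamp_coord x; have cx := gp_conj_eta_mem gp m.
have xq := clamp_mem x (ltW q0).
have ux := unhat_mem m.
have Ki : 0 < K^-1 by rewrite invr_gt0; have := gp_K gp; lra.
have gx : -1 <= g (mobius_inv (-1) (xi z 0) (mobius (-1) q (clamp 0 q x))) <= xi z 0.
  rewrite /g (clamp_id ux); apply/andP; split.
    by rewrite -[leLHS](gp_norm gp); apply: (top_eta_homo (gp_top gp)); lra.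
  apply: (@le_trans _ _ (eta z (xi z 0))); last by have := gp_endq gp; lra.
  by apply: (top_eta_homo (gp_top gp)); lra.
have xq' : -1 <= clamp 0 q x <= q by lra.
have m' : -1 <= mobius (-1) q (clamp 0 q x) <= 1 by lra.
have c1 := cont_comp (@clamp_cont _ 0 q x) (mobius_cont q0 xq').
have c2 := cont_comp c1 (mobius_inv_cont p0 m').
have c3 := cont_comp (cont_comp c2 (cg _)) (mobius_cont p0 gx).
exact: (cont_comp c3 (mobius_inv_cont q0 (mobius_mem p0 gx))).
Qed.

End Facts.

End CommonCoordinate.

(** * Closeness of pairs *)

Section Closeness.
Variable R : realType.
Implicit Types (z : map_pair R) (K q M delta x y : R) (d : R -> R).

Lemma C2_opp a b M (f : R -> R) : C2_bounded a b M f -> C2_bounded a b M (fun x => - f x).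
Proof.
move=> [f1 [f2 h]]; exists (fun x => -1 * f1 x), (fun x => -1 * f2 x) => x /h[h1 h2 b0 b1 b2].
split; [|exact: dvZ|by rewrite normrN|by rewrite mulN1r normrN|by rewrite mulN1r normrN].
by apply: near_eq_is_derive (dvZ (-1) h1); near=> t; rewrite mulN1r.
Unshelve. all: by end_near. Qed.

Lemma C2_cst_le a b c M : `|c| <= M -> C2_bounded a b M (fun=> c : R).
Proof. by move=> cM; apply: C2_le cM _; exact: C2_cst. Qed.

Lemma C2_inv_bound_ge0 M c : 0 <= M -> 0 < c -> 0 <= C2_inv_bound M c :> R.
Proof.
move=> M0 c0; have ci : 0 <= c^-1 by rewrite invr_ge0 ltW.
by rewrite /C2_inv_bound; nonneg.
Qed.

(** The denominator of the inverse coordinate change is at least 1/K on [-1, 1]. *)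
Lemma C2_inv_den K q a b M (f : R -> R) : 1 <= K -> K^-1 <= q <= K -> 0 <= M ->
  (forall x, a < x < b -> -1 <= f x <= 1) -> C2_bounded a b M f ->
  C2_bounded a b (C2_inv_bound ((K + 1) + 4 * ((K + 1) * M)) K^-1)
    (fun x => ((q + 1) - (q - 1) * f x)^-1).
Proof.
move=> K1 /andP[q1 q2] M0 fI cf; have Ki : 0 < K^-1 by rewrite invr_gt0; lra.
have KM : 0 <= (K + 1) * M by rewrite mulr_ge0; lra.
apply: C2_inv => //; [lra | by move=> x /fI; exact: mobius_inv_den_ge |].
apply: C2_add; first by apply: C2_cst_le; rewrite ger0_norm; lra.
apply: C2_opp; apply: C2_mul => //; first lra.
by apply: C2_cst_le; rewrite ler_norml; lra.
Qed.

Lemma C2_mobius K : 1 <= K -> exists2 M, 0 <= M &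
  forall q, K^-1 <= q <= K -> C2_bounded (-1) q M (mobius (-1) q).
Proof.
move=> K1; have Ki : 0 < K^-1 by rewrite invr_gt0; lra.
pose M1 := 4 * ((K + 1) * K); have M10 : 0 <= M1 by rewrite /M1 !mulr_ge0//; lra.
exists (4 * (M1 * C2_inv_bound (M1 + 2 * K) K^-1)).
  by rewrite !mulr_ge0 ?C2_inv_bound_ge0//; lra.
move=> q /andP[q1 q2].
have id : C2_bounded (-1) q K (fun x => x) by apply: C2_id; lra.
have -> : mobius (-1) q = fun x => (q + 1) * x * ((q - 1) * x + 2 * q)^-1.
  by apply/funext => x; rewrite mobiusE.
apply: C2_mul => //; first by rewrite C2_inv_bound_ge0//; lra.
  apply: C2_mul id; [lra|lra|].
  by apply: C2_cst_le; rewrite ger0_norm; lra.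
apply: C2_inv => //; [lra | by move=> x xI; apply: mobius_den_ge => //; lra |].
apply: C2_add; last by apply: C2_cst_le; rewrite ger0_norm; lra.
apply: C2_mul id; [lra|lra|].
by apply: C2_cst_le; rewrite ler_norml; lra.
Qed.

Lemma C2_mobius_inv K : 1 <= K -> exists2 M, 0 <= M &
  forall q, K^-1 <= q <= K -> C2_bounded 0 1 M (mobius_inv (-1) q).
Proof.
move=> K1; have Ki : 0 < K^-1 by rewrite invr_gt0; lra.
pose I := C2_inv_bound ((K + 1) + 4 * ((K + 1) * 1)) K^-1.
have I0 : 0 <= I by rewrite C2_inv_bound_ge0//; lra.
exists (4 * (4 * (2 * K * 1) * I)); first by rewrite !mulr_ge0//; lra.
move=> q qI; have /andP[q1 q2] := qI.
have id : C2_bounded 0 1 1 (fun x : R => x) by apply: C2_id; lra.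
have -> : mobius_inv (-1) q = fun x => 2 * q * x * ((q + 1) - (q - 1) * x)^-1.
  by apply/funext => x; rewrite mobius_invE.
apply: C2_mul => //; first by rewrite !mulr_ge0//; lra.
  apply: C2_mul id => //; first by rewrite !mulr_ge0//; lra.
  by apply: C2_cst_le; rewrite ger0_norm; lra.
by apply: C2_inv_den => //; move=> x xI; lra.
Qed.

Lemma C2_conj K : 1 <= K -> exists2 M, 0 <= M & forall z a d dd ddd,
  good_pair K z a d dd ddd -> C2_bounded 0 1 M (conj_eta z).
Proof.
move=> K1; have [MA MA0 hA] := C2_mobius K1; have [MB MB0 hB] := C2_mobius_inv K1.
pose M1 := K * (1 + MB + MB ^+ 2).
have M10 : 0 <= M1 by rewrite /M1; nonneg; lra.
exists (MA * (1 + M1 + M1 ^+ 2)); first by rewrite mulr_ge0 ?addr_ge0 ?sqr_ge0.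
move=> z a d dd ddd gp; have q0 := gp_q0 gp; rewrite /conj_eta (gp_norm gp).
have inI x : 0 < x < 1 -> 0 < mobius_inv (-1) (xi z 0) x < xi z 0.
  move=> xI; apply/andP; split.
    by rewrite -[ltLHS](mobius_inv0 (xi z 0)); apply: mobius_inv_lt => //; lra.
  by rewrite -[ltRHS](mobius_inv_end q0); apply: mobius_inv_lt => //; lra.
have ceta : C2_bounded 0 (xi z 0) K (eta z).
  exists d, dd => x xI; have [? ? _] := gp_dK gp xI.
  by split; [exact: gp_d gp _ xI | exact: gp_dd gp _ xI | exact: gp_etaK gp _ xI | |].
have K0 : 0 <= K by lra.
have cB := C2_comp MB0 K0 inI (hB _ (gp_q gp)) ceta.
apply: (C2_comp M10 MA0 _ cB (hA _ (gp_q gp))) => x /inI/andP[x1 x2].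
have := gp_endq gp; have := gp_lt gp (lexx 0) x1 (ltW x2); rewrite (gp_norm gp).
have Ki : 0 < K^-1 by rewrite invr_gt0; lra.
have := gp_lt gp (ltW x1) x2 (lexx _); lra.
Qed.

(** Closeness in terms of ordinary derivatives on the open interval. *)
Definition close delta z0 z1 : Prop :=
  [/\ `|xi z0 0 - xi z1 0| <= delta,
      forall y, -1 <= y <= 0 -> `|conj_xi z0 y - conj_xi z1 y| <= delta,
      forall y, 0 <= y <= 1 -> `|conj_eta z0 y - conj_eta z1 y| <= delta &
      C2_bounded 0 1 delta (fun y => conj_eta z0 y - conj_eta z1 y)].

Lemma close_sym delta z0 z1 : close delta z0 z1 -> close delta z1 z0.
Proof.
move=> [h1 h2 h3 h4]; split.
- by rewrite distrC.
- by move=> y yI; rewrite distrC h2.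
- by move=> y yI; rewrite distrC h3.
- by apply: C2_eq (C2_opp h4) => x _; rewrite opprB.
Qed.

Lemma close_dist K delta z0 z1 a d dd ddd a' d' dd' ddd' :
  good_pair K z0 a d dd ddd -> good_pair K z1 a' d' dd' ddd' ->
  (pair_dist 2 z0 z1 <= delta%:E)%E -> close delta z0 z1.
Proof.
move=> g0 g1; rewrite /pair_dist !ge_max => /andP[hq /andP[hx he]]; split.
- move: hq; rewrite lee_fin (gp_norm g0) (gp_norm g1) !invrN invr1 !mulrN1.
  by rewrite -opprD normrN.
- move=> y yI; have mem : `[(-1), 0]%classic y by rewrite /= in_itv.
  exact: (@Cr_norm_le _ 2 _ (fun y => conj_xi z0 y - conj_xi z1 y) delta 0 y hx).
- move=> y yI; have mem : `[0, 1]%classic y by rewrite /= in_itv.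
  exact: (@Cr_norm_le _ 2 _ (fun y => conj_eta z0 y - conj_eta z1 y) delta 0 y he).
- have [M M0 cM] := C2_conj (gp_K g0).
  have [f1 [f2 hf]] := C2_add (cM _ _ _ _ _ g0) (C2_opp (cM _ _ _ _ _ g1)).
  set f := fun y => conj_eta z0 y - conj_eta z1 y in he hf *.
  have mem (x : R) : 0 < x < 1 -> `[0, 1]%classic x.
    by move=> /andP[x0 x1]; rewrite /= in_itv /= !ltW.
  have d1 x : 0 < x < 1 -> derivn_within `[0, 1] 1 f x = f1 x.
    move=> xI; have [h _ _ _ _] := hf _ xI.
    by apply: (@deriv_within_eq _ _ _ f) h; [exact: nbhs_itvcc | near=> y].
  have d2 x : 0 < x < 1 -> derivn_within `[0, 1] 2 f x = f2 x.
    move=> xI; have [_ h _ _ _] := hf _ xI.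
    apply: (@deriv_within_eq _ _ _ f1) h; first exact: nbhs_itvcc.
    apply: (filterS _ (near_in_itvoo _)); last by rewrite in_itv /=; exact: xI.
    by move=> y /=; rewrite in_itv /=; exact: d1.
  exists f1, f2 => x xI; have [h1 h2 _ _ _] := hf _ xI; split=> //.
  + exact: (@Cr_norm_le _ 2 _ f delta 0 x he _ (mem _ xI)).
  + by rewrite -d1//; exact: (@Cr_norm_le _ 2 _ f delta 1 x he _ (mem _ xI)).
  + by rewrite -d2//; exact: (@Cr_norm_le _ 2 _ f delta 2 x he _ (mem _ xI)).
Unshelve. all: by end_near. Qed.

Lemma hat_etaE K z a d dd ddd x : good_pair K z a d dd ddd ->
  hat_eta (xi z 0) z x = eta z (clamp 0 (xi z 0) x).
Proof.
move=> gp; have q0 := gp_q0 gp; have m := @clamp_mem _ 0 (xi z 0) x (ltW q0).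
have Ki : 0 < K^-1 by rewrite invr_gt0; have := gp_K gp; lra.
rewrite /hat_eta /conj_eta (gp_norm gp) /= (mobiusK q0 (x := clamp _ _ _)); last lra.
apply: mobiusK => //; apply/andP; split.
  by rewrite -[leLHS](gp_norm gp); apply: (top_eta_homo (gp_top gp)); lra.
apply: (@le_trans _ _ (eta z (xi z 0))); last by have := gp_endq gp; lra.
by apply: (top_eta_homo (gp_top gp)); lra.
Qed.

Lemma hat_xiE K z a d dd ddd x : good_pair K z a d dd ddd ->
  hat_xi (xi z 0) z x = xi z (clamp (-1) 0 x).
Proof.
move=> gp; have q0 := gp_q0 gp; have m := @clamp_mem _ (-1) 0 x ltac:(lra).
rewrite /hat_xi /conj_xi (gp_norm gp) /= (mobiusK q0 (x := clamp _ _ _)); last lra.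
have /lands_in_etaE/andP[l1 l2] := gp_lands gp; rewrite (gp_norm gp) in l1 l2.
apply: mobiusK => //; apply/andP; split.
  apply: (@le_trans _ _ (xi z (-1))); first lra.
  by apply: (top_xi_homo (gp_top gp)); rewrite ?(gp_norm gp); lra.
by apply: (top_xi_homo (gp_top gp)); rewrite ?(gp_norm gp); lra.
Qed.

(** In the common coordinate the difference of the two maps is the difference of
    the conjugated maps times a smooth factor, composed with the coordinate. *)
Lemma small_hat K : 1 <= K -> exists2 C, 1 <= C &
  forall z0 a0 d0 dd0 ddd0 z1 a1 d1 dd1 ddd1 delta,
  good_pair K z0 a0 d0 dd0 ddd0 -> good_pair K z1 a1 d1 dd1 ddd1 -> 0 <= delta ->
  close delta z0 z1 -> let q := xi z0 0 in
  [/\ exists e1 e2, small_map (C * delta) q (fun x => hat_eta q z1 x - eta z0 (clamp 0 q x)) e1 e2,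
      forall x, `|hat_eta q z1 x - hat_eta q z0 x| <= C * delta &
      forall x, `|hat_xi q z1 x - hat_xi q z0 x| <= C * delta].
Proof.
move=> K1; have [MA MA0 hA] := C2_mobius K1; have [M M0 hM] := C2_conj K1.
pose I := C2_inv_bound ((K + 1) + 4 * ((K + 1) * M)) K^-1.
have Ki : 0 < K^-1 by rewrite invr_gt0; lra.
have I0 : 0 <= I by rewrite C2_inv_bound_ge0// addr_ge0 ?mulr_ge0//; lra.
have K1' : 0 <= 2 * K * (K + 1) by rewrite !mulr_ge0//; lra.
pose A := 1 + MA + MA ^+ 2.
have A0 : 0 <= A by rewrite /A; nonneg.
pose C1 := 4 * (2 * K * (K + 1) * (4 * (4 * (I * I)))) * A.
have C10 : 0 <= C1 by rewrite /C1; nonneg.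
have K4 : 0 <= 4 * K ^+ 4 by rewrite mulr_ge0 ?exprn_ge0//; lra.
exists (1 + C1 + 4 * K ^+ 4); first by lra.
move=> z0 a0 d0 dd0 ddd0 z1 a1 d1 dd1 ddd1 delta g0 g1 dl0 [_ cxi ceta cE] q.
have q0 : 0 < q := gp_q0 g0; have qI : K^-1 <= q <= K := gp_q g0; have /andP[q1 q2] := qI.
have dC : C1 * delta <= (1 + C1 + 4 * K ^+ 4) * delta by rewrite ler_wpM2r//; lra.
have dK : 4 * K ^+ 4 * delta <= (1 + C1 + 4 * K ^+ 4) * delta by rewrite ler_wpM2r//; lra.
split.
- suff [e1 [e2 h]] : C2_bounded 0 q (C1 * delta) (fun x => hat_eta q z1 x - eta z0 (clamp 0 q x)).
    exists e1, e2; split=> x /h[h1 h2 h3 h4 h5] //; exact: le_trans dC.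
  pose D (y : R) := (q + 1) - (q - 1) * y.
  pose W y := 2 * q * (q + 1) * ((conj_eta z1 y - conj_eta z0 y) *
      ((D (conj_eta z1 y))^-1 * (D (conj_eta z0 y))^-1)).
  have cl (x : R) : 0 < x < 1 -> 0 <= x <= 1 by lra.
  have c1 : C2_bounded 0 1 I (fun y => (D (conj_eta z1 y))^-1).
    by apply: (C2_inv_den K1 qI M0 _ (hM _ _ _ _ _ g1)) => x /cl; exact: gp_conj_eta_mem g1 _.
  have c0 : C2_bounded 0 1 I (fun y => (D (conj_eta z0 y))^-1).
    by apply: (C2_inv_den K1 qI M0 _ (hM _ _ _ _ _ g0)) => x /cl; exact: gp_conj_eta_mem g0 _.
  have cE' : C2_bounded 0 1 delta (fun y => conj_eta z1 y - conj_eta z0 y).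
    by apply: C2_eq (C2_opp cE) => x _; rewrite opprB.
  have II : 0 <= 4 * (I * I) by rewrite !mulr_ge0.
  have cq : C2_bounded 0 1 (2 * K * (K + 1)) (fun=> 2 * q * (q + 1)).
    have q10 : 0 <= q * (q + 1) by rewrite mulr_ge0//; lra.
    have qK : q * (q + 1) <= K * (K + 1) by rewrite ler_pM//; lra.
    by apply: C2_cst_le; rewrite -!mulrA ger0_norm; lra.
  have cW := C2_mul K1' (mulr_ge0 (ler0n _ 4) (mulr_ge0 dl0 II)) cq
    (C2_mul dl0 II cE' (C2_mul I0 I0 c1 c0)).
  have inA x : 0 < x < q -> 0 < mobius (-1) q x < 1.
    move=> xI; apply/andP; split.
      by rewrite -[ltLHS](mobius0 q); apply: mobius_lt => //; lra.
    by rewrite -[ltRHS](mobius_end q0); apply: mobius_lt => //; lra.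
  have cA : C2_bounded 0 q MA (mobius (-1) q).
    have [e1 [e2 h]] := hA _ (gp_q g0).
    by exists e1, e2 => x xI; apply: h; have : -1 < x < q by lra.
  have := C2_comp MA0 _ inA cA cW; rewrite -/A => h.
  have -> : C1 * delta = 4 * (2 * K * (K + 1) * (4 * (delta * (4 * (I * I))))) * A.
    by rewrite /C1; ring.
  apply: C2_eq (h _); last by nonneg.
  move=> x xI; rewrite -(hat_etaE x g0) /hat_eta -/q clamp_id; last by case/andP: xI => *; rewrite !ltW.
  have mI := cl _ (inA _ xI).
  have m1 := gp_conj_eta_mem g1 mI; have m0 := gp_conj_eta_mem g0 mI.
  have D1 := mobius_inv_den_gt0 q0 m1; have D0 := mobius_inv_den_gt0 q0 m0.
  rewrite mobius_inv_sub// /D; field.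
  by rewrite !gt_eqF.
- move=> x; apply: le_trans dK; have mI := clamp_coord q0 x.
  have m1 := gp_conj_eta_mem g1 mI; have m0 := gp_conj_eta_mem g0 mI.
  apply: le_trans (mobius_inv_lip K1 (gp_q g0) m1 m0) _.
  by rewrite ler_wpM2l// distrC ceta.
- move=> x; apply: le_trans dK; have mI := clamp_coord' q0 x.
  have m1 := gp_conj_xi_mem g1 mI; have m0 := gp_conj_xi_mem g0 mI.
  apply: le_trans (mobius_inv_lip K1 (gp_q g0) m1 m0) _.
  by rewrite ler_wpM2l// distrC cxi.
Qed.

End Closeness.

(** * Synchronization *)

Section Synchronization.
Variable R : realType.
Implicit Types (z : map_pair R) (K q M delta x y kappa : R) (d : R -> R).

(** The gap is only needed for the first return maps and for their
    compositions with the first branch: the pairs obtained by renormalizing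
    twice are made of these maps. *)
Lemma ordered_return_contra kappa z0 z1 th0 th1 F0 X0 F1 X1 a : 0 < kappa ->
  top_pair z0 -> top_pair z1 -> lands_in_eta z0 -> lands_in_eta z1 ->
  infinitely_renormalizable z0 -> infinitely_renormalizable z1 ->
  (forall j, period (iter j (@renorm R) z0) = period (iter j (@renorm R) z1)) ->
  period z0 = Some a ->
  models z0 th0 F0 X0 -> models z1 th1 F1 X1 ->
  {homo F0 : x y / x <= y} -> {homo X0 : x y / x <= y} ->
  (forall y, iter a F0 (X0 y) + kappa <= iter a F1 (X1 y)) ->
  (forall y, iter a F0 (X0 (F0 y)) + kappa <= iter a F1 (X1 (F1 y))) -> False.
Proof.
move=> k0 tp0 tp1 le0 le1 ir0 ir1 same pa md0 md1 hF hX gX gXF.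
have pa1 : period z1 = Some a by rewrite -pa; have := same 0%N.
have [_ tp0' le0' md0'] := renorm_eta tp0 md0 le0 pa (ir0 1%N).
have [_ tp1' le1' md1'] := renorm_eta tp1 md1 le1 pa1 (ir1 1%N).
have [b pb] := inf_period (inf_renormS ir0).
have pb1 : period (renorm z1) = Some b by rewrite -pb; have := same 1%N.
have [b0 tp0'' le0'' md0''] := renorm_xi tp0' md0' le0' pb (ir0 2%N).
have [_ tp1'' le1'' md1''] := renorm_xi tp1' md1' le1' pb1 (ir1 2%N).
have hG : {homo iter a F0 \o X0 : x y / x <= y}.
  by move=> x y xy /=; apply: iter_homo => //; exact: hX.
apply: (ordered_contra k0 tp0'' tp1'' le0'' le1'' (inf_renormS (inf_renormS ir0))
  (inf_renormS (inf_renormS ir1)) _ md0'' md1'' _ hG _ gX).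
- by move=> j; have := same j.+2; rewrite !iterSr.
- by move=> x y xy /=; apply: iter_homo => //; exact: hF.
- move=> x /=; have [n ->] : exists n, b = n.+1 by exists b.-1; rewrite prednK.
  rewrite !iterSr; elim: n => [|n IH] /=; first exact: gXF.
  by apply: le_trans (gX _); rewrite lerD2r; apply: hG; apply: le_trans IH; rewrite lerDl ltW.
Qed.

(** If the landing point of the second pair were too high, [gap_core] would
    order the return maps of the two pairs. *)
Lemma landing_le K : 1 <= K -> exists2 dl, 0 < dl & exists2 L, 0 <= L &
  forall z0 z1 a d0 dd0 ddd0 d1 dd1 ddd1 delta,
  good_pair K z0 a d0 dd0 ddd0 -> good_pair K z1 a d1 dd1 ddd1 ->
  infinitely_renormalizable z0 -> infinitely_renormalizable z1 ->
  (forall j, period (iter j (@renorm R) z0) = period (iter j (@renorm R) z1)) ->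
  0 < delta -> delta < dl -> close delta z0 z1 ->
  iter a (eta z1) (xi z1 0) <= iter a (eta z0) (xi z0 0) + L * delta.
Proof.
move=> K1; have [C C1 small] := small_hat K1.
have J0 : 0 <= 1 + K by lra.
have [dl dl0 [L L0 core]] := gap_core K1 J0.
have K2 : 0 <= 4 * K ^+ 2 by rewrite mulr_ge0 ?sqr_ge0.
exists (dl / C); first by rewrite divr_gt0//; lra.
exists (L * C + 4 * K ^+ 2); first by rewrite addr_ge0// mulr_ge0//; lra.
move=> z0 z1 a d0 dd0 ddd0 d1 dd1 ddd1 delta g0 g1 ir0 ir1 same dt0 dtl cl.
have [[e1 [e2 sm]] ceta cxi] := small _ _ _ _ _ _ _ _ _ _ _ g0 g1 (ltW dt0) cl.
have cq : `|xi z0 0 - xi z1 0| <= delta by case: cl.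
set q := xi z0 0 in sm ceta cxi cq *.
have q0 : 0 < q := gp_q0 g0.
have Cd0 : 0 < C * delta by rewrite mulr_gt0//; lra.
have Cdl : C * delta < dl by rewrite mulrC -ltr_pdivlMr//; lra.
pose m := iter a (eta z0) q.
pose f0 x := eta z0 (clamp 0 q x).
have f0E : hat_eta q z0 = f0 by apply/funext => x; exact: hat_etaE g0.
have md0 := hat_models g0 q0; have md1 := hat_models g1 q0.
have hf0 := hat_eta_homo g0 q0; have hX0 := hat_xi_homo g0 q0.
have hF1 := hat_eta_homo g1 q0.
have land z a' d' dd' ddd' : good_pair K z a' d' dd' ddd' ->
    iter a' (hat_eta q z) q = hat_coord q z (iter a' (eta z) (xi z 0)).
  move=> g; have md := hat_models g q0; have nz := gp_norm g.
  have zI : eta z 0 <= (0 : R) <= 0 by rewrite nz; lra.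
  have := models_iter_eta (gp_top g) md (gp_per g) zI (leqnn a').
  by rewrite hat_coord0 (models_xi0 (gp_top g) md) (hat_coord_end g q0).
have f0_ge x : -1 <= f0 x by rewrite -f0E; exact: hat_eta_ge g0 q0 x.
have X0_mem x : f0 q <= hat_xi q z0 x <= q by rewrite -f0E; exact: hat_xi_mem g0 q0 x.
have land0 : iter a f0 q = m.
  rewrite -f0E (land _ _ _ _ _ g0) /hat_coord mobiusK ?(gp_q0 g0)//.
  have Ki : 0 < K^-1 by rewrite invr_gt0; lra.
  by have := gp_ca g0; have := gp_caq g0; rewrite -/q -/m; lra.
rewrite f0E in md0 hf0 ceta.
have Ki : 0 < K^-1 by rewrite invr_gt0; lra.
have c1I : 0 <= iter a (eta z1) (xi z1 0) <= xi z1 0.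
  by have := gp_ca g1; have := gp_caq g1; lra.
have goal : iter a (hat_eta q z1) q <= m + L * (C * delta).
  rewrite leNgt; apply/negP => big.
  have FE : hat_eta q z1 = fun x => f0 x + (hat_eta q z1 x - f0 x).
    by apply/funext => x; rewrite addrC subrK.
  have neg : hat_eta q z1 (iter a (hat_eta q z1) q) <= 0.
    rewrite (land _ _ _ _ _ g1) (models_eta md1)// -[leRHS](hat_coord0 z1 q).
    apply: (hat_coord_le g1 q0).
    - by rewrite -[leLHS](gp_norm g1); apply: (top_eta_homo (gp_top g1)); lra.
    - by have := gp_ca1 g1; rewrite /=; lra.
    - by have := gp_q0 g1; lra.
  have gap := core _ _ _ _ _ _ _ _ _ _ a (hat_eta q z1) (gp_base_map g0) sm Cd0 Cdl FE hf0 hF1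
    (hat_eta_cont g1 q0) f0_ge (hat_eta_ge g1 q0) (gp_a g0) land0 big neg.
  have CJ : C * delta <= (1 + K) * (C * delta) by rewrite ler_peMl ?ltW//; lra.
  apply: (@ordered_return_contra (C * delta) z0 z1 _ _ _ _ _ _ a Cd0 (gp_top g0) (gp_top g1)
    (gp_lands g0) (gp_lands g1) ir0 ir1 same (gp_period g0) md0 md1 hf0 hX0) => y.
  - apply: gap; [exact: X0_mem | exact: hat_xi_mem g1 q0 _ |].
    exact: le_trans (cxi _) CJ.
  - apply: gap; [exact: X0_mem | exact: hat_xi_mem g1 q0 _ |].
    rewrite -(subrKA (hat_xi q z0 (hat_eta q z1 y))) mulrDl mul1r.
    apply: le_trans (ler_normD _ _) _; apply: lerD; first exact: cxi.
    rewrite !(hat_xiE _ g0).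
    apply: le_trans (gp_xi_lip g0 _ _) _; [apply: clamp_mem; lra | apply: clamp_mem; lra |].
    rewrite ler_wpM2l//; first lra.
    exact: le_trans (clamp_lip _ _ _ _) (ceta _).
rewrite (land _ _ _ _ _ g1) in goal.
have c1E : iter a (eta z1) (xi z1 0) =
    mobius_inv (-1) (xi z1 0) (mobius (-1) (xi z1 0) (iter a (eta z1) (xi z1 0))).
  by rewrite mobiusK ?(gp_q0 g1)//; lra.
have par := mobius_inv_param K1 (proj1 (andP (gp_q g0))) (proj1 (andP (gp_q g1)))
  (coord_mem (gp_q0 g1) c1I).
rewrite -c1E -/q -/(hat_coord q z1 _) in par.
have := le_trans par (ler_wpM2l K2 cq); rewrite ler_norml => /andP[h _].
rewrite -/m; clear -h goal; lra.
Qed.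

End Synchronization.

Theorem mainTheorem5 (R : realType) (K0 : R) (hK0 : 1 < K0) :
  exists e0 L : R, 0 < e0 /\ 1 < L /\
    forall z0 z1 : map_pair R,
      controlled K0 z0 -> controlled K0 z1 ->
      negative_schwarzian z0 -> negative_schwarzian z1 ->
      infinitely_renormalizable z0 -> infinitely_renormalizable z1 ->
      rotation_number z0 = rotation_number z1 ->
      0 <= rotation_number z0 <= 1 ->
      irrational (rotation_number z0) ->
      (pair_dist 2 z0 z1 < e0%:E)%E ->
      synchronized L z0 z1.
Proof.
have K1 := ltW hK0; have [e0 e00 [L L0 half]] := landing_le K1.
exists e0, (L + 2); split=> //; split; first by lra.
move=> z0 z1 ct0 ct1 ns0 ns1 ir0 ir1 rho _ irr dist.
have [a g0] := controlled_good hK0 ct0 ns0; have [b g1] := controlled_good hK0 ct1 ns1.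
have same := rotation_number_inj (gp_top g0) (gp_top g1) ir0 ir1 rho irr.
have ba : b = a.
  by have := same 0%N; rewrite /= (gp_period g0) (gp_period g1) => -[].
rewrite {}ba in g1.
exists a; split; [exact: gp_period g0 | exact: gp_period g1 |].
have D0 : (0 <= pair_dist 2 z0 z1)%E by rewrite /pair_dist le_max lee_fin normr_ge0.
have [D DE] : exists D, pair_dist 2 z0 z1 = D%:E.
  exists (fine (pair_dist 2 z0 z1)); rewrite fineK//.
  by rewrite ge0_fin_numE//; apply: lt_trans dist (ltry _).
rewrite DE lee_fin lte_fin in D0 dist *; rewrite -EFinM lee_fin.
set X := `|_|.
have near dt : 0 < dt -> D <= dt -> dt < e0 -> X <= L * dt.
  move=> dt0 Ddt dte.
  have cl : close dt z0 z1 by apply: (close_dist g0 g1); rewrite DE lee_fin.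
  have h1 := half _ _ _ _ _ _ _ _ _ _ g0 g1 ir0 ir1 same dt0 dte cl.
  have h2 := half _ _ _ _ _ _ _ _ _ _ g1 g0 ir1 ir0 (fun j => esym (same j)) dt0 dte (close_sym cl).
  by rewrite /X ler_norml; apply/andP; split; lra.
have [D1|D1] := ltP 0 D.
  by have h := near D D1 (lexx _) dist; apply: le_trans h _; rewrite ler_wpM2r// ; lra.
have -> : D = 0 by apply/le_anti; rewrite D0 D1.
rewrite mulr0; apply/ler_addgt0Pr => eps eps0; rewrite add0r.
have L1 : 0 < L + 1 by lra.
pose dt := Num.min (e0 / 2) (eps / (L + 1)).
have dt0 : 0 < dt by rewrite lt_min !divr_gt0.
have dte : dt < e0 by rewrite gt_min; apply/orP; left; lra.
apply: le_trans (near _ dt0 _ dte) _; first by lra.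
apply: (@le_trans _ _ ((L + 1) * dt)); first by rewrite ler_wpM2r ?ltW//; lra.
by rewrite -ler_pdivlMl// mulrC ge_min lexx orbT.
Qed.
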